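(* Let $n\ge1$, $r\ge 1$, and let $P\in\Psi^{r+n-1}(\mathbb{R}^d,\mathbb{R}^d)$ have a Hermitian symbol compactly supported in $x$. Let $q>1+d/2$ and $r\le q$. Then there is a constant $C>0$ such that for all $w\in C_c^\infty(\mathbb{R}^d,\mathbb{R}^d)$ and $f_1,\dots,f_n\in C_c^\infty(\mathbb{R}^d,\mathbb{R})$, $$\|S_{n,P}(f_1,\dots,f_n)w\|_{H^{q-r}}\le C\,\|f_1\|_{H^q}\cdots\|f_n\|_{H^q}\,\|w\|_{H^{q-1}},$$ where $S_{n,P}(f_1,f_2,\dots,f_n):=[f_1,[f_2,\cdots[f_n,P]\cdots]]$.
   Context: Each $f_i$ is identified with the operator of multiplication by $f_i$, and $[\cdot,\cdot]$ is the commutator of operators. $\|f\|_{H^q}=\|\langle\xi\rangle^q\hat f\|_{L^2}$ with $\langle\xi\rangle=(1+|\xi|^2)^{1/2}$ and $\hat f(\xi)=\int_{\mathbb{R}^d}e^{-2\pi i\langle x,\xi\rangle}f(x)\,dx$ (componentwise for vector-valued functions). For $m\in\mathbb{R}$, $\mathbf{S}^m(\mathbb{R}^d\times\mathbb{R}^d,M_d(\mathbb{C}))$ is the set of smooth $M_d(\mathbb{C})$-valued functions $p(x,\xi)$ with $|\partial_x^\beta\partial_\xi^\alpha p(x,\xi)|\le C_{\alpha,\beta}\langle\xi\rangle^{m-|\alpha|}$ for all multi-indices $\alpha,\beta$. $\Psi^m(\mathbb{R}^d,\mathbb{R}^d)$ is the class of operators $Pu(x)=\int e^{2\pi i x\cdot\xi}p(x,\xi)\hat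 u(\xi)\,d\xi$ with $p\in\mathbf{S}^m$. ''Compactly supported in $x$'' means there is a compact $K\subset\mathbb{R}^d$ with $p(x,\xi)=0$ for all $x\notin K$ and all $\xi$. *)

(* Defs.v *)
From HB Require Import structures.
From mathcomp Require Import all_boot all_order all_algebra.
From mathcomp Require Import all_classical all_reals all_analysis.
From mathcomp Require Import complex.

Set Implicit Arguments.
Unset Strict Implicit.
Unset Printing Implicit Defensive.

Import Order.TTheory GRing.Theory Num.Theory.
Import numFieldNormedType.Exports.

Local Open Scope classical_set_scope.
Local Open Scope ring_scope.
Local Open Scope complex_scope.

Section LebesgueRn.
Context {R : realType}.

Definition cons_pair n (x : measurableTypeR R * n.-tuple (measurableTypeR R)) :
  n.+1.-tuple (measurableTypeR R) := [tuple of x.1 :: x.2].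
Definition uncons_pair n (t : n.+1.-tuple (measurableTypeR R)) :
  measurableTypeR R * n.-tuple (measurableTypeR R) :=
  (thead t, [tuple of behead t]).

Lemma cons_pairK n : cancel (@cons_pair n) (@uncons_pair n).
Proof. by case=> a t; congr pair; apply: val_inj. Qed.

Lemma measurable_cons_pair n : measurable_fun setT (@cons_pair n).
Proof. exact: measurable_cons. Qed.

Lemma measurable_uncons_pair n : measurable_fun setT (@uncons_pair n).
Proof.
apply: measurable_fun_pair => /=; last exact: measurable_behead.
exact: measurable_tnth.
Qed.

Section step.
Variables (n : nat)
  (m : {sigma_finite_measure set n.-tuple (measurableTypeR R) -> \bar R}).

Definition leb_step : set (n.+1.-tuple (measurableTypeR R)) -> \bar R :=
  pushforward (lebesgue_measure \x m)%E (@cons_pair n).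

Let leb_step0 : leb_step set0 = 0%E.
Proof. by rewrite /leb_step /pushforward preimage_set0 measure0. Qed.

Let leb_step_ge0 A : (0 <= leb_step A)%E.
Proof. by rewrite /leb_step /pushforward. Qed.

Let leb_step_sigma_additive : semi_sigma_additive leb_step.
Proof.
move=> F mF tF mUF; rewrite /leb_step /pushforward preimage_bigcup.
apply: measure_semi_sigma_additive.
- by move=> k; rewrite -[X in measurable X]setTI; exact: measurable_cons_pair.
- apply/trivIsetP => /= i j _ _ ij; rewrite -preimage_setI.
  by move/trivIsetP : tF => /(_ _ _ _ _ ij) ->//; rewrite preimage_set0.
- rewrite -preimage_bigcup -[X in measurable X]setTI.
  exact: measurable_cons_pair.
Qed.

HB.instance Definition _ := isMeasure.Build _ _ _ leb_step
  leb_step0 leb_step_ge0 leb_step_sigma_additive.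

Let leb_step_sigma_finite : sigma_finite setT leb_step.
Proof.
have /sigma_finiteP[F [TF ndF Foo]] :
  sigma_finite setT (@lebesgue_measure R) by exact: sigma_finiteT.
have /sigma_finiteP[G [TG ndG Goo]] := sigma_finiteT m.
exists (fun k => @uncons_pair n @^-1` (F k `*` G k)) => [|k].
  apply/esym; rewrite -subTset => t _ /=.
  have [i _ Fi] : (\bigcup_i F i) (thead t) by rewrite -TF.
  have [j _ Gj] : (\bigcup_j G j) [tuple of behead t] by rewrite -TG.
  exists (maxn i j) => //; split => /=.
    by move: Fi; exact/subsetPset/ndF/leq_maxl.
  by move: Gj; exact/subsetPset/ndG/leq_maxr.
have [mF Fk] := Foo k; have [mG Gk] := Goo k; split.
  rewrite -[X in measurable X]setTI; apply: measurable_uncons_pair => //.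
  exact: measurableX.
rewrite /leb_step /pushforward -comp_preimage.
rewrite (_ : _ \o _ = id) ?preimage_id; last first.
  by apply/funext => z; exact: cons_pairK.
by rewrite product_measure1E// lte_mul_pinfty// ge0_fin_numE.
Qed.

HB.instance Definition _ := Measure_isSigmaFinite.Build _ _ _ leb_step
  leb_step_sigma_finite.
End step.

(* Lebesgue measure of R^d, as the d-fold product of that of R. *)
Fixpoint lebesgue_tuple (d : nat) :
    {sigma_finite_measure set d.-tuple (measurableTypeR R) -> \bar R} :=
  if d is d'.+1 then leb_step (lebesgue_tuple d') else \d_([tuple]).
End LebesgueRn.

Section Calculus.
Context {R : realType}.

Definition iterD (V : normedModType R) (vs : seq V) (g : V -> R) : V -> R :=
  foldr (fun v h => fun x => 'D_v h x) g vs.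

(* On the finite-dimensional spaces used here this is C^oo: iterated
   directional derivatives of every order exist and are continuous. *)
Definition smooth (V : normedModType R) (g : V -> R) : Prop :=
  forall vs : seq V, continuous (iterD vs g) /\
    forall x v, derivable (iterD vs g) x v.

Definition csmooth (V : normedModType R) (g : V -> R[i]) : Prop :=
  smooth (fun x => complex.Re (g x)) /\ smooth (fun x => complex.Im (g x)).

Definition iterDC (V : normedModType R) (vs : seq V) (g : V -> R[i]) (x : V) :
    R[i] :=
  iterD vs (fun y => complex.Re (g y)) x
    +i* iterD vs (fun y => complex.Im (g y)) x.

Definition compact_support (V : normedModType R) (W : nmodType) (g : V -> W) :
    Prop :=
  exists K : set V, compact K /\ forall x, ~ K x -> g x = 0.

End Calculus.

Section Euclidean.
Context {R : realType}.
Variable d : nat.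

Definition dotR (x y : 'rV[R]_d) : R := \sum_i x 0 i * y 0 i.

(* The bracket <xi>. Here |xi| is the Euclidean norm: the library's `|xi| on
   'rV[R]_d is the sup norm. *)
Definition japanese (xi : 'rV[R]_d) : R := Num.sqrt (1 + dotR xi xi).

Definition cnorm k (v : 'cV[R[i]]_k) : R :=
  Num.sqrt (\sum_i (ComplexField.Normc.normc (v i 0)) ^+ 2).

Definition cis (t : R) : R[i] := cos t +i* sin t.

Definition rV_of_tuple (t : d.-tuple (measurableTypeR R)) : 'rV[R]_d :=
  \row_i tnth t i.

Definition integralC (F : 'rV[R]_d -> R[i]) : R[i] :=
  (\int[lebesgue_tuple d]_t complex.Re (F (rV_of_tuple t)))
    +i* (\int[lebesgue_tuple d]_t complex.Im (F (rV_of_tuple t))).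

Definition fourier k (u : 'rV[R]_d -> 'cV[R[i]]_k) (xi : 'rV[R]_d) :
    'cV[R[i]]_k :=
  \col_i integralC (fun x => cis (- (2 * pi * dotR x xi)) * u x i 0).

(* Extended-real valued, so that an infinite norm is not read as 0. *)
Definition sobolev_norm (q : R) k (u : 'rV[R]_d -> 'cV[R[i]]_k) : \bar R :=
  Lnorm (lebesgue_tuple d) 2%:E (fun t =>
    (japanese (rV_of_tuple t) `^ q * cnorm (fourier u (rV_of_tuple t)))%:E).

Definition complexify k (w : 'rV[R]_d -> 'cV[R]_k) (x : 'rV[R]_d) :
    'cV[R[i]]_k := \col_i (w x i 0)%:C.

Definition scalar_field (f : 'rV[R]_d -> R) (x : 'rV[R]_d) : 'cV[R]_1 :=
  \col__ f x.

Definition test_function (f : 'rV[R]_d -> R) : Prop :=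
  smooth f /\ compact_support f.

Definition test_vector k (w : 'rV[R]_d -> 'cV[R]_k) : Prop :=
  forall i, test_function (fun x => w x i 0).

Definition test_cvector k (u : 'rV[R]_d -> 'cV[R[i]]_k) : Prop :=
  forall i, csmooth (fun x => u x i 0) /\ compact_support (fun x => u x i 0).

End Euclidean.

Section PseudoDifferential.
Context {R : realType}.
Variable d : nat.

Definition symbol := 'rV[R]_d -> 'rV[R]_d -> 'M[R[i]]_d.
Definition operator := ('rV[R]_d -> 'cV[R[i]]_d) -> 'rV[R]_d -> 'cV[R[i]]_d.

Definition order_multi (alpha : 'I_d -> nat) : nat := (\sum_i alpha i)%N.

(* Directions of differentiation in d_x^beta d_xi^alpha; any matrix norm gives
   the same symbol_class, which bounds the entries. *)
Definition multi_dirs (beta alpha : 'I_d -> nat) :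
    seq ('rV[R]_d * 'rV[R]_d)%type :=
  flatten [seq nseq (beta i) (delta_mx 0 i : 'rV[R]_d, 0 : 'rV[R]_d)
          | i <- enum 'I_d]
  ++ flatten [seq nseq (alpha i) (0 : 'rV[R]_d, delta_mx 0 i : 'rV[R]_d)
             | i <- enum 'I_d].

Definition symbol_class (m : R) (p : symbol) : Prop :=
  (forall i j, csmooth (fun z : 'rV[R]_d * 'rV[R]_d => p z.1 z.2 i j)) /\
  forall alpha beta : 'I_d -> nat, exists C : R, forall x xi i j,
    ComplexField.Normc.normc (iterDC (multi_dirs beta alpha)
      (fun z : 'rV[R]_d * 'rV[R]_d => p z.1 z.2 i j) (x, xi))
    <= C * japanese xi `^ (m - (order_multi alpha)%:R).

Definition Op (p : symbol) : operator := fun u x =>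
  \col_i integralC (fun xi => cis (2 * pi * dotR x xi) *
                              (p x xi *m fourier u xi) i 0).

(* P belongs to Psi^m, with symbol p. The oscillatory formula is imposed on
   C_c^oo(R^d, C^d) only: elsewhere its integrals need not converge. *)
Definition Psi (m : R) (P : operator) (p : symbol) : Prop :=
  symbol_class m p /\
  forall u, test_cvector u -> forall x, P u x = Op p u x.

(* Each matrix p(x, xi) is Hermitian: p(x, xi)^* = p(x, xi). *)
Definition hermitian_symbol (p : symbol) : Prop :=
  forall x xi, p x xi \is hermsymmx.

Definition x_compact_support (p : symbol) : Prop :=
  exists K : set 'rV[R]_d, compact K /\
    forall x, ~ K x -> forall xi, p x xi = 0.

Definition mulop (f : 'rV[R]_d -> R) : operator := fun u x => (f x)%:C *: u x.

Definition commop (A B : operator) : operator := fun u x =>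
  A (B u) x - B (A u) x.

Definition S_op (P : operator) (fs : seq ('rV[R]_d -> R)) : operator :=
  foldr (fun f Q => commop (mulop f) Q) P fs.

End PseudoDifferential.

(* Main.v *)
(** On the Fourier side [P] acts through the kernel [k(theta, zeta)], the Fourier transform at
    [theta] of [x |-> p(x, zeta)], and commuting with [f] replaces a kernel [k] by
      [(theta, zeta) |-> \int f^(xi) (k(theta - xi, zeta) - k(theta - xi, zeta + xi)) dxi].
    Thus [S_{n,P}] only involves [n]-fold differences of [k] in [zeta].  As [p] has order
    [r + n - 1] and compact support in [x], the difference with steps [xi_1, ..., xi_n] is
      [O(<theta>^-N <xi_1>...<xi_n> (<zeta> + <xi_1> + ... + <xi_n>)^(r-1))] for every [N].
    Distributing the weight [<eta>^(q-r)] over the frequencies bounds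
    [<eta>^(q-r) |(S_{n,P}(f_1,...,f_n) w)^(eta)|] by a sum of convolutions of the
    [<xi> |f_i^(xi)|], of [|w^|] and of [<theta>^-M], in each of which exactly one of the factors
    coming from the [f_i] and [w] carries the extra weight [<.>^(q-1)].  By Young's inequality
    that factor is measured in [L^2] and the others in [L^1]; since [q - 1 > d/2], the [L^1] norms
    are controlled by the [L^2] norms with weight [<.>^(q-1)]. *)

From HB Require Import structures.
From mathcomp Require Import all_boot all_order all_algebra.
From mathcomp Require Import all_classical all_reals all_analysis.
From mathcomp Require Import measurable_realfun complex.
From mathcomp Require Import ring lra.
(* Imported last, since ssrnat also defines an [iterD]. *)
Require Import Defs.

Set Implicit Arguments.
Unset Strict Implicit.
Unset Printing Implicit Defensive.

Import Order.TTheory GRing.Theory Num.Theory.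
Import numFieldNormedType.Exports.

Local Open Scope classical_set_scope.
Local Open Scope ring_scope.
Local Open Scope complex_scope.

(** The whole weight lands on a single factor because the exponents q - r and r - 1 are both
    nonnegative and add up to q - 1. Let X be the sum of <zeta> and the <xi_i>. Then <eta> <= 2
    <theta> X, so <eta>^(q-r) X^(r-1) is at most a constant times <theta>^(q-r) X^(q-1), and X^(q-1)
    is at most a constant times the sum of the separate powers. The factor <xi_i> left over from
    each difference raises the weight on f_i from q - 1 to q; w receives no such factor. The formula
    for P is available on C_c^oo inputs only. So P is only ever applied to w multiplied by some of
    the f_i, and multiplication by f_i on the left becomes a convolution through Fourier inversion
    for f_i alone, the other factor being merely integrable. Fourier transforms are never
    differentiated and nothing is integrated by parts: smoothness in x and in zeta enters through
    finite differences, estimated by the mean value theorem. *)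

Local Notation normc := ComplexField.Normc.normc.

(** * Lebesgue measure on row vectors and its affine changes of variables *)

Section MeasurableRV.
Context {R : realType}.

(** Row vectors carry the algebra and the topology, tuples carry the measure of the statement.
    Transporting the sigma-algebra, and later the measure, along the bijection makes everything
    available on one type. *)
Definition measurable_rV d : set (set 'rV[R]_d) :=
  [set A | measurable (@rV_of_tuple R d @^-1` A)].

Let measurable_rV0 d : @measurable_rV d set0.
Proof. by rewrite /measurable_rV /= preimage_set0. Qed.

Let measurable_rVC d A : @measurable_rV d A -> measurable_rV (~` A).
Proof. by rewrite /measurable_rV /= preimage_setC; exact: measurableC. Qed.

Let measurable_rV_bigcup d (F : (set 'rV[R]_d)^nat) :
  (forall i, measurable_rV (F i)) -> measurable_rV (\bigcup_i F i).
Proof.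
move=> mF; rewrite /measurable_rV /= preimage_bigcup.
by apply: bigcup_measurable => i _; exact: mF.
Qed.

HB.instance Definition _ d := @isMeasurable.Build default_measure_display
  'rV[R]_d (@measurable_rV d) (@measurable_rV0 d) (@measurable_rVC d)
  (@measurable_rV_bigcup d).

Lemma measurable_rV_of_tuple d : measurable_fun setT (@rV_of_tuple R d).
Proof. by move=> _ A mA; rewrite setTI. Qed.

Definition tuple_of_rV d (x : 'rV[R]_d) : d.-tuple (measurableTypeR R) :=
  [tuple x 0 i | i < d].

Lemma rV_of_tupleK d : cancel (@rV_of_tuple R d) (@tuple_of_rV d).
Proof. by move=> t; apply: eq_from_tnth => i; rewrite tnth_mktuple mxE. Qed.

Lemma tuple_of_rVK d : cancel (@tuple_of_rV d) (@rV_of_tuple R d).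
Proof. by move=> x; apply/rowP => i; rewrite mxE tnth_mktuple. Qed.

Lemma measurable_tuple_of_rV d : measurable_fun setT (@tuple_of_rV d).
Proof.
move=> _ A mA; rewrite setTI /measurable /= /measurable_rV /= -comp_preimage.
by rewrite (_ : _ \o _ = id) ?preimage_id//; apply/funext; exact: rV_of_tupleK.
Qed.

Lemma measurable_coord d (i : 'I_d) :
  measurable_fun setT (fun x : 'rV[R]_d => x 0 i).
Proof.
rewrite (_ : (fun _ => _) = (@tnth _ _ ^~ i) \o @tuple_of_rV d); last first.
  by apply/funext => x /=; rewrite tnth_mktuple.
by apply: measurableT_comp; [exact: measurable_tnth|exact: measurable_tuple_of_rV].
Qed.

Lemma measurable_fun_rV d d' (T : measurableType d') (f : T -> 'rV[R]_d) :
  (forall i, measurable_fun setT (fun t => f t 0 i)) -> measurable_fun setT f.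
Proof.
move=> mf; rewrite (_ : f = @rV_of_tuple R d \o (@tuple_of_rV d \o f)); last first.
  by apply/funext => t /=; rewrite tuple_of_rVK.
apply: measurableT_comp; first exact: measurable_rV_of_tuple.
apply/measurable_fun_tnthP => i.
suff -> : @tnth _ _ ^~ i \o (@tuple_of_rV d \o f) = fun t => f t 0 i by exact: mf.
by apply/funext => t /=; rewrite tnth_mktuple.
Qed.

Lemma measurable_rV_add d d' (T : measurableType d') (f g : T -> 'rV[R]_d) :
  measurable_fun setT f -> measurable_fun setT g ->
  measurable_fun setT (fun t => f t + g t).
Proof.
move=> mf mg; apply: measurable_fun_rV => i.
under eq_fun do rewrite mxE.
by apply: measurable_funD; apply: (measurableT_comp (measurable_coord i)).
Qed.

Lemma measurable_rV_scale d d' (T : measurableType d') (a : R) (f : T -> 'rV[R]_d) :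
  measurable_fun setT f -> measurable_fun setT (fun t => a *: f t).
Proof.
move=> mf; apply: measurable_fun_rV => i.
under eq_fun do rewrite mxE.
by apply: measurable_funM => //; apply: (measurableT_comp (measurable_coord i)).
Qed.

Lemma measurable_rV_opp d d' (T : measurableType d') (f : T -> 'rV[R]_d) :
  measurable_fun setT f -> measurable_fun setT (fun t => - f t).
Proof.
move=> mf; under eq_fun do rewrite -scaleN1r.
exact: measurable_rV_scale.
Qed.

Lemma measurable_rV_sub d d' (T : measurableType d') (f g : T -> 'rV[R]_d) :
  measurable_fun setT f -> measurable_fun setT g ->
  measurable_fun setT (fun t => f t - g t).
Proof. by move=> mf mg; apply: measurable_rV_add => //; exact: measurable_rV_opp. Qed.

Definition lebesgue_rV d := pushforward (@lebesgue_tuple R d) (@rV_of_tuple R d).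

Let lebesgue_rV0 d : @lebesgue_rV d set0 = 0%E.
Proof. by rewrite /lebesgue_rV /pushforward preimage_set0 measure0. Qed.

Let lebesgue_rV_ge0 d A : (0 <= @lebesgue_rV d A)%E.
Proof. by rewrite /lebesgue_rV /pushforward. Qed.

Let lebesgue_rV_sigma_additive d : semi_sigma_additive (@lebesgue_rV d).
Proof.
move=> F mF tF mUF; rewrite /lebesgue_rV /pushforward preimage_bigcup.
apply: measure_semi_sigma_additive => //.
apply/trivIsetP => /= i j _ _ ij; rewrite -preimage_setI.
by move/trivIsetP : tF => /(_ _ _ _ _ ij) ->//; rewrite preimage_set0.
Qed.

HB.instance Definition _ d := isMeasure.Build _ _ _ (@lebesgue_rV d)
  (@lebesgue_rV0 d) (@lebesgue_rV_ge0 d) (@lebesgue_rV_sigma_additive d).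

Let lebesgue_rV_sigma_finite d : sigma_finite setT (@lebesgue_rV d).
Proof.
have [F TF Foo] : sigma_finite setT (@lebesgue_tuple R d) by exact: sigma_finiteT.
exists (fun k => @tuple_of_rV d @^-1` F k) => [|k].
  by rewrite -preimage_bigcup -TF preimage_setT.
have [mF Fk] := Foo k; split.
  by rewrite -[X in measurable X]setTI; exact: measurable_tuple_of_rV.
rewrite /lebesgue_rV /pushforward -comp_preimage.
by rewrite (_ : _ \o _ = id) ?preimage_id//; apply/funext; exact: rV_of_tupleK.
Qed.

HB.instance Definition _ d := Measure_isSigmaFinite.Build _ _ _ (@lebesgue_rV d)
  (@lebesgue_rV_sigma_finite d).

(** No integrability is required: both integrals are by definition the integral of the positive part
    minus that of the negative part, and these agree separately. *)
Lemma eq_integral_nonneg d1 d2 (X : measurableType d1) (Y : measurableType d2)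
    (mu : {measure set X -> \bar R}) (nu : {measure set Y -> \bar R}) (phi : X -> Y) :
  (forall f : Y -> \bar R, measurable_fun setT f -> (forall y, 0 <= f y)%E ->
    \int[nu]_y f y = \int[mu]_x f (phi x))%E ->
  forall f : Y -> \bar R, measurable_fun setT f ->
    (\int[nu]_y f y = \int[mu]_x f (phi x))%E.
Proof.
move=> H f mf; rewrite integralE [RHS]integralE.
rewrite H//; last exact: measurable_funepos.
rewrite [X in (_ - X)%E = _]H//; last exact: measurable_funeneg.
by congr (_ - _)%E; apply: eq_integral => x _; rewrite !unlock.
Qed.

Lemma ge0_integral_lebesgue_tuple d (f : 'rV[R]_d -> \bar R) :
  measurable_fun setT f -> (forall x, 0 <= f x)%E ->
  (\int[@lebesgue_rV d]_x f x = \int[lebesgue_tuple d]_t f (rV_of_tuple t))%E.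
Proof.
move=> mf f0; rewrite ge0_integral_pushforward ?preimage_setT//.
exact: measurable_rV_of_tuple.
Qed.

Lemma integral_lebesgue_tuple d (f : 'rV[R]_d -> \bar R) :
  measurable_fun setT f ->
  (\int[@lebesgue_rV d]_x f x = \int[lebesgue_tuple d]_t f (rV_of_tuple t))%E.
Proof.
move=> mf; apply: (eq_integral_nonneg (@ge0_integral_lebesgue_tuple d)) => //.
Qed.

Lemma integral_lebesgue_rV0 (f : 'rV[R]_0 -> \bar R) :
  measurable_fun setT f -> (\int[@lebesgue_rV 0]_x f x = f 0%R)%E.
Proof.
move=> mf; rewrite integral_lebesgue_tuple//= integral_dirac//.
by rewrite diracT mul1e; congr f; apply/rowP; case.
Qed.

Definition cons_rV d (x : R) (y : 'rV[R]_d) : 'rV[R]_d.+1 :=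
  \row_i oapp (fun j => y 0 j) x (unlift ord0 i).

Lemma cons_rV0 d x (y : 'rV[R]_d) : cons_rV x y 0 ord0 = x.
Proof. by rewrite mxE unlift_none. Qed.

Lemma cons_rVS d x (y : 'rV[R]_d) i : cons_rV x y 0 (lift ord0 i) = y 0 i.
Proof. by rewrite mxE liftK. Qed.

Lemma cons_rVP d (P : 'I_d.+1 -> Prop) : P ord0 -> (forall i, P (lift ord0 i)) ->
  forall i, P i.
Proof. by move=> P0 PS i; case: (unliftP ord0 i) => [j ->|->]. Qed.

Lemma rV_of_tuple_cons d x (t : d.-tuple (measurableTypeR R)) :
  rV_of_tuple (cons_pair (x, t)) = cons_rV x (rV_of_tuple t).
Proof.
apply/rowP; apply: cons_rVP => [|i]; first by rewrite cons_rV0 mxE.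
by rewrite cons_rVS !mxE tnthS.
Qed.

Lemma measurable_cons_rV d :
  measurable_fun setT (fun z : measurableTypeR R * 'rV[R]_d => cons_rV z.1 z.2).
Proof.
apply: measurable_fun_rV; apply: cons_rVP => [|i].
  by under eq_fun do rewrite cons_rV0; exact: measurable_fst.
under eq_fun do rewrite cons_rVS.
by apply: (measurableT_comp (measurable_coord i)).
Qed.

Lemma measurable_cons_rVr d (x : R) :
  measurable_fun setT (@cons_rV d x).
Proof.
exact: (measurableT_comp (@measurable_cons_rV d)
  (@pair1_measurable _ _ (measurableTypeR R) _ x)).
Qed.

Lemma ge0_integral_cons_rV d (f : 'rV[R]_d.+1 -> \bar R) :
  measurable_fun setT f -> (forall x, 0 <= f x)%E ->
  (\int[@lebesgue_rV d.+1]_x f x =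
   \int[@lebesgue_measure R]_x \int[@lebesgue_rV d]_y f (cons_rV x y))%E.
Proof.
move=> mf f0; rewrite integral_lebesgue_tuple//=.
have mg := measurableT_comp mf (@measurable_rV_of_tuple d.+1).
rewrite ge0_integral_pushforward//=; last exact: measurable_cons_pair.
rewrite preimage_setT fubini_tonelli1//=; last first.
  exact: (measurableT_comp mg (@measurable_cons_pair R d)).
apply: eq_integral => x _.
rewrite integral_lebesgue_tuple; last first.
  exact: (measurableT_comp mf (@measurable_cons_rVr d x)).
by apply: eq_integral => t _; rewrite /= rV_of_tuple_cons.
Qed.

(** Lebesgue measure is determined by its values on half-open intervals, and there the claim is a
    computation of lengths. *)
Lemma lebesgue_measure_affine (a b : R) : a != 0 ->
  forall A : set (measurableTypeR R), measurable A ->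
  @lebesgue_measure R A =
    (`|a|%:E * pushforward (@lebesgue_measure R)
      ((fun x => (a * x + b)%R) : measurableTypeR R -> measurableTypeR R) A)%E.
Proof.
move=> a0.
have mphi : measurable_fun setT
    ((fun x => (a * x + b)%R) : measurableTypeR R -> measurableTypeR R).
  by apply: measurable_funD => //; exact: measurable_funM.
pose pf : {measure set (measurableTypeR R) -> \bar R} :=
  pushforward (@lebesgue_measure R)
    ((fun x => (a * x + b)%R) : measurableTypeR R -> measurableTypeR R).
pose m : {measure set (measurableTypeR R) -> \bar R} :=
  mscale (NngNum (normr_ge0 a)) (pf mphi).
suff h X : ocitv X -> lebesgue_measure X = m X.
  by move=> A mA; exact: (lebesgue_measure_unique h mA).
case=> -[c e] /= _ <-.
rewrite /m /mscale /= /pushforward.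
have [alt|agt|ae0] := ltgtP a 0; last by rewrite ae0 eqxx in a0.
(* A negative slope exchanges the endpoints, so the preimage is open on the other side; its length
   is unaffected. *)
- rewrite (_ : _ @^-1` _ = [set` `[(e - b) / a, (c - b) / a[]); last first.
    apply/seteqP; split => x /=; rewrite !in_itv/=.
      move=> /andP[h1 h2]; rewrite ler_ndivrMr// ltr_ndivlMr//.
      by apply/andP; split; lra.
    rewrite ler_ndivrMr// ltr_ndivlMr// => /andP[h1 h2].
    by apply/andP; split; lra.
  rewrite !lebesgue_measure_itv/= !lte_fin ltr_ndivrMr// divfK// ltrD2r.
  case: ifPn => _; last by rewrite mule0.
  by rewrite ltr0_norm// -EFinD -EFinM; congr EFin; field.
- rewrite (_ : _ @^-1` _ = [set` `](c - b) / a, (e - b) / a]]); last first.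
    apply/seteqP; split => x /=; rewrite !in_itv/=.
      move=> /andP[h1 h2]; rewrite ler_pdivlMr// ltr_pdivrMr//.
      by apply/andP; split; lra.
    rewrite ler_pdivlMr// ltr_pdivrMr// => /andP[h1 h2].
    by apply/andP; split; lra.
  rewrite !lebesgue_measure_itv/= !lte_fin ltr_pdivrMr// divfK// ltrD2r.
  case: ifPn => _; last by rewrite mule0.
  by rewrite gtr0_norm// -EFinD -EFinM; congr EFin; field.
Qed.

Lemma ge0_integral_affine1 (a b : R) (f : measurableTypeR R -> \bar R) : a != 0 ->
  measurable_fun setT f -> (forall x, 0 <= f x)%E ->
  (\int[@lebesgue_measure R]_x f x =
   `|a|%:E * \int[@lebesgue_measure R]_x f (a * x + b)%R)%E.
Proof.
move=> a0 mf f0.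
have mphi : measurable_fun setT
    ((fun x => (a * x + b)%R) : measurableTypeR R -> measurableTypeR R).
  by apply: measurable_realfun.measurable_funD => //; exact: measurable_funM.
pose pf : {measure set (measurableTypeR R) -> \bar R} :=
  pushforward (@lebesgue_measure R)
    ((fun x => (a * x + b)%R) : measurableTypeR R -> measurableTypeR R).
transitivity (\int[mscale (NngNum (normr_ge0 a)) (pf mphi)]_x f x)%E.
  apply: eq_measure_integral => A mA _.
  exact: lebesgue_measure_affine.
rewrite ge0_integral_mscale//=; congr (_ * _)%E.
by rewrite ge0_integral_pushforward// preimage_setT.
Qed.

Lemma cons_rV_affine d (a x : R) (y : 'rV[R]_d) (v : 'rV[R]_d.+1) :
  a *: cons_rV x y + v = cons_rV (a * x + v 0 ord0) (a *: y + \row_j v 0 (lift ord0 j)).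
Proof.
apply/rowP; apply: cons_rVP => [|i]; first by rewrite !(mxE, unlift_none).
by rewrite cons_rVS !mxE liftK.
Qed.

Lemma measurable_rV_affine d a (v : 'rV[R]_d) :
  measurable_fun setT (fun x : 'rV[R]_d => a *: x + v).
Proof. by apply: measurable_rV_add => //; exact: measurable_rV_scale. Qed.

(** One coordinate at a time, by Tonelli: each contributes a factor [|a|]. In dimension 0 the space
    is a single point. *)
Lemma ge0_integral_affine d (a : R) (v : 'rV[R]_d) (f : 'rV[R]_d -> \bar R) :
  a != 0 -> measurable_fun setT f -> (forall x, 0 <= f x)%E ->
  (\int[@lebesgue_rV d]_x f x =
   (`|a| ^+ d)%:E * \int[@lebesgue_rV d]_x f (a *: x + v)%R)%E.
Proof.
move=> a0; elim: d v f => [|d ih] v f mf f0.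
  rewrite !integral_lebesgue_rV0//; last first.
    by apply: (measurableT_comp mf); exact: measurable_rV_affine.
  by rewrite expr0 mul1e; congr f; apply/rowP; case.
rewrite !ge0_integral_cons_rV//; last first.
  by apply: (measurableT_comp mf); exact: measurable_rV_affine.
pose w : 'rV[R]_d := \row_j v 0 (lift ord0 j).
pose F (x : measurableTypeR R) := (\int[@lebesgue_rV d]_y f (cons_rV x y))%E.
have mfc := measurableT_comp mf (@measurable_cons_rV d).
have mF : measurable_fun setT F.
  apply: (measurable_fun_fubini_tonelli_F (m2 := @lebesgue_rV d) _ mfc) => z. exact: f0.
rewrite (@ge0_integral_affine1 a (v 0 ord0) F)//; last first.
  by move=> x; apply: integral_ge0.
rewrite exprS EFinM -muleA; congr (_ * _)%E.
pose G (x : measurableTypeR R) :=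
  (\int[@lebesgue_rV d]_y f (cons_rV (a * x + v 0 ord0)%R (a *: y + w)%R))%E.
have mG : measurable_fun setT G.
  have mg : measurable_fun setT (fun z : measurableTypeR R * 'rV[R]_d =>
      f (cons_rV (a * z.1 + v 0 ord0) (a *: z.2 + w))).
    pose h (z : measurableTypeR R * 'rV[R]_d) : measurableTypeR R * 'rV[R]_d :=
      (a * z.1 + v 0 ord0, a *: z.2 + w).
    have mh : measurable_fun setT h.
      apply: measurable_fun_pair => /=.
        by apply: measurable_realfun.measurable_funD => //; exact: measurable_funM.
      by apply: measurable_rV_add => //; exact: measurable_rV_scale.
    exact: (measurableT_comp mfc mh).
  by apply: (measurable_fun_fubini_tonelli_F (m2 := @lebesgue_rV d) _ mg) => z.
transitivity ((`|a| ^+ d)%:E * \int[lebesgue_measure]_x G x)%E; last first.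
  congr (_ * _)%E; apply: eq_integral => x _.
  by apply: eq_integral => y _; rewrite cons_rV_affine.
have G0 x : (0 <= G x)%E by exact: integral_ge0.
rewrite -ge0_integralZl ?lee_fin ?exprn_ge0//.
apply: eq_integral => x _; rewrite /F (ih w)//.
exact: (measurableT_comp mf (@measurable_cons_rVr d _)).
Qed.

Lemma ge0_integral_shift d (v : 'rV[R]_d) (f : 'rV[R]_d -> \bar R) :
  measurable_fun setT f -> (forall x, 0 <= f x)%E ->
  (\int[@lebesgue_rV d]_x f x = \int[@lebesgue_rV d]_x f (x + v)%R)%E.
Proof.
move=> mf f0; rewrite (@ge0_integral_affine d 1 v f) ?oner_eq0//.
by rewrite normr1 expr1n mul1e; under eq_integral do rewrite scale1r.
Qed.

Lemma ge0_integral_reflect d (v : 'rV[R]_d) (f : 'rV[R]_d -> \bar R) :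
  measurable_fun setT f -> (forall x, 0 <= f x)%E ->
  (\int[@lebesgue_rV d]_x f x = \int[@lebesgue_rV d]_x f (v - x)%R)%E.
Proof.
move=> mf f0; rewrite (@ge0_integral_affine d (- 1) v f) ?oppr_eq0 ?oner_eq0//.
rewrite normrN normr1 expr1n mul1e.
by under eq_integral do rewrite scaleN1r addrC.
Qed.
End MeasurableRV.

(** * Measurability of continuous functions of one or two vectors *)

Section ContinuousMeasurable.
Context {R : realType}.

Lemma rV_norm_le d (x : 'rV[R]_d) e :
  0 <= e -> (forall i, `|x 0 i| <= e) -> `|x| <= e.
Proof.
move=> e0 xe; rewrite [`|x|]mx_normrE; apply/bigmax_leP; split=> //= -[i j] _.
by rewrite ord1.
Qed.

Lemma rV_coord_norm d (x : 'rV[R]_d) i : `|x 0 i| <= `|x|.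
Proof.
rewrite [leRHS]mx_normrE.
exact: (le_bigmax _ (fun ij : 'I_1 * 'I_d => `|x ij.1 ij.2|) (0, i)).
Qed.

(* Rounding gives countably valued approximations; this reaches continuous functions of
   several variables without comparing the product and Borel sigma-algebras. *)
Lemma measurable_rounding d (T : measurableType d) (V : topologicalType)
    (I : countType) (q : nat -> T -> I) (c : nat -> I -> V) (phi : T -> V)
    (g : V -> R) :
  continuous g -> (forall k i, measurable (q k @^-1` [set i])) ->
  (forall t, (fun k => c k (q k t)) @ \oo --> phi t) ->
  measurable_fun setT (g \o phi).
Proof.
move=> cg mq qphi.
apply: (measurable_fun_cvg (h := fun k t => g (c k (q k t)))) => [k|t _].
  move=> _ Y mY; rewrite setTI.
  rewrite (_ : _ @^-1` _ = \bigcup_i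
    (if `[< Y (g (c k i)) >] then q k @^-1` [set i] else set0)).
    apply: countable_bigcupT_measurable; first exact: countableP.
    by move=> i; case: ifPn.
  apply/seteqP; split => t /=.
    by move=> Yt; exists (q k t) => //; rewrite asboolT.
  by case=> i _; case: ifPn => // /asboolP Yi /= ->.
exact: (continuous_cvg _ (cg _) (qphi t)).
Qed.

(** The rounding fed to [measurable_rounding]: its codes form a countable type, and rounding each
    coordinate down to a multiple of 1/(k+1) costs at most 1/(k+1) in the sup norm. *)
Definition round_code d (k : nat) (x : 'rV[R]_d) : {ffun 'I_d -> int} :=
  [ffun i => Num.floor (k.+1%:R * x 0 i)].

Definition round_val d (k : nat) (z : {ffun 'I_d -> int}) : 'rV[R]_d :=
  \row_i ((z i)%:~R / k.+1%:R).

Lemma measurable_round_code d k (z : {ffun 'I_d -> int}) :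
  measurable (@round_code d k @^-1` [set z]).
Proof.
rewrite (_ : _ @^-1` _ = \bigcap_(i in [set: 'I_d])
   ((fun x : 'rV[R]_d => x 0 i) @^-1`
     [set` `[(z i)%:~R / k.+1%:R, (z i + 1)%:~R / k.+1%:R[])); last first.
  apply/seteqP; split => x /=.
    move=> <- i _; rewrite /= in_itv/= ffunE ler_pdivrMr// ltr_pdivlMr//.
    by rewrite mulrC floor_itv.
  move=> xz; apply/ffunP => i; rewrite ffunE; apply: floor_def.
  have := xz i I; rewrite /= in_itv/= ler_pdivrMr// ltr_pdivlMr//.
  by rewrite mulrC.
apply: fin_bigcap_measurable => // i _.
rewrite -[X in measurable X]setTI.
by apply: (@measurable_coord R d i measurableT); exact: measurable_itv.
Qed.

Lemma round_cvg d (x : 'rV[R]_d) :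
  (fun k => round_val k (round_code k x)) @ \oo --> x.
Proof.
apply/cvgrPdist_le => e e0; near=> k.
have ke : k.+1%:R^-1 <= e.
  by apply: ltW; near: k; exact: near_infty_natSinv_lt (PosNum e0).
apply: le_trans ke; apply: rV_norm_le => // i.
rewrite !mxE ffunE.
have /andP[h1 h2] := floor_itv (k.+1%:R * x 0 i).
have k0 : 0 < k.+1%:R :> R by [].
rewrite ler_norml; apply/andP; split; rewrite -(ler_pM2l k0) ?mulrN ?mulrBr.
  rewrite divff ?gt_eqF// mulrCA divff ?gt_eqF//; lra.
rewrite mulfV ?gt_eqF// mulrCA divff ?gt_eqF//.
by move: h2; rewrite intrD; lra.
Unshelve. all: by end_near. Qed.

Lemma measurable_continuous_rV d (g : 'rV[R]_d -> R) :
  continuous g -> measurable_fun setT g.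
Proof.
move=> cg; apply: (@measurable_rounding _ _ _ _ (@round_code d) (@round_val d) id) => //.
  exact: measurable_round_code.
exact: round_cvg.
Qed.

Lemma measurable_continuous_rV2 d d' (g : 'rV[R]_d * 'rV[R]_d' -> R) :
  continuous g -> measurable_fun setT g.
Proof.
move=> cg; apply: (@measurable_rounding _ _ _ _
  (fun k z => (round_code k z.1, round_code k z.2))
  (fun k ij => (round_val k ij.1, round_val k ij.2)) id) => //.
  move=> k [i j].
  rewrite (_ : _ @^-1` _ = (round_code k @^-1` [set i]) `*` (round_code k @^-1` [set j])).
    by apply: measurableX; exact: measurable_round_code.
  by apply/seteqP; split => z /= [-> ->].
case=> x y P [[A B] /= [Ax By] AB].
have hA : \forall k \near \oo, A (round_val k (round_code k x)) by exact: round_cvg.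
have hB : \forall k \near \oo, B (round_val k (round_code k y)) by exact: round_cvg.
rewrite nbhs_simpl /=; apply: filterS2 hA hB => k Ak Bk; exact: AB.
Qed.
End ContinuousMeasurable.

(** * Real part, imaginary part and modulus of complex numbers *)

Section ComplexParts.
Context {R : realType}.
Implicit Types z w : R[i].

Lemma cReD z w : complex.Re (z + w) = complex.Re z + complex.Re w.
Proof. by case: z w => [a b] [c e]. Qed.

Lemma cImD z w : complex.Im (z + w) = complex.Im z + complex.Im w.
Proof. by case: z w => [a b] [c e]. Qed.

Lemma cReN z : complex.Re (- z) = - complex.Re z. Proof. by case: z. Qed.

Lemma cImN z : complex.Im (- z) = - complex.Im z. Proof. by case: z. Qed.

Lemma cReM z w : complex.Re (z * w) =
  complex.Re z * complex.Re w - complex.Im z * complex.Im w.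
Proof. by case: z w => [a b] [c e]. Qed.

Lemma cImM z w : complex.Im (z * w) =
  complex.Re z * complex.Im w + complex.Im z * complex.Re w.
Proof. by case: z w => [a b] [c e]. Qed.

Lemma complex_eqP z w :
  complex.Re z = complex.Re w -> complex.Im z = complex.Im w -> z = w.
Proof. by case: z w => [a b] [c e] /= -> ->. Qed.

Lemma normcE z : normc z = Num.sqrt (complex.Re z ^+ 2 + complex.Im z ^+ 2).
Proof. by case: z. Qed.

Lemma normc_ge0 z : 0 <= normc z. Proof. by rewrite normcE sqrtr_ge0. Qed.

Lemma sqr_normcE z : normc z ^+ 2 = complex.Re z ^+ 2 + complex.Im z ^+ 2.
Proof. by rewrite normcE sqr_sqrtr// addr_ge0 ?sqr_ge0. Qed.

Lemma ler_normcD z w : normc (z + w) <= normc z + normc w.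
Proof. exact: le_normcD. Qed.

Lemma ler_normcB z w : normc (z - w) <= normc z + normc w.
Proof. by rewrite -(normcN w) ler_normcD. Qed.

Lemma normcM z w : normc (z * w) = normc z * normc w.
Proof. exact: ComplexField.Normc.normcM. Qed.

Lemma normcR (a : R) : normc a%:C = `|a|.
Proof. by rewrite normcE /= expr0n addr0 sqrtr_sqr. Qed.

Lemma normr_Re_le z : `|complex.Re z| <= normc z.
Proof. by rewrite normcE -sqrtr_sqr ler_wsqrtr// lerDl sqr_ge0. Qed.

Lemma normr_Im_le z : `|complex.Im z| <= normc z.
Proof. by rewrite normcE -sqrtr_sqr ler_wsqrtr// lerDr sqr_ge0. Qed.

Lemma normc_le_ReIm z : normc z <= `|complex.Re z| + `|complex.Im z|.
Proof.
rewrite {1}[z]complexE (le_trans (ler_normcD _ _))// normcM !normcR.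
by rewrite [normc 'i]normcE /= expr0n expr1n add0r sqrtr1 mul1r.
Qed.

Lemma normc_sum (I : Type) (s : seq I) (F : I -> R[i]) :
  normc (\sum_(i <- s) F i) <= \sum_(i <- s) normc (F i).
Proof.
elim: s => [|i s ih]; first by rewrite !big_nil ComplexField.Normc.normc0.
by rewrite !big_cons (le_trans (ler_normcD _ _))// lerD2l.
Qed.

Lemma normc_cis (t : R) : normc (cis t) = 1.
Proof. by rewrite normcE /= cos2Dsin2 sqrtr1. Qed.

Lemma cisD (s t : R) : cis (s + t) = cis s * cis t :> R[i].
Proof. by apply: complex_eqP; rewrite ?cReM ?cImM /= ?cosD ?sinD; ring. Qed.

Lemma cis0 : cis 0 = 1 :> R[i].
Proof. by rewrite /cis cos0 sin0. Qed.
End ComplexParts.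

(** * Integration of complex-valued functions *)

Section ComplexIntegral.
Context {R : realType}.

Definition cmeasurable d (T : measurableType d) (F : T -> R[i]) :=
  measurable_fun setT (fun x => complex.Re (F x)) /\
  measurable_fun setT (fun x => complex.Im (F x)).

Definition cintegral d (T : measurableType d) (mu : {measure set T -> \bar R}) (F : T -> R[i]) :
    R[i] :=
  (\int[mu]_x complex.Re (F x)) +i* (\int[mu]_x complex.Im (F x)).

Definition cintegrable d (T : measurableType d) (mu : {measure set T -> \bar R}) (F : T -> R[i]) :=
  cmeasurable F /\ (\int[mu]_x (normc (F x))%:E < +oo)%E.

Section cmeasurable_lemmas.
Context d (T : measurableType d).
Implicit Types F G : T -> R[i].

Lemma cmeasurable_normc F : cmeasurable F -> measurable_fun setT (fun x => normc (F x)).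
Proof.
case=> mR mI; under eq_fun do rewrite normcE.
apply: measurableT_comp; first exact: (continuous_measurable_fun (@sqrt_continuous R)).
by apply: measurable_realfun.measurable_funD; exact: measurable_funX.
Qed.

Lemma cmeasurableD F G : cmeasurable F -> cmeasurable G ->
  cmeasurable (fun x => F x + G x).
Proof.
move=> [mFr mFi] [mGr mGi]; split.
  under eq_fun do rewrite cReD; exact: measurable_realfun.measurable_funD.
under eq_fun do rewrite cImD; exact: measurable_realfun.measurable_funD.
Qed.

Lemma cmeasurableN F : cmeasurable F -> cmeasurable (fun x => - F x).
Proof.
move=> [mFr mFi]; split.
  under eq_fun do rewrite cReN; exact: measurable_realfun.measurable_funN.
under eq_fun do rewrite cImN; exact: measurable_realfun.measurable_funN.
Qed.

Lemma cmeasurableB F G : cmeasurable F -> cmeasurable G ->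
  cmeasurable (fun x => F x - G x).
Proof. by move=> mF mG; apply: cmeasurableD => //; exact: cmeasurableN. Qed.

Lemma cmeasurableM F G : cmeasurable F -> cmeasurable G ->
  cmeasurable (fun x => F x * G x).
Proof.
move=> [mFr mFi] [mGr mGi]; split.
  under eq_fun do rewrite cReM.
  by apply: measurable_realfun.measurable_funB; exact: measurable_funM.
under eq_fun do rewrite cImM.
by apply: measurable_realfun.measurable_funD; exact: measurable_funM.
Qed.

Lemma cmeasurable_cst (c : R[i]) : cmeasurable (fun _ : T => c).
Proof. by split; exact: measurable_cst. Qed.

Lemma cmeasurable_sum (I : Type) (s : seq I) (F : I -> T -> R[i]) :
  (forall i, cmeasurable (F i)) -> cmeasurable (fun x => \sum_(i <- s) F i x).
Proof.
move=> mF; elim: s => [|i s ih].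
  by under eq_fun do rewrite big_nil; exact: cmeasurable_cst.
by under eq_fun do rewrite big_cons; exact: cmeasurableD.
Qed.

Lemma cmeasurable_real (f : T -> R) : measurable_fun setT f ->
  cmeasurable (fun x => (f x)%:C).
Proof. by move=> mf; split => //=; exact: measurable_cst. Qed.

Lemma cmeasurable_cis (f : T -> R) : measurable_fun setT f ->
  cmeasurable (fun x => cis (f x)).
Proof.
move=> mf; split => /=; apply: measurableT_comp => //.
  exact: (continuous_measurable_fun (@continuous_cos R)).
exact: (continuous_measurable_fun (@continuous_sin R)).
Qed.

Lemma cmeasurable_comp d' (T' : measurableType d') (F : T' -> R[i]) (phi : T -> T') :
  cmeasurable F -> measurable_fun setT phi -> cmeasurable (fun x => F (phi x)).
Proof. by move=> [mR mI] mphi; split; [exact: (measurableT_comp mR)|exact: (measurableT_comp mI)]. Qed.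
End cmeasurable_lemmas.

Section cintegral_lemmas.
Context d (T : measurableType d) (mu : {measure set T -> \bar R}).
Implicit Types F G : T -> R[i].

Lemma eq_cintegral F G : F =1 G -> cintegral mu F = cintegral mu G.
Proof. by move=> /funext ->. Qed.

Lemma le_cintegrable F (g : T -> \bar R) : cmeasurable F ->
  measurable_fun setT g ->
  (forall x, (normc (F x))%:E <= g x)%E -> (\int[mu]_x g x < +oo)%E -> cintegrable mu F.
Proof.
move=> mF mg Fg goo; split => //; apply: le_lt_trans goo; apply: ge0_le_integral => //.
- by move=> x _; rewrite lee_fin normc_ge0.
- exact/measurable_EFinP/cmeasurable_normc.
Qed.

Lemma cintegrable_Re F : cintegrable mu F ->
  mu.-integrable setT (EFin \o (fun x => complex.Re (F x))).
Proof.
move=> [mF Foo]; apply/integrableP; split; first exact/measurable_EFinP/mF.1.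
apply: le_lt_trans Foo; apply: ge0_le_integral => //.
- by do 2 apply: measurableT_comp => //; exact: mF.1.
- exact/measurable_EFinP/cmeasurable_normc.
- by move=> x _; rewrite lee_fin normr_Re_le.
Qed.

Lemma cintegrable_Im F : cintegrable mu F ->
  mu.-integrable setT (EFin \o (fun x => complex.Im (F x))).
Proof.
move=> [mF Foo]; apply/integrableP; split; first exact/measurable_EFinP/mF.2.
apply: le_lt_trans Foo; apply: ge0_le_integral => //.
- by do 2 apply: measurableT_comp => //; exact: mF.2.
- exact/measurable_EFinP/cmeasurable_normc.
- by move=> x _; rewrite lee_fin normr_Im_le.
Qed.

Lemma cintegrable_ReZ (a : R) F : cintegrable mu F ->
  mu.-integrable setT (EFin \o (fun x => a * complex.Re (F x))).
Proof. by move=> iF; exact: (integrableZl measurableT a (cintegrable_Re iF)). Qed.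

Lemma cintegrable_ImZ (a : R) F : cintegrable mu F ->
  mu.-integrable setT (EFin \o (fun x => a * complex.Im (F x))).
Proof. by move=> iF; exact: (integrableZl measurableT a (cintegrable_Im iF)). Qed.

Lemma cintegrableD F G : cintegrable mu F -> cintegrable mu G ->
  cintegrable mu (fun x => F x + G x).
Proof.
move=> [mF Foo] [mG Goo].
apply: (le_cintegrable (g := fun x => (normc (F x))%:E + (normc (G x))%:E)%E).
- exact: cmeasurableD.
- by apply: emeasurable_funD; exact/measurable_EFinP/cmeasurable_normc.
- by move=> x; rewrite -EFinD lee_fin ler_normcD.
rewrite ge0_integralD//; first exact: lte_add_pinfty.
- by move=> x _; rewrite lee_fin normc_ge0.
- exact/measurable_EFinP/cmeasurable_normc.
- by move=> x _; rewrite lee_fin normc_ge0.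
- exact/measurable_EFinP/cmeasurable_normc.
Qed.

Lemma cintegrableMl F (c : T -> R[i]) (M : R) : cmeasurable c ->
  (forall x, normc (c x) <= M) -> cintegrable mu F ->
  cintegrable mu (fun x => c x * F x).
Proof.
move=> mc cM [mF Foo].
apply: (le_cintegrable (g := fun x => `|M|%:E * (normc (F x))%:E)%E).
- exact: cmeasurableM.
- by apply: measurable_funeM; exact/measurable_EFinP/cmeasurable_normc.
- move=> x; rewrite -EFinM lee_fin normcM ler_wpM2r ?normc_ge0//.
  by rewrite (le_trans (cM x))// ler_norm.
rewrite ge0_integralZl//; last 2 first.
- exact/measurable_EFinP/cmeasurable_normc.
- by move=> x _; rewrite lee_fin normc_ge0.
by rewrite lte_mul_pinfty// lee_fin.
Qed.

Lemma cintegrableZ F (c : R[i]) : cintegrable mu F -> cintegrable mu (fun x => c * F x).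
Proof. by apply: (@cintegrableMl _ _ (normc c)) => //; exact: cmeasurable_cst. Qed.

Lemma cintegrableN F : cintegrable mu F -> cintegrable mu (fun x => - F x).
Proof. by move=> iF; under eq_fun do rewrite -mulN1r; exact: cintegrableZ. Qed.

Lemma cintegrableB F G : cintegrable mu F -> cintegrable mu G ->
  cintegrable mu (fun x => F x - G x).
Proof. by move=> iF iG; apply: cintegrableD => //; exact: cintegrableN. Qed.

Lemma cintegralD F G : cintegrable mu F -> cintegrable mu G ->
  cintegral mu (fun x => F x + G x) = cintegral mu F + cintegral mu G.
Proof.
move=> iF iG; apply: complex_eqP; rewrite ?cReD ?cImD /=.
  under eq_Rintegral do rewrite cReD.
  by rewrite RintegralD//; exact: cintegrable_Re.
under eq_Rintegral do rewrite cImD.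
by rewrite RintegralD//; exact: cintegrable_Im.
Qed.

Lemma cintegralZ F (c : R[i]) : cintegrable mu F ->
  cintegral mu (fun x => c * F x) = c * cintegral mu F.
Proof.
move=> iF.
have iR a := cintegrable_ReZ a iF; have iI a := cintegrable_ImZ a iF.
apply: complex_eqP; rewrite ?cReM ?cImM /=.
  under eq_Rintegral do rewrite cReM.
  rewrite RintegralB//.
  by rewrite !RintegralZl//; [exact: cintegrable_Im|exact: cintegrable_Re].
under eq_Rintegral do rewrite cImM.
rewrite RintegralD//.
by rewrite !RintegralZl//; [exact: cintegrable_Re|exact: cintegrable_Im].
Qed.

Lemma cintegralN F : cintegrable mu F ->
  cintegral mu (fun x => - F x) = - cintegral mu F.
Proof.
move=> iF; under eq_cintegral do rewrite -mulN1r.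
by rewrite cintegralZ// mulN1r.
Qed.

Lemma cintegralB F G : cintegrable mu F -> cintegrable mu G ->
  cintegral mu (fun x => F x - G x) = cintegral mu F - cintegral mu G.
Proof.
by move=> iF iG; rewrite cintegralD ?cintegralN//; exact: cintegrableN.
Qed.

Lemma cintegrable0 : cintegrable mu (fun=> 0).
Proof.
split; first exact: cmeasurable_cst.
by under eq_integral do rewrite ComplexField.Normc.normc0; rewrite integral0.
Qed.

Lemma cintegral0 : cintegral mu (fun=> 0) = 0.
Proof.
by rewrite /cintegral /=; apply: complex_eqP => /=; rewrite /Rintegral integral0.
Qed.

Lemma cintegrable_sum (I : Type) (s : seq I) (F : I -> T -> R[i]) :
  (forall i, cintegrable mu (F i)) -> cintegrable mu (fun x => \sum_(i <- s) F i x).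
Proof.
move=> iF; elim: s => [|i s ih].
  by under eq_fun do rewrite big_nil; exact: cintegrable0.
by under eq_fun do rewrite big_cons; exact: cintegrableD.
Qed.

Lemma cintegral_sum (I : Type) (s : seq I) (F : I -> T -> R[i]) :
  (forall i, cintegrable mu (F i)) ->
  cintegral mu (fun x => \sum_(i <- s) F i x) = \sum_(i <- s) cintegral mu (F i).
Proof.
move=> iF; elim: s => [|i s ih].
  by under eq_cintegral do rewrite big_nil; rewrite cintegral0 big_nil.
under eq_cintegral do rewrite big_cons.
by rewrite cintegralD// ?ih ?big_cons//; exact: cintegrable_sum.
Qed.

(* With a + ib the integral of F, a^2 + b^2 is the integral of a Re F + b Im F, hence at
   most |a + ib| times the integral of |F|. *)
Lemma le_normc_cintegral F : cintegrable mu F ->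
  ((normc (cintegral mu F))%:E <= \int[mu]_x (normc (F x))%:E)%E.
Proof.
move=> iF; have [mF Foo] := iF.
set N := normc _; set J := (\int[mu]_x _)%E.
have J0 : (0 <= J)%E by apply: integral_ge0 => x _; rewrite lee_fin normc_ge0.
have Jfin : J \is a fin_num by rewrite ge0_fin_numE.
have iN : mu.-integrable setT (EFin \o (fun x => normc (F x))).
  apply/integrableP; split; first exact/measurable_EFinP/cmeasurable_normc.
  by under eq_integral do rewrite /= ger0_norm ?normc_ge0//.
rewrite -(fineK Jfin) lee_fin.
have N0 : 0 <= N by exact: normc_ge0.
have [->|Nn0] := eqVneq N 0; first exact: fine_ge0.
have Npos : 0 < N by rewrite lt_def Nn0.
rewrite -(ler_pM2l Npos) -expr2 sqr_normcE.
set a := complex.Re _; set b := complex.Im _.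
have -> : a ^+ 2 + b ^+ 2 =
    \int[mu]_x (a * complex.Re (F x) + b * complex.Im (F x)).
  rewrite RintegralD//; [|exact: cintegrable_ReZ|exact: cintegrable_ImZ].
  by rewrite !RintegralZl//; [exact: cintegrable_Im|exact: cintegrable_Re].
rewrite -/(Rintegral mu setT (fun x => normc (F x))) -RintegralZl//.
apply: le_Rintegral => //.
- exact: (integrableD measurableT (cintegrable_ReZ a iF) (cintegrable_ImZ b iF)).
- exact: (integrableZl measurableT N iN).
move=> x _; have -> : N = normc (a -i* b) by rewrite /N !normcE /= sqrrN.
rewrite -normcM (le_trans _ (normr_Re_le _))// cReM /= mulNr opprK.
exact: ler_norm.
Qed.

Lemma Rintegral_dominated (f_ : nat -> T -> R) (f g : T -> R) :
  (forall k, measurable_fun setT (f_ k)) -> measurable_fun setT f ->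
  (forall x, (fun k => f_ k x) @ \oo --> f x) ->
  measurable_fun setT g -> (\int[mu]_x (g x)%:E < +oo)%E ->
  (forall k x, `|f_ k x| <= g x) ->
  (fun k => \int[mu]_x f_ k x) @ \oo --> \int[mu]_x f x.
Proof.
move=> mf_ mf ff mg goo fg.
have ig : mu.-integrable setT (EFin \o g).
  apply/integrableP; split; first exact/measurable_EFinP.
  rewrite (_ : (fun x => _) = EFin \o g)//; apply/funext => x /=.
  by rewrite ger0_norm// (le_trans _ (fg 0%N x)).
have [] := @dominated_convergence _ _ _ mu setT measurableT
  (fun k x => (f_ k x)%:E) (fun x => (f x)%:E) (EFin \o g) _ _ _ ig _.
- by move=> k; exact/measurable_EFinP.
- exact/measurable_EFinP.
- by apply: aeW => x _; apply: cvg_EFin; [exact: nearW|exact: ff].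
- by apply: aeW => x k _; rewrite lee_fin.
move=> iff _ h.
apply: fine_cvg; rewrite fineK; first exact: h.
exact: integrable_fin_num.
Qed.

Lemma cintegral_dominated (F_ : nat -> T -> R[i]) (F : T -> R[i]) (g : T -> R) :
  (forall k, cmeasurable (F_ k)) -> cmeasurable F ->
  (forall x, (fun k => complex.Re (F_ k x)) @ \oo --> complex.Re (F x)) ->
  (forall x, (fun k => complex.Im (F_ k x)) @ \oo --> complex.Im (F x)) ->
  measurable_fun setT g -> (\int[mu]_x (g x)%:E < +oo)%E ->
  (forall k x, normc (F_ k x) <= g x) ->
  (fun k => complex.Re (cintegral mu (F_ k))) @ \oo --> complex.Re (cintegral mu F) /\
  (fun k => complex.Im (cintegral mu (F_ k))) @ \oo --> complex.Im (cintegral mu F).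
Proof.
move=> mF_ mF cR cI mg goo Fg; split=> /=.
- apply: Rintegral_dominated mg goo _ => //; first by move=> k; exact: (mF_ k).1.
    exact: mF.1.
  by move=> k x; rewrite (le_trans (normr_Re_le _)).
- apply: Rintegral_dominated mg goo _ => //; first by move=> k; exact: (mF_ k).2.
    exact: mF.2.
  by move=> k x; rewrite (le_trans (normr_Im_le _)).
Qed.
End cintegral_lemmas.
End ComplexIntegral.

(** * Fubini for complex integrands dominated by a product *)

Section ComplexFubini.
Context {R : realType} d1 d2 (T1 : measurableType d1) (T2 : measurableType d2).
Variables (m1 : {sigma_finite_measure set T1 -> \bar R})
          (m2 : {sigma_finite_measure set T2 -> \bar R}).

(** Tonelli gives measurability of the integrals of the positive and of the negative part; their
    difference and its [fine] stay measurable even where a section is not integrable. *)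
Lemma measurable_Rintegral (f : T1 * T2 -> R) : measurable_fun setT f ->
  measurable_fun setT (fun x => \int[m2]_y f (x, y)).
Proof.
move=> mf; rewrite /Rintegral.
have mfE : measurable_fun setT (EFin \o f) by exact/measurable_EFinP.
apply: (measurableT_comp (fine_measurable measurableT)).
under eq_fun do rewrite integralE.
apply: emeasurable_funB.
- have h := measurable_fun_fubini_tonelli_F (m2 := m2) _ (measurable_funepos mfE).
  apply: eq_measurable_fun (h _) => // x _.
  by apply: eq_integral => y _; rewrite !unlock.
- have h := measurable_fun_fubini_tonelli_F (m2 := m2) _ (measurable_funeneg mfE).
  apply: eq_measurable_fun (h _) => // x _.
  by apply: eq_integral => y _; rewrite !unlock.
Qed.

Lemma cmeasurable_cintegral (F : T1 * T2 -> R[i]) : cmeasurable F ->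
  cmeasurable (fun x => cintegral m2 (fun y => F (x, y))).
Proof.
move=> [mR mI]; split; [exact: (measurable_Rintegral mR)|exact: (measurable_Rintegral mI)].
Qed.
End ComplexFubini.

Section ComplexFubiniDominated.
Context {R : realType} d1 d2 (T1 : measurableType d1) (T2 : measurableType d2).
Variables (m1 : {sigma_finite_measure set T1 -> \bar R})
          (m2 : {sigma_finite_measure set T2 -> \bar R}).
Variables (F : T1 * T2 -> R[i]) (a : T1 -> R) (b : T2 -> R).
Hypotheses (mF : cmeasurable F) (ma : measurable_fun setT a) (mb : measurable_fun setT b)
  (a0 : forall x, 0 <= a x) (b0 : forall y, 0 <= b y)
  (aoo : (\int[m1]_x (a x)%:E < +oo)%E) (boo : (\int[m2]_y (b y)%:E < +oo)%E)
  (Fab : forall x y, normc (F (x, y)) <= a x * b y).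

Let maE : measurable_fun setT (fun x => (a x)%:E). Proof. exact/measurable_EFinP. Qed.
Let mbE : measurable_fun setT (fun x => (b x)%:E). Proof. exact/measurable_EFinP. Qed.
Let a0E x : (0 <= (a x)%:E)%E. Proof. by rewrite lee_fin. Qed.
Let b0E x : (0 <= (b x)%:E)%E. Proof. by rewrite lee_fin. Qed.
Let a0I : (0 <= \int[m1]_x (a x)%:E)%E. Proof. exact: integral_ge0. Qed.
Let b0I : (0 <= \int[m2]_x (b x)%:E)%E. Proof. exact: integral_ge0. Qed.

Let mab : measurable_fun setT (fun z : T1 * T2 => (a z.1 * b z.2)%:E).
Proof. by apply/measurable_EFinP; apply: measurable_funM; exact: measurableT_comp. Qed.

Let abE : (\int[m1 \x m2]_z (a z.1 * b z.2)%:E =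
   (\int[m1]_x (a x)%:E) * (\int[m2]_y (b y)%:E))%E.
Proof.
have ab0 z : (0 <= (a z.1 * b z.2)%:E)%E by rewrite lee_fin mulr_ge0.
rewrite fubini_tonelli1// /fubini_F -ge0_integralZr//.
by apply: eq_integral => x _ /=; rewrite -ge0_integralZl.
Qed.

Lemma cintegrable_prod : cintegrable (m1 \x m2)%E F.
Proof.
apply: (le_cintegrable (g := fun z => (a z.1 * b z.2)%:E)) => //.
- by case=> x y; rewrite lee_fin.
by rewrite abE lte_mul_pinfty// ge0_fin_numE.
Qed.

(** The majorant [a x * b y] is integrable in [y] for every [x], so every section is integrable, not
    just almost every one, and no null sets appear later. *)
Lemma cintegrable_section1 x : cintegrable m2 (fun y => F (x, y)).
Proof.
apply: (le_cintegrable (g := fun y => ((a x)%:E * (b y)%:E)%E)).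
- exact: (cmeasurable_comp mF (pair1_measurable x)).
- by apply: measurable_funeM; exact/measurable_EFinP.
- by move=> y; rewrite -EFinM lee_fin.
by rewrite ge0_integralZl// ?lee_fin// lte_mul_pinfty// ?lee_fin.
Qed.

Lemma cintegrable_section2 y : cintegrable m1 (fun x => F (x, y)).
Proof.
apply: (le_cintegrable (g := fun x => ((b y)%:E * (a x)%:E)%E)).
- exact: (cmeasurable_comp mF (pair2_measurable y)).
- by apply: measurable_funeM; exact/measurable_EFinP.
- by move=> x; rewrite -EFinM lee_fin mulrC.
by rewrite ge0_integralZl// ?lee_fin// lte_mul_pinfty// ?lee_fin.
Qed.

Lemma cintegral_prod1 :
  cintegral (m1 \x m2)%E F = cintegral m1 (fun x => cintegral m2 (fun y => F (x, y))).
Proof.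
have iF := cintegrable_prod.
apply: complex_eqP => /=; rewrite /Rintegral.
  rewrite -(integral12_prod_meas1 (cintegrable_Re iF)) /fubini_F.
  congr fine; apply: eq_integral => x _ /=; rewrite fineK//.
  exact: integrable_fin_num (cintegrable_Re (cintegrable_section1 x)).
rewrite -(integral12_prod_meas1 (cintegrable_Im iF)) /fubini_F.
congr fine; apply: eq_integral => x _ /=; rewrite fineK//.
exact: integrable_fin_num (cintegrable_Im (cintegrable_section1 x)).
Qed.

Lemma cintegral_prod2 :
  cintegral (m1 \x m2)%E F = cintegral m2 (fun y => cintegral m1 (fun x => F (x, y))).
Proof.
have iF := cintegrable_prod.
apply: complex_eqP => /=; rewrite /Rintegral.
  rewrite -(integral21_prod_meas1 (cintegrable_Re iF)) /fubini_G.
  congr fine; apply: eq_integral => x _ /=; rewrite fineK//.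
  exact: integrable_fin_num (cintegrable_Re (cintegrable_section2 x)).
rewrite -(integral21_prod_meas1 (cintegrable_Im iF)) /fubini_G.
congr fine; apply: eq_integral => x _ /=; rewrite fineK//.
exact: integrable_fin_num (cintegrable_Im (cintegrable_section2 x)).
Qed.

Lemma cintegral_fubini :
  cintegral m1 (fun x => cintegral m2 (fun y => F (x, y))) =
  cintegral m2 (fun y => cintegral m1 (fun x => F (x, y))).
Proof. by rewrite -cintegral_prod1 cintegral_prod2. Qed.

Lemma le_normc_section1 x :
  normc (cintegral m2 (fun y => F (x, y))) <= a x * fine (\int[m2]_y (b y)%:E).
Proof.
rewrite -lee_fin (le_trans (le_normc_cintegral (cintegrable_section1 x)))//.
rewrite EFinM fineK ?ge0_fin_numE//.
rewrite -ge0_integralZl// ?lee_fin//.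
apply: ge0_le_integral => //.
- by move=> y _; rewrite lee_fin normc_ge0.
- apply/measurable_EFinP/cmeasurable_normc.
  exact: (cmeasurable_comp mF (pair1_measurable x)).
- by apply: measurable_funeM; exact/measurable_EFinP.
- by move=> y _; rewrite -EFinM lee_fin.
Qed.

Lemma cintegrable_cintegral1 :
  cintegrable m1 (fun x => cintegral m2 (fun y => F (x, y))).
Proof.
apply: (le_cintegrable (g := fun x => ((fine (\int[m2]_y (b y)%:E))%:E * (a x)%:E)%E)).
- exact: cmeasurable_cintegral.
- by apply: measurable_funeM; exact/measurable_EFinP.
- by move=> x; rewrite -EFinM lee_fin mulrC le_normc_section1.
by rewrite ge0_integralZl// ?lee_fin ?fine_ge0// lte_mul_pinfty// lee_fin fine_ge0.
Qed.
End ComplexFubiniDominated.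

(** * Changes of variables in complex integrals over R^d *)

Section ComplexLebesgue.
Context {R : realType}.

Lemma Rintegral_transfer d1 d2 (X : measurableType d1) (Y : measurableType d2)
    (mu : {measure set X -> \bar R}) (nu : {measure set Y -> \bar R}) (phi : X -> Y) :
  (forall f : Y -> \bar R, measurable_fun setT f -> (forall y, 0 <= f y)%E ->
    \int[nu]_y f y = \int[mu]_x f (phi x))%E ->
  forall F : Y -> R[i], cmeasurable F -> cintegral nu F = cintegral mu (fun x => F (phi x)).
Proof.
move=> H F [mR mI]; apply: complex_eqP => /=; rewrite /Rintegral.
  by rewrite (eq_integral_nonneg H)//; exact/measurable_EFinP.
by rewrite (eq_integral_nonneg H)//; exact/measurable_EFinP.
Qed.

Lemma integralC_cintegral d (F : 'rV[R]_d -> R[i]) : cmeasurable F ->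
  integralC F = cintegral (@lebesgue_rV R d) F.
Proof.
move=> mF; rewrite (Rintegral_transfer (@ge0_integral_lebesgue_tuple R d))//.
Qed.

Lemma cintegral_shift d (v : 'rV[R]_d) (F : 'rV[R]_d -> R[i]) : cmeasurable F ->
  cintegral (@lebesgue_rV R d) F = cintegral (@lebesgue_rV R d) (fun x => F (x + v)).
Proof. by apply: Rintegral_transfer => f; exact: ge0_integral_shift. Qed.

Lemma cintegral_reflect d (v : 'rV[R]_d) (F : 'rV[R]_d -> R[i]) : cmeasurable F ->
  cintegral (@lebesgue_rV R d) F = cintegral (@lebesgue_rV R d) (fun x => F (v - x)).
Proof. by apply: Rintegral_transfer => f; exact: ge0_integral_reflect. Qed.

(** Unlike for a shift, a factor must be distributed over the positive part minus the negative part;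
    integrability makes this difference well defined. *)
Lemma integral_affine d (a : R) (v : 'rV[R]_d) (f : 'rV[R]_d -> \bar R) : a != 0 ->
  (lebesgue_rV (d:=d)).-integrable setT f ->
  (lebesgue_rV (d:=d)).-integrable setT (fun x : 'rV[R]_d => f (a *: x + v)%R) /\
  (\int[@lebesgue_rV R d]_x f x =
   (`|a| ^+ d)%:E * \int[@lebesgue_rV R d]_x f (a *: x + v)%R)%E.
Proof.
move=> a0 /[dup] intf /integrableP[mf foo].
have ad0 : 0 < `|a| ^+ d by rewrite exprn_gt0// normr_gt0.
have mfa : measurable_fun setT (fun x : 'rV[R]_d => f (a *: x + v)%R).
  exact: (measurableT_comp mf (@measurable_rV_affine R d a v)).
have ifa : (lebesgue_rV (d:=d)).-integrable setT (fun x : 'rV[R]_d => f (a *: x + v)%R).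
  apply/integrableP; split => //; move: foo.
  have mabs : measurable_fun setT (abse \o f) by exact: measurableT_comp.
  rewrite (@ge0_integral_affine R d a v (abse \o f))//= => foo.
  rewrite -(@lte_pmul2l _ ((`|a| ^+ d)%:E)) ?lte_fin// (lt_le_trans foo)//.
  by rewrite mulry gtr0_sg// mul1e.
split=> //.
rewrite integralE (integralE _ _ (fun x : 'rV[R]_d => f (a *: x + v)%R)).
rewrite muleBr//; last first.
  apply: fin_num_adde_defr; apply: integrable_fin_num => //.
  exact: integrable_funepos.
rewrite (@ge0_integral_affine R d a v)//; last exact: measurable_funepos.
rewrite [X in (_ - X)%E = _](@ge0_integral_affine R d a v)//; last exact: measurable_funeneg.
by congr (_ * _ - _ * _)%E; apply: eq_integral => x _; rewrite !unlock.
Qed.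

Lemma cintegral_affine d (a : R) (v : 'rV[R]_d) (F : 'rV[R]_d -> R[i]) : a != 0 ->
  cintegrable (@lebesgue_rV R d) F ->
  cintegral (@lebesgue_rV R d) F =
  (`|a| ^+ d)%:C * cintegral (@lebesgue_rV R d) (fun x => F (a *: x + v)).
Proof.
move=> a0 iF; apply: complex_eqP; rewrite ?cReM ?cImM /= mul0r ?subr0 ?addr0.
  have [i1 i2] := integral_affine v a0 (cintegrable_Re iF).
  by rewrite {1}/Rintegral i2 fineM// integrable_fin_num.
have [i1 i2] := integral_affine v a0 (cintegrable_Im iF).
by rewrite {1}/Rintegral i2 fineM// integrable_fin_num.
Qed.

Lemma cintegral_cons_rV d (F : 'rV[R]_d.+1 -> R[i]) (a : R -> R) (b : 'rV[R]_d -> R) :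
  cmeasurable F -> measurable_fun (setT : set (measurableTypeR R)) a -> measurable_fun setT b ->
  (forall x, 0 <= a x) -> (forall y, 0 <= b y) ->
  (\int[@lebesgue_measure R]_x (a x)%:E < +oo)%E ->
  (\int[@lebesgue_rV R d]_y (b y)%:E < +oo)%E ->
  (forall x y, normc (F (cons_rV x y)) <= a x * b y) ->
  cintegral (@lebesgue_rV R d.+1) F =
  cintegral (@lebesgue_measure R) (fun x => cintegral (@lebesgue_rV R d)
     (fun y => F (cons_rV x y))).
Proof.
move=> mF ma mb a0 b0 aoo boo Fab.
rewrite (@Rintegral_transfer _ _ _ _ (@lebesgue_measure R \x @lebesgue_rV R d)%E _
  (fun z => cons_rV z.1 z.2))//; last first.
  move=> f mf f0; rewrite ge0_integral_cons_rV// fubini_tonelli1//.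
  exact: (measurableT_comp mf (@measurable_cons_rV R d)).
have mG : cmeasurable (fun z : measurableTypeR R * 'rV[R]_d => F (cons_rV z.1 z.2)).
  exact: (cmeasurable_comp mF (@measurable_cons_rV R d)).
exact: (cintegral_prod1 (m1 := @lebesgue_measure R) (m2 := @lebesgue_rV R d)
  mG ma mb a0 b0 aoo boo Fab).
Qed.
End ComplexLebesgue.

(** * Directional derivatives: mean value theorem, linearity in the direction, symmetry *)

Section DirectionalCalculus.
Context {R : realType} {V : normedModType R}.
Implicit Types (g f : V -> R) (x y u v w : V) (vs : seq V).

Lemma is_derive_line g x v (t : R) : derivable g (t *: v + x) v ->
  is_derive t (1 : R) (fun s : R => g (s *: v + x)) ('D_v g (t *: v + x)).
Proof.
move=> dg; suff E : (fun h : R => h^-1 *: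
   (((fun s : R => g (s *: v + x)) \o shift t) (h *: 1) - g (t *: v + x))) =
   (fun h : R => h^-1 *: ((g \o shift (t *: v + x)) (h *: v) - g (t *: v + x))).
  by split; rewrite /derivable /derive E.
by apply/funext => h /=; rewrite scalerDl addrA /GRing.scale/= mulr1.
Qed.

(** The clause on signs places the intermediate point between [x] and [h *: v + x] when [h] is
    nonnegative, instead of only within distance; [in_span] needs this. *)
Lemma directional_mvt g x v (h : R) : (forall y, derivable g y v) ->
  exists2 s : R, `|s| <= `|h| /\ (0 <= h -> 0 <= s) &
    g (h *: v + x) - g x = h * 'D_v g (s *: v + x).
Proof.
move=> dg; pose phi (s : R) := g (s *: v + x).
have dphi s : is_derive s (1 : R) phi ('D_v g (s *: v + x)) by exact: is_derive_line.
have cphi (a b : R) : {within `[a, b], continuous phi}.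
  by apply: derivable_within_continuous => s _; exact: ex_derive.
have [h0|h0] := leP 0 h.
  have [s sh E] := MVT_segment h0 (fun s _ => dphi s) (cphi 0 h).
  move: sh; rewrite in_itv/= => /andP[s0 sh].
  exists s; first by rewrite !ger0_norm.
  by move: E; rewrite /phi scale0r add0r subr0 => ->; rewrite mulrC.
have [s sh E] := MVT_segment (ltW h0) (fun s _ => dphi s) (cphi h 0).
move: sh; rewrite in_itv/= => /andP[hs s0].
exists s.
  by split => //; rewrite !ler0_norm ?lerN2// ltW.
by move: E; rewrite /phi scale0r add0r sub0r mulrN mulrC; lra.
Qed.

Lemma derive_eps g x w (l : R) :
  (forall e : R, 0 < e -> exists2 del : R, 0 < del & forall h : R, h != 0 ->
     `|h| < del -> `|g (h *: w + x) - g x - h * l| <= e * `|h|) ->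
  'D_w g x = l.
Proof.
move=> H; apply/cvg_lim => //; apply/cvgrPdist_le => e e0.
have [del del0 Hd] := H _ e0.
apply/nbhs_ballP; exists del => //= h; rewrite /ball/= sub0r normrN => hd hn0.
rewrite distrC /GRing.scale/=; set D := g _ - g x.
have -> : h^-1 * D - l = h^-1 * (D - h * l) by rewrite [in RHS]mulrBr mulKf.
rewrite normrM normfV ler_pdivrMl ?normr_gt0// [leRHS]mulrC.
exact: Hd.
Qed.

Lemma continuous_eps g x : {for x, continuous g} -> forall e : R, 0 < e ->
  exists2 del : R, 0 < del & forall y, `|y - x| < del -> `|g y - g x| <= e.
Proof.
move=> /cvgrPdist_le cg e e0; have /nbhs_ballP[del del0 H] := cg e e0.
exists del => // y yx; rewrite distrC; apply: H.
by rewrite -ball_normE /= distrC.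
Qed.

Lemma deriveZ_dir g x u (a : R) : (forall y, derivable g y u) ->
  {for x, continuous ('D_u g)} -> 'D_(a *: u) g x = a * 'D_u g x.
Proof.
move=> dg cg; apply: derive_eps => e e0.
have K0 : 0 < `|a| * `|u| + `|a| + 1 by rewrite ltr_wpDl// addr_ge0// mulr_ge0.
have [del del0 H] := continuous_eps cg (divr_gt0 e0 K0).
exists (del / (`|a| * `|u| + `|a| + 1)); first exact: divr_gt0.
move=> h _ hd; rewrite scalerA.
have [s [sh _] ->] := directional_mvt x (h * a) dg.
rewrite mulrA -mulrBr !normrM -mulrA [leRHS]mulrC ler_wpM2l//.
have au0 : 0 <= `|a| * `|u| by rewrite mulr_ge0.
have : `|'D_u g (s *: u + x) - 'D_u g x| <= e / (`|a| * `|u| + `|a| + 1).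
  apply: H; rewrite addrK normrZ (le_lt_trans (ler_wpM2r _ sh))//.
  move: hd; rewrite ltr_pdivlMr//; apply: le_lt_trans.
  by rewrite normrM -mulrA ler_wpM2l// -addrA lerDl addr_ge0.
rewrite ler_pdivlMr//; apply: le_trans; rewrite mulrC ler_wpM2l//.
by rewrite addrAC lerDr addr_ge0.
Qed.

(** Existence of directional derivatives alone does not make them additive in the direction. Moving
    first along [v], then along [u], and applying the mean value theorem to each leg, continuity at
    [x] of both derivatives gives the claim. *)
Lemma deriveD_dir g x u v : (forall y, derivable g y u) -> (forall y, derivable g y v) ->
  {for x, continuous ('D_u g)} -> {for x, continuous ('D_v g)} ->
  'D_(u + v) g x = 'D_u g x + 'D_v g x.
Proof.
move=> dgu dgv cu cv; apply: derive_eps => e e0.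
have e20 : 0 < e / 2 by exact: divr_gt0.
have [d1 d10 H1] := continuous_eps cu e20.
have [d2 d20 H2] := continuous_eps cv e20.
have K0 : 0 < `|u| + `|v| + 1 by rewrite ltr_wpDl// addr_ge0.
(* Both intermediate points lie within [|h| * (|u| + |v|)] of [x]; the added 1 keeps the denominator
   positive. *)
exists (Num.min d1 d2 / (`|u| + `|v| + 1)).
  by rewrite divr_gt0// lt_min d10.
move=> h _; rewrite ltr_pdivlMr// lt_min => /andP[h1 h2].
have [s [sh _] Es] := directional_mvt (h *: v + x) h dgu.
have [t [th _] Et] := directional_mvt x h dgv.
rewrite scalerDr -(addrA (h *: u)).
have -> : g (h *: u + (h *: v + x)) - g x - h * ('D_u g x + 'D_v g x) =
  h * ('D_u g (s *: u + (h *: v + x)) - 'D_u g x) + h * ('D_v g (t *: v + x) - 'D_v g x).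
  by rewrite !mulrBr -Es -Et; ring.
rewrite (le_trans (ler_normD _ _))// !normrM [leRHS]mulrC -mulrDr ler_wpM2l//.
have hh0 := normr_ge0 h; have u0 := normr_ge0 u; have v0 := normr_ge0 v.
rewrite (splitr e) lerD//.
  apply: H1; rewrite addrA addrK (le_lt_trans (ler_normD _ _))// !normrZ.
  apply: le_lt_trans h1; have : `|s| * `|u| <= `|h| * `|u| by rewrite ler_wpM2r.
  by rewrite !mulrDr mulr1; lra.
apply: H2; rewrite addrK normrZ.
apply: le_lt_trans h2; have : `|t| * `|v| <= `|h| * `|v| by rewrite ler_wpM2r.
by have : 0 <= `|h| * `|u| by [rewrite mulr_ge0]; rewrite !mulrDr mulr1; lra.
Qed.

Lemma derive_shift g w x v : 'D_w (fun y => g (y + v)) x = 'D_w g (x + v).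
Proof.
rewrite /derive (_ : (fun h : R => h^-1 *: ((g \o shift (x + v)) (h *: w) - g (x + v))) =
  (fun h : R => h^-1 *: (((fun y => g (y + v)) \o shift x) (h *: w) - g (x + v))))//.
by apply/funext => h /=; rewrite addrA.
Qed.

Lemma derivable_shift g w x v : derivable g (x + v) w ->
  derivable (fun y => g (y + v)) x w.
Proof.
rewrite /derivable (_ : (fun h : R => h^-1 *: ((g \o shift (x + v)) (h *: w) - g (x + v))) =
  (fun h : R => h^-1 *: (((fun y => g (y + v)) \o shift x) (h *: w) - g (x + v))))//.
by apply/funext => h /=; rewrite addrA.
Qed.

Lemma derive_comm g x u v :
  (forall y, derivable g y u) -> (forall y, derivable g y v) ->
  (forall y, derivable ('D_u g) y v) -> (forall y, derivable ('D_v g) y u) ->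
  {for x, continuous ('D_u ('D_v g))} -> {for x, continuous ('D_v ('D_u g))} ->
  'D_u ('D_v g) x = 'D_v ('D_u g) x.
Proof.
move=> du dv duv dvu cuv cvu; apply/eqP; rewrite -subr_eq0 -normr_le0.
apply/ler_addgt0Pr => e e0; rewrite add0r.
have e20 : 0 < e / 2 by exact: divr_gt0.
have [d1 d10 H1] := continuous_eps cuv e20.
have [d2 d20 H2] := continuous_eps cvu e20.
have K0 : 0 < `|u| + `|v| + 1 by rewrite ltr_wpDl// addr_ge0.
pose h := Num.min d1 d2 / (`|u| + `|v| + 1) / 2.
have h0 : 0 < h by rewrite !divr_gt0// lt_min d10.
have [hd1 hd2] : h * (`|u| + `|v|) < d1 /\ h * (`|u| + `|v|) < d2.
  apply/andP; rewrite -lt_min.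
  have m0 : 0 < Num.min d1 d2 by rewrite lt_min d10.
  rewrite /h mulrAC ltr_pdivrMr// mulrAC ltr_pdivrMr//.
  rewrite -mulrA ltr_pM2l//; have := normr_ge0 u; have := normr_ge0 v; lra.
(* both mixed derivatives, at points close to x, equal the second difference over h^2 *)
have mixed a b : (forall y, derivable g y a) -> (forall y, derivable ('D_a g) y b) ->
    exists2 z, `|z - x| <= h * (`|a| + `|b|) &
    g (h *: a + h *: b + x) - g (h *: a + x) - g (h *: b + x) + g x =
      h * (h * 'D_b ('D_a g) z).
  move=> da db; pose psi := (fun y => g (y + h *: b)) - g.
  have dpsi y : derivable psi y a.
    exact: (derivableB (derivable_shift (da _)) (da y)).
  have [s [sh s0] E] := directional_mvt x h dpsi.
  have [t [th t0] E'] := directional_mvt (s *: a + x) h db.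
  exists (t *: b + (s *: a + x)).
    rewrite addrA addrK (le_trans (ler_normD _ _))// !normrZ mulrDr [leRHS]addrC.
    by rewrite (gtr0_norm h0) in sh th; rewrite lerD// ler_wpM2r.
  rewrite -E' [h *: b + (s *: a + x)]addrC -derive_shift.
  rewrite -(deriveB (derivable_shift (da _)) (da (s *: a + x))).
  rewrite -[RHS]E /psi !fctE [h *: b + x]addrC -!addrA [x + h *: b]addrC.
  by congr (_ + _); rewrite opprD opprK addrCA.
have [z1 z1x E1] := mixed v u dv dvu.
have [z2 z2x E2] := mixed u v du duv.
have Ez : 'D_u ('D_v g) z1 = 'D_v ('D_u g) z2.
  apply: (mulfI (lt0r_neq0 h0)); apply: (mulfI (lt0r_neq0 h0)).
  apply: (etrans (esym E1)); apply: (etrans _ E2).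
  by rewrite (addrC (h *: u) (h *: v)); congr (_ + _); exact: addrAC.
have h1 : `|z1 - x| < d1 by rewrite addrC in hd1; exact: le_lt_trans z1x hd1.
have B1 := H1 z1 h1; have B2 := H2 z2 (le_lt_trans z2x hd2).
rewrite Ez in B1; rewrite -(subrKA ('D_v ('D_u g) z2)) (splitr e).
apply: (le_trans (ler_normD _ _)); apply: lerD; last exact: B2.
by rewrite distrC; exact: B1.
Qed.
End DirectionalCalculus.

(** * Stability properties of smooth functions and their iterated derivatives *)

Section SmoothFunctions.
Context {R : realType} {V : normedModType R}.
Implicit Types (g f : V -> R) (x y u v w : V) (vs ws : seq V).

Lemma iterD_cons v vs g : iterD (v :: vs) g = 'D_v (iterD vs g).
Proof. by []. Qed.

Lemma iterD_cat vs ws g : iterD (vs ++ ws) g = iterD vs (iterD ws g).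
Proof. by rewrite /iterD foldr_cat. Qed.

Lemma smooth_iterD vs g : smooth g -> smooth (iterD vs g).
Proof. by move=> sg ws; rewrite -iterD_cat; exact: sg. Qed.

Lemma smooth_derive v g : smooth g -> smooth ('D_v g).
Proof. exact: (@smooth_iterD [:: v]). Qed.

Lemma smooth_continuous g : smooth g -> continuous g.
Proof. by case/(_ [::]). Qed.

Lemma smooth_derivable g x v : smooth g -> derivable g x v.
Proof. by case/(_ [::]) => _; exact. Qed.

Lemma smooth_deriveC g u v : smooth g -> 'D_u ('D_v g) = 'D_v ('D_u g).
Proof.
move=> sg; apply/funext => x.
have su := smooth_derive u sg; have sv := smooth_derive v sg.
have cuv : {for x, continuous ('D_u ('D_v g))}.
  exact: (smooth_continuous (smooth_derive u sv)).
have cvu : {for x, continuous ('D_v ('D_u g))}.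
  exact: (smooth_continuous (smooth_derive v su)).
exact: (derive_comm (fun y => smooth_derivable sg) (fun y => smooth_derivable sg)
  (fun y => smooth_derivable su) (fun y => smooth_derivable sv) cuv cvu).
Qed.

(** The symbol estimates list directions in the fixed order of [multi_dirs], while the mean value
    theorem produces them in the order of the differences; this reconciles the two. *)
Lemma iterD_perm vs ws g : smooth g -> perm_eq vs ws -> iterD vs g = iterD ws g.
Proof.
move=> sg.
have swap s1 v s2 : iterD (s1 ++ v :: s2) g = iterD (v :: s1 ++ s2) g.
  elim: s1 => [//|u s1 ih]; rewrite cat_cons iterD_cons ih.
  exact: (smooth_deriveC u v (smooth_iterD (s1 ++ s2) sg)).
elim: vs ws => [|v vs ih] ws; first by rewrite perm_sym => /perm_nilP ->.
move=> pvw; have : v \in ws by rewrite -(perm_mem pvw) mem_head.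
move=> /splitPr vws; case: vws pvw => s1 s2 pvw.
rewrite swap !iterD_cons (ih (s1 ++ s2))//.
by rewrite -(perm_cons v) (perm_trans pvw)// -cat1s perm_catCA.
Qed.

Lemma iterDD vs f g : smooth f -> smooth g ->
  iterD vs (fun x => f x + g x) = (fun x => iterD vs f x + iterD vs g x).
Proof.
move=> sf sg; elim: vs => [//|v vs ih]; rewrite !iterD_cons ih.
by apply/funext => x; rewrite -deriveD//; apply: smooth_derivable; exact: smooth_iterD.
Qed.

Lemma iterDZ vs g (a : R) : smooth g ->
  iterD vs (fun x => a * g x) = (fun x => a * iterD vs g x).
Proof.
move=> sg; elim: vs => [//|v vs ih]; rewrite !iterD_cons ih.
by apply/funext => x; rewrite -deriveMl//; apply: smooth_derivable; exact: smooth_iterD.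
Qed.

Lemma smoothD f g : smooth f -> smooth g -> smooth (fun x => f x + g x).
Proof.
move=> sf sg vs; rewrite iterDD//; split=> [x|x v].
  by apply: cvgD; [exact: (sf vs).1|exact: (sg vs).1].
by apply: derivableD; [exact: (sf vs).2|exact: (sg vs).2].
Qed.

Lemma smoothZ g (a : R) : smooth g -> smooth (fun x => a * g x).
Proof.
move=> sg vs; rewrite iterDZ//; split=> [x|x v].
  by apply: cvgM; [exact: cvg_cst|exact: (sg vs).1].
by apply: derivableM; [exact: derivable_cst|exact: (sg vs).2].
Qed.

Lemma smoothB f g : smooth f -> smooth g -> smooth (fun x => f x - g x).
Proof.
move=> sf sg; rewrite (_ : (fun x => _) = (fun x => f x + -1 * g x)); last first.
  by apply/funext => x; rewrite mulN1r.
exact: (smoothD sf (smoothZ (-1) sg)).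
Qed.

Lemma iterD_shift vs g v : iterD vs (fun x => g (x + v)) = (fun x => iterD vs g (x + v)).
Proof.
elim: vs => [//|w vs ih]; rewrite !iterD_cons ih.
by apply/funext => x; rewrite derive_shift.
Qed.

Lemma smooth_shift g v : smooth g -> smooth (fun x => g (x + v)).
Proof.
move=> sg vs; rewrite iterD_shift; split=> [x|x w]; last first.
  by apply: derivable_shift; exact: (sg vs).2.
apply: (@continuous_comp _ _ _ (fun y => y + v) (iterD vs g)); last exact: (sg vs).1.
by apply: cvgD; [exact: cvg_id|exact: cvg_cst].
Qed.

Lemma iterD_cst0 vs : iterD vs (fun _ : V => 0 : R) = (fun=> 0).
Proof.
elim: vs => [//|v vs ih]; rewrite !iterD_cons ih.
by apply/funext => x; rewrite (derive_cst (0 : R)).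
Qed.

Lemma smooth_cst0 : smooth (fun _ : V => 0 : R).
Proof.
move=> vs; rewrite iterD_cst0; split; first exact: cst_continuous.
by move=> x v; exact: (@derivable_cst _ _ _ (0 : R)).
Qed.

(* Iterated derivatives of f g are sums of products of smooth functions. *)
Let sumprod (s : seq ((V -> R) * (V -> R))) : V -> R :=
  fun x => \sum_(p <- s) p.1 x * p.2 x.

Lemma smoothM f g : smooth f -> smooth g -> smooth (fun x => f x * g x).
Proof.
move=> sf sg.
have der1 (s : seq ((V -> R) * (V -> R))) : (forall p, List.In p s -> smooth p.1 /\ smooth p.2) ->
    forall x v, derivable (sumprod s) x v /\
    'D_v (sumprod s) x = \sum_(p <- s) ('D_v p.1 x * p.2 x + p.1 x * 'D_v p.2 x).
  elim: s => [|p s ih] H x v.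
    rewrite (_ : sumprod [::] = cst 0); last by apply/funext => y; rewrite /sumprod big_nil.
    by rewrite big_nil derive_cst; split => //; exact: derivable_cst.
  have [sp1 sp2] := H p (or_introl erefl).
  have [d1 d2] := ih (fun p' Hp' => H p' (or_intror Hp')) x v.
  have dp1 : derivable p.1 x v := smooth_derivable sp1.
  have dp2 : derivable p.2 x v := smooth_derivable sp2.
  rewrite (_ : sumprod (p :: s) = p.1 * p.2 + sumprod s); last first.
    by apply/funext => y; rewrite /sumprod big_cons.
  have dp12 := derivableM dp1 dp2.
  split; first exact: (derivableD dp12 d1).
  rewrite (deriveD dp12 d1) d2 (deriveM dp1 dp2) big_cons; congr (_ + _).
  by rewrite addrC /GRing.scale/= mulrC.
have key vs : exists s, (forall p, List.In p s -> smooth p.1 /\ smooth p.2) /\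
    iterD vs (fun x => f x * g x) = sumprod s.
  elim: vs => [|v vs [s [Hs E]]].
    exists [:: (f, g)]; split; first by move=> p [<-|[]]; exact: (conj sf sg).
    by apply/funext => x; rewrite /sumprod big_seq1.
  rewrite iterD_cons E.
  exists (flatten [seq [:: ('D_v p.1, p.2); (p.1, 'D_v p.2)] | p <- s]); split.
    elim: s Hs {E} => [//|p s ih] Hs p' /= [<-|[<-|]] /=.
    - have [h1 h2] := Hs p (or_introl erefl); exact: (conj (smooth_derive v h1) h2).
    - have [h1 h2] := Hs p (or_introl erefl); exact: (conj h1 (smooth_derive v h2)).
    - by apply: ih => p'' Hp''; apply: Hs; right.
  apply/funext => x; rewrite (der1 s Hs x v).2 /sumprod big_flatten big_map.
  by apply: eq_bigr => p _; rewrite big_cons big_seq1.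
move=> vs; have [s [Hs ->]] := key vs; split; last by move=> x v; exact: (der1 s Hs x v).1.
move=> x; elim: s Hs => [|p s ih] Hs.
  rewrite (_ : sumprod [::] = cst 0); last by apply/funext => y; rewrite /sumprod big_nil.
  exact: cvg_cst.
rewrite (_ : sumprod (p :: s) = (fun y => p.1 y * p.2 y + sumprod s y)); last first.
  by apply/funext => y; rewrite /sumprod big_cons.
have [sp1 sp2] := Hs p (or_introl erefl).
apply: cvgD; last by apply: ih => p' Hp'; apply: Hs; right.
by apply: cvgM; exact: smooth_continuous.
Qed.
End SmoothFunctions.

(** * Iterated finite differences and their control by derivatives *)

Section Differences.
Context {R : realType} {V : normedModType R}.
Implicit Types (x y v w : V) (ws : seq V).

Definition diffs (W : zmodType) ws (g : V -> W) : V -> W :=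
  foldr (fun w h x => h (x + w) - h x) g ws.

Lemma diffs_cons (W : zmodType) w ws (g : V -> W) :
  diffs (w :: ws) g = fun x => diffs ws g (x + w) - diffs ws g x.
Proof. by []. Qed.

Lemma smooth_diffs ws (g : V -> R) : smooth g -> smooth (diffs ws g).
Proof.
move=> sg; elim: ws => [|w ws ih]; first exact: sg.
exact: (smoothB (smooth_shift w ih) ih).
Qed.

Lemma derive_diffs ws (g : V -> R) v : smooth g ->
  'D_v (diffs ws g) = diffs ws ('D_v g).
Proof.
move=> sg; elim: ws => [//|w ws ih]; rewrite !diffs_cons -ih.
have sd := smooth_diffs ws sg.
apply/funext => x; rewrite -derive_shift.
exact: (deriveB (smooth_derivable (smooth_shift w sd)) (smooth_derivable sd)).
Qed.

(** The region where the intermediate points of the iterated mean value theorem lie: [x] plus a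
    fraction, between 0 and 1, of each step. *)
Fixpoint in_span ws x y : Prop :=
  if ws is w :: ws' then exists2 t : R, 0 <= t <= 1 & in_span ws' (t *: w + x) y
  else x = y.

(** The mean value theorem turns the outermost difference into a derivative. As derivatives commute
    with differences, it can be moved onto [g], which leaves one difference fewer. *)
Lemma diffs_bound ws (g : V -> R) x (B : R) : smooth g ->
  (forall y, in_span ws x y -> `|iterD ws g y| <= B) -> `|diffs ws g x| <= B.
Proof.
elim: ws g x => [|w ws ih] g x sg H; first exact: H.
have sd := smooth_diffs ws sg.
rewrite diffs_cons.
have [t [t1 t0] E] := @directional_mvt R V (diffs ws g) x w 1 (fun y => smooth_derivable sd).
rewrite scale1r mul1r in E; rewrite (addrC x) E.
have -> : 'D_w (diffs ws g) (t *: w + x) = diffs ws ('D_w g) (t *: w + x).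
  exact: (congr1 (fun h => h (t *: w + x)) (derive_diffs ws w sg)).
apply: ih; first exact: (smooth_derive w sg).
move=> y hy; have -> : iterD ws ('D_w g) = iterD (w :: ws) g.
  rewrite -[LHS](iterD_cat ws [:: w]); apply: iterD_perm => //.
  by rewrite -cat1s perm_catC.
apply: H; exists t => //; rewrite t0//=.
by rewrite (le_trans (ler_norm _))// (le_trans t1)// normr1.
Qed.

Definition lincomb (c : seq (R * V)) : V := \sum_(p <- c) p.1 *: p.2.

Lemma derive_lincomb (c : seq (R * V)) (g : V -> R) x : smooth g ->
  'D_(lincomb c) g x = \sum_(p <- c) p.1 * 'D_(p.2) g x.
Proof.
move=> sg; have cD v y : {for y, continuous ('D_v g)}.
  exact: (smooth_continuous (smooth_derive v sg)).
elim: c => [|p c ih].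
  rewrite /lincomb !big_nil -(scale0r (0 : V)) deriveZ_dir ?mul0r// => y.
  exact: smooth_derivable.
rewrite /lincomb !big_cons deriveD_dir//.
- by rewrite deriveZ_dir// ?ih// => y; exact: smooth_derivable.
- by move=> y; exact: smooth_derivable.
- by move=> y; exact: smooth_derivable.
Qed.

(** Smoothness is proved together with the formula because splitting off a term requires the
    remaining sum to be smooth. *)
Lemma iterD_sum (I : Type) (s : seq I) (a : I -> R) (g : I -> V -> R) vs x :
  (forall i, smooth (g i)) ->
  iterD vs (fun y => \sum_(i <- s) a i * g i y) x = \sum_(i <- s) a i * iterD vs (g i) x
  /\ smooth (fun y => \sum_(i <- s) a i * g i y).
Proof.
move=> sg; elim: s x => [|i s ih] x.
  under eq_fun do rewrite big_nil; rewrite iterD_cst0 big_nil; split => //.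
  exact: smooth_cst0.
under eq_fun do rewrite big_cons.
have sm := (ih x).2; have sZ := smoothZ (a i) (sg i).
split; last exact: (smoothD sZ sm).
by rewrite (iterDD vs sZ sm) big_cons (iterDZ vs (a i) (sg i)) (ih x).1.
Qed.

(** An iterated derivative is multilinear in its directions. Expanding gives one term for each
    choice [vs] of a direction from every combination, and the absolute coefficients add up to the
    product of sums. *)
Lemma iterD_lincomb_bound (cs : seq (seq (R * V))) (g : V -> R) x (B : R) : smooth g -> 0 <= B ->
  (forall vs, all2 (fun v (c : seq (R * V)) => v \in map snd c) vs cs -> `|iterD vs g x| <= B) ->
  `|iterD (map lincomb cs) g x| <= (\prod_(c <- cs) \sum_(p <- c) `|p.1|) * B.
Proof.
(* The last direction is the one differentiated first, so peeling it replaces [g] by its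
   derivatives. *)
move=> + B0; elim/last_ind: cs g => [|cs c ih] g sg H.
  by rewrite big_nil mul1r; exact: (H [::]).
rewrite map_rcons -cats1 iterD_cat /=.
rewrite (_ : 'D_(lincomb c) g = fun y => \sum_(p <- c) p.1 * 'D_(p.2) g y); last first.
  by apply/funext => y; exact: derive_lincomb.
rewrite (@iterD_sum _ c fst (fun p => 'D_(p.2) g) (map lincomb cs) x (fun p => smooth_derive p.2 sg)).1.
rewrite -cats1 big_cat big_seq1 /= -mulrA mulrCA mulr_suml.
rewrite (le_trans (ler_norm_sum _ _ _))//.
rewrite big_seq [leRHS]big_seq ler_sum// => p pc.
rewrite normrM ler_wpM2l//; apply: ih; first exact: smooth_derive.
move=> vs Hvs; rewrite -[iterD vs _]/(iterD vs (iterD [:: p.2] g)) -iterD_cat.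
apply: H; elim: vs cs Hvs => [|v vs ihv] [|c' cs]//=.
  by rewrite andbT => _; exact: map_f.
by move=> /andP[-> /ihv].
Qed.
End Differences.

(** * The bracket <x> *)

Section JapaneseBracket.
Context {R : realType} (d : nat).
Implicit Types x y : 'rV[R]_d.

Lemma dotR_ge0 x : 0 <= dotR x x.
Proof. by apply: sumr_ge0 => i _; rewrite -expr2 sqr_ge0. Qed.

Lemma sqr_japanese x : japanese x ^+ 2 = 1 + dotR x x.
Proof. by rewrite sqr_sqrtr// addr_ge0// dotR_ge0. Qed.

Lemma japanese_ge1 x : 1 <= japanese x.
Proof. by rewrite -[leLHS]sqrtr1 ler_wsqrtr// lerDl dotR_ge0. Qed.

Lemma japanese_gt0 x : 0 < japanese x.
Proof. exact: lt_le_trans ltr01 (japanese_ge1 x). Qed.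

Lemma japanese_ge0 x : 0 <= japanese x. Proof. exact: ltW (japanese_gt0 x). Qed.

Lemma sqr_coord_le_japanese x i : 1 + x 0 i ^+ 2 <= japanese x ^+ 2.
Proof.
rewrite sqr_japanese lerD2l /dotR (bigD1 i)//= expr2 lerDl.
by apply: sumr_ge0 => j _; rewrite -expr2 sqr_ge0.
Qed.

Lemma coord_le_japanese x i : `|x 0 i| <= japanese x.
Proof.
rewrite -(ler_pXn2r (ltn0Sn 1)) ?nnegrE ?japanese_ge0// real_normK ?num_real//.
by rewrite (le_trans _ (sqr_coord_le_japanese x i))// lerDr.
Qed.

Lemma japanese_le_coord x (M : R) : (forall i, `|x 0 i| <= M) ->
  japanese x ^+ 2 <= 1 + d%:R * M ^+ 2.
Proof.
move=> xM; rewrite sqr_japanese lerD2l /dotR.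
rewrite mulr_natl -[X in _ *+ X](card_ord d) -sumr_const ler_sum// => i _.
have M0 : 0 <= M := le_trans (normr_ge0 _) (xM i).
by rewrite -expr2 -[leLHS]real_normK ?num_real// ler_pXn2r ?nnegrE.
Qed.

(* weighted AM-GM, with the weight <y>/<x> *)
Lemma dotR_le_japanese x y : dotR x y <= japanese x * japanese y.
Proof.
have jx := japanese_gt0 x; have jy := japanese_gt0 y.
suff : dotR x y *+ 2 * (japanese x * japanese y) <=
    (japanese x * japanese y) *+ 2 * (japanese x * japanese y).
  by rewrite ler_pM2r ?mulr_gt0// lerMn2r.
apply: (@le_trans _ _ (dotR x x * japanese y ^+ 2 + dotR y y * japanese x ^+ 2)).
  rewrite /dotR -sumrMnl !mulr_suml -big_split ler_sum// => i _ /=.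
  rewrite -subr_ge0 (_ : _ - _ = (x 0 i * japanese y - y 0 i * japanese x) ^+ 2).
    exact: sqr_ge0.
  by ring.
have hx : dotR x x <= japanese x ^+ 2 by rewrite sqr_japanese lerDr.
have hy : dotR y y <= japanese y ^+ 2 by rewrite sqr_japanese lerDr.
rewrite [leRHS](_ : _ = japanese x ^+ 2 * japanese y ^+ 2 + japanese y ^+ 2 * japanese x ^+ 2).
  by rewrite lerD// ler_wpM2r// sqr_ge0.
by ring.
Qed.

Lemma japanese_triangle x y : japanese (x + y) <= japanese x + japanese y.
Proof.
have jx := japanese_ge0 x; have jy := japanese_ge0 y.
rewrite -(ler_pXn2r (ltn0Sn 1)) ?nnegrE ?japanese_ge0 ?addr_ge0//.
rewrite sqrrD !sqr_japanese.
have -> : dotR (x + y) (x + y) = dotR x x + dotR x y *+ 2 + dotR y y.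
  rewrite /dotR -sumrMnl -!big_split; apply: eq_bigr => i _ /=; rewrite !mxE.
  by ring.
have := dotR_le_japanese x y; rewrite -(ler_pMn2r (ltn0Sn 1)); lra.
Qed.

Lemma japaneseN x : japanese (- x) = japanese x.
Proof.
by congr (Num.sqrt (1 + _)); apply: eq_bigr => i _; rewrite !mxE mulrNN.
Qed.

Lemma japanese_scale (t : R) x : 0 <= t <= 1 -> japanese (t *: x) <= japanese x.
Proof.
move=> /andP[t0 t1]; rewrite ler_wsqrtr// lerD2l ler_sum// => i _.
rewrite !mxE mulrACA -expr2 ler_piMl ?exprn_ile1//.
by rewrite -expr2 sqr_ge0.
Qed.

(** Two numbers that are at least 1 have sum at most twice their product. *)
Lemma japanese_peetre x y : japanese (x + y) <= 2 * japanese x * japanese y.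
Proof.
rewrite (le_trans (japanese_triangle x y))//.
have := japanese_ge1 x; have := japanese_ge1 y => h1 h2.
have : 0 <= (japanese x - 1) * (japanese y - 1) by rewrite mulr_ge0// subr_ge0.
have : 0 <= japanese x * japanese y by rewrite mulr_ge0// japanese_ge0.
lra.
Qed.

Lemma measurable_dotR d' (T : measurableType d') (f g : T -> 'rV[R]_d) :
  measurable_fun setT f -> measurable_fun setT g ->
  measurable_fun setT (fun t => dotR (f t) (g t)).
Proof.
move=> mf mg; apply: measurable_sum => i.
by apply: measurable_funM; apply: (measurableT_comp (measurable_coord i)).
Qed.

Lemma measurable_japanese : measurable_fun setT (@japanese R d).
Proof.
apply: (measurableT_comp (continuous_measurable_fun (@sqrt_continuous R))).
by apply: measurable_realfun.measurable_funD => //; exact: measurable_dotR.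
Qed.

Lemma powR_japanese_gt0 (s : R) x : 0 < japanese x `^ s.
Proof. by rewrite powR_gt0// japanese_gt0. Qed.

Lemma measurable_powR_japanese (s : R) :
  measurable_fun setT (fun x => japanese x `^ s).
Proof. exact: (measurableT_comp (measurable_powR s) measurable_japanese). Qed.
End JapaneseBracket.

(** * Integrability of powers of 1 + x^2 on the line *)

Section BracketIntegrable.
Context {R : realType}.
Local Notation leb := (@lebesgue_measure R).

Lemma is_derive_continuous (f : R -> R) (x df : R) :
  is_derive x (1 : R) f df -> {for x, continuous f}.
Proof.
move=> h; apply: differentiable_continuous; apply/derivable1_diffP.
exact: ex_derive.
Qed.

Lemma continuous_powR (s x : R) : 0 < x -> {for x, continuous (fun y : R => y `^ s)}.
Proof. by move=> x0; exact: (is_derive_continuous (is_derive1_powR s x0)). Qed.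

Lemma powR_cvg_infty (s : R) : 0 < s -> (1 + x) `^ (- s) @[x --> +oo%R] --> (0 : R).
Proof.
move=> s0; apply/cvgrPdist_le => e e0; near=> x.
have x0 : 0 < x by near: x; exact: nbhs_pinfty_gt.
rewrite sub0r normrN ger0_norm ?powR_ge0//.
have xe : e `^ (- s^-1) <= x by near: x; apply: nbhs_pinfty_ge; rewrite num_real.
rewrite powRN -[leRHS]invrK lef_pV2 ?posrE ?invr_gt0 ?powR_gt0//; last first.
  by rewrite addr_gt0.
apply: (@le_trans _ _ ((e `^ (- s^-1)) `^ s)).
  by rewrite -powRrM mulNr mulVf ?gt_eqF// powR_inv1// ltW.
apply: ge0_ler_powR; first exact: ltW.
- by rewrite nnegrE powR_ge0.
- by rewrite nnegrE addr_ge0// ltW.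
- by rewrite (le_trans xe)// lerDr.
Unshelve. all: by end_near. Qed.

Lemma integral_powR_tail (s : R) : 1 < s ->
  (\int[leb]_(x in `[0%R, +oo[) ((1 + x) `^ (- s))%:E < +oo)%E.
Proof.
move=> s1; have s10 : 0 < s - 1 by rewrite subr_gt0.
pose F (x : R) := - (s - 1)^-1 * (1 + x) `^ (- (s - 1)).
have dF (x : R) : 0 <= x -> is_derive x (1 : R) F ((1 + x) `^ (- s)).
  move=> x0; have x10 : 0 < 1 + x by rewrite ltr_pwDl.
  have h1 : is_derive x (1 : R) (fun x : R => 1 + x) 1.
    by have := is_deriveD (is_derive_cst (1 : R) x 1) (is_derive_id x (1 : R)); rewrite add0r.
  have h := is_derive1_comp (is_derive1_powR (- (s - 1)) x10) h1.
  have := is_deriveZ (- (s - 1)^-1) h; rewrite /GRing.scale/= => hh.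
  apply: is_derive_eq hh _.
  rewrite mulr1 mulrA mulrNN mulVf ?gt_eqF// mul1r; congr (_ `^ _); ring.
rewrite (@ge0_continuous_FTC2y R _ F 0 0).
- by rewrite -EFinB ltry.
- by move=> x _; rewrite powR_ge0.
- apply: continuous_in_subspaceT => x; rewrite inE/= in_itv/= andbT => x0.
  have x10 : 0 < 1 + x by rewrite ltr_pwDl.
  apply: (@continuous_comp _ _ _ (fun x : R => 1 + x) (fun y : R => y `^ (- s))).
    by apply: cvgD; [exact: cvg_cst|exact: cvg_id].
  exact: continuous_powR.
- rewrite -[X in _ --> X](mulr0 (- (s - 1)^-1)).
  by apply: cvgM; [exact: cvg_cst|exact: powR_cvg_infty].
- by move=> x x0; have h := dF x (ltW x0); exact: ex_derive.
- by apply: cvg_at_right_filter; exact: (is_derive_continuous (dF 0 (lexx _))).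
- by move=> x; rewrite in_itv/= andbT => x0; have h := dF x (ltW x0); rewrite derive1E derive_val.
Qed.

Lemma continuous_bracket1 (s : R) : continuous (fun x : R => (1 + x ^+ 2) `^ s).
Proof.
move=> x; have x10 : 0 < 1 + x ^+ 2 by rewrite ltr_pwDl// sqr_ge0.
apply: (@continuous_comp _ _ _ (fun x : R => 1 + x ^+ 2) (fun y : R => y `^ s)).
  by apply: cvgD; [exact: cvg_cst|exact: exprn_continuous].
exact: continuous_powR.
Qed.

Lemma integral_bracket1 (s : R) : 1 / 2 < s ->
  (\int[leb]_x ((1 + x ^+ 2) `^ (- s))%:E < +oo)%E.
Proof.
move=> s12; rewrite ge0_symfun_integralT; last 3 first.
- by move=> x; rewrite powR_ge0.
- exact: continuous_bracket1.
- by move=> x /=; rewrite sqrrN.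
rewrite lte_mul_pinfty// -set_itvcy.
have s1 : 1 < 2 * s by lra.
have := integral_powR_tail s1; set J := (\int[_]_(x in _) _)%E => Joo.
(* The factor comes from (1 + x)^2 <= 2 (1 + x^2), raised to the power s. *)
apply: (@le_lt_trans _ _ ((2 `^ s)%:E * J)%E); last first.
  by rewrite lte_mul_pinfty// lee_fin powR_ge0.
have mpow t : measurable_fun (`[0%R, +oo[ : set R) (fun x : R => ((1 + x) `^ t)%:E).
  apply/measurable_EFinP; apply: measurable_funTS.
  apply: (measurableT_comp (measurable_powR t)).
  by apply: measurable_realfun.measurable_funD.
rewrite -ge0_integralZl//; last 2 first.
- exact: mpow.
- by move=> x _; rewrite lee_fin powR_ge0.
have mbr : measurable_fun (`[0%R, +oo[ : set R) (fun x : R => ((1 + x ^+ 2) `^ (- s))%:E).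
  apply/measurable_EFinP; apply: measurable_funTS.
  exact: (continuous_measurable_fun (@continuous_bracket1 _)).
apply: ge0_le_integral.
- exact: measurable_itv.
- by move=> x _; rewrite lee_fin powR_ge0.
- exact: mbr.
- exact: measurable_funeM (mpow _).
move=> x; rewrite /= in_itv/= andbT => x0.
rewrite -EFinM lee_fin.
have x10 : 0 <= 1 + x by rewrite addr_ge0.
have x20 : 0 < 1 + x ^+ 2 by rewrite ltr_pwDl// sqr_ge0.
have s0 : 0 <= s by lra.
have h : (1 + x) `^ (2 * s) <= 2 `^ s * (1 + x ^+ 2) `^ s.
  rewrite -powRM ?(ltW x20)// powRrM; apply: ge0_ler_powR => //.
  - by rewrite nnegrE powR_ge0.
  - by rewrite nnegrE mulr_ge0// ltW.
  rewrite powR_mulrn//.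
  by rewrite -subr_ge0 (_ : _ - _ = (1 - x) ^+ 2) ?sqr_ge0//; ring.
have x1s : 0 < (1 + x) `^ (2 * s) by rewrite powR_gt0// ltr_pwDl.
have x2s : 0 < (1 + x ^+ 2) `^ s by rewrite powR_gt0.
by rewrite !powRN ler_pdivlMr// mulrC ler_pdivrMr.
Qed.
End BracketIntegrable.

(** * Integrals of products of functions of one coordinate *)

Section ProductIntegrals.
Context {R : realType}.
Local Notation leb := (@lebesgue_measure R).

Lemma prod_cons_rV d (A : comPzRingType) (g : 'I_d.+1 -> R -> A) x (y : 'rV[R]_d) :
  \prod_i g i (cons_rV x y 0 i) = g ord0 x * \prod_i g (lift ord0 i) (y 0 i).
Proof.
by rewrite big_ord_recl cons_rV0; congr (_ * _); apply: eq_bigr => i _; rewrite cons_rVS.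
Qed.

Lemma measurable_prod_coord d (g : R -> R) :
  measurable_fun (setT : set (measurableTypeR R)) g ->
  measurable_fun setT (fun x : 'rV[R]_d => \prod_i g (x 0 i)).
Proof.
move=> mg; apply: measurable_prod => i _.
exact: (measurableT_comp mg (measurable_coord i)).
Qed.

Lemma ge0_integral_prod_coord d (g : R -> R) :
  measurable_fun (setT : set (measurableTypeR R)) g -> (forall t, 0 <= g t) ->
  (\int[@lebesgue_rV R d]_x (\prod_i g (x 0%R i))%:E = (\int[leb]_t (g t)%:E) ^+ d)%E.
Proof.
move=> mg g0; elim: d => [|d ih].
  rewrite integral_lebesgue_rV0 ?big_ord0//.
  by apply/measurable_EFinP; exact: measurable_prod_coord.
rewrite ge0_integral_cons_rV; last 2 first.
- by apply/measurable_EFinP; exact: measurable_prod_coord.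
- by move=> x; rewrite lee_fin prodr_ge0.
rewrite expeS -ge0_integralZr//; last 3 first.
- exact/measurable_EFinP.
- by move=> x _; rewrite lee_fin.
- by rewrite -ih integral_ge0// => x _; rewrite lee_fin prodr_ge0.
apply: eq_integral => x _; rewrite -ih -ge0_integralZl//; last 3 first.
- by apply/measurable_EFinP; exact: measurable_prod_coord.
- by move=> y _; rewrite lee_fin prodr_ge0.
- by rewrite lee_fin.
by apply: eq_integral => y _; rewrite (prod_cons_rV (fun=> g)) EFinM.
Qed.

Lemma expe_lty (x : \bar R) n : (0 <= x)%E -> (x < +oo)%E -> (x ^+ n < +oo)%E.
Proof.
move=> x0 xoo; elim: n => [|n ih]; first by rewrite expe0 ltry.
by rewrite expeS lte_mul_pinfty// ge0_fin_numE.
Qed.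

Lemma normc_prod (I : Type) (s : seq I) (F : I -> R[i]) :
  normc (\prod_(i <- s) F i) = \prod_(i <- s) normc (F i).
Proof.
elim: s => [|i s ih]; first by rewrite !big_nil ComplexField.Normc.normc1.
by rewrite !big_cons normcM ih.
Qed.

Lemma cmeasurable_prod d (T : measurableType d) (I : Type) (s : seq I) (F : I -> T -> R[i]) :
  (forall i, cmeasurable (F i)) -> cmeasurable (fun x => \prod_(i <- s) F i x).
Proof.
move=> mF; elim: s => [|i s ih].
  by under eq_fun do rewrite big_nil; exact: cmeasurable_cst.
by under eq_fun do rewrite big_cons; exact: cmeasurableM.
Qed.

(** Using one majorant [h] for all factors, the remaining coordinates are again dominated by a
    product of copies of [h], whose integral is a power; this is what Fubini needs at each step of
    the induction. *)
Lemma cintegral_prod_coord d (G : 'I_d -> R -> R[i]) (h : R -> R) :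
  (forall i, cmeasurable (G i : measurableTypeR R -> _)) ->
  measurable_fun (setT : set (measurableTypeR R)) h ->
  (forall i t, normc (G i t) <= h t) -> (\int[leb]_t (h t)%:E < +oo)%E ->
  (forall t, 0 <= h t) ->
  cintegral (@lebesgue_rV R d) (fun x => \prod_i G i (x 0 i)) =
  \prod_i cintegral leb (G i).
Proof.
move=> + mh + hoo h0; elim: d G => [|d ih] G mG Gh.
  rewrite big_ord0 /cintegral; under eq_Rintegral do rewrite big_ord0.
  under [X in _ +i* X]eq_Rintegral do rewrite big_ord0.
  by rewrite /= /Rintegral !integral_lebesgue_rV0.
have cm k (F : 'I_k -> R -> R[i]) : (forall i, cmeasurable (F i : measurableTypeR R -> _)) ->
    cmeasurable (fun x : 'rV[R]_k => \prod_i F i (x 0 i)).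
  move=> mF; apply: cmeasurable_prod => i.
  exact: (cmeasurable_comp (mF i) (measurable_coord i)).
have mhd := @measurable_prod_coord d h mh.
have hd0 (y : 'rV[R]_d) : 0 <= \prod_i h (y 0 i) by exact: prodr_ge0.
have hoo' : (\int[@lebesgue_rV R d]_y (\prod_i h (y 0%R i))%:E < +oo)%E.
  rewrite ge0_integral_prod_coord// expe_lty// integral_ge0// => x _.
  by rewrite lee_fin.
have le_prod (y : 'rV[R]_d) :
    normc (\prod_i G (lift ord0 i) (y 0 i)) <= \prod_i h (y 0 i).
  by rewrite normc_prod ler_prod// => i _; rewrite normc_ge0 Gh.
have bnd x (y : 'rV[R]_d) :
    normc (\prod_i G i (cons_rV x y 0 i)) <= h x * \prod_i h (y 0 i).
  by rewrite prod_cons_rV normcM ler_pM ?normc_ge0.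
rewrite (cintegral_cons_rV (cm _ G mG) mh mhd h0 hd0 hoo hoo' bnd).
rewrite big_ord_recl -(ih _ (fun i => mG (lift ord0 i)) (fun i => Gh (lift ord0 i))).
have iG' : cintegrable (@lebesgue_rV R d) (fun y : 'rV[R]_d => \prod_i G (lift ord0 i) (y 0 i)).
  apply: (le_cintegrable (g := fun y : 'rV[R]_d => (\prod_i h (y 0%R i))%:E)) => //.
  - exact: (cm d (fun i => G (lift ord0 i))).
  - exact/measurable_EFinP.
have iG0 : cintegrable leb (G ord0).
  apply: (le_cintegrable (g := fun y : measurableTypeR R => (h y)%:E)) => //.
  - exact/measurable_EFinP.
  - by move=> y; rewrite lee_fin.
pose c := cintegral (@lebesgue_rV R d) (fun y : 'rV[R]_d => \prod_i G (lift ord0 i) (y 0 i)).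
transitivity (cintegral leb (fun x => c * G ord0 x)).
  apply: eq_cintegral => x; rewrite (eq_cintegral _ (fun y => prod_cons_rV G x y)).
  exact: (etrans (cintegralZ (G ord0 x) iG') (mulrC _ _)).
exact: (etrans (cintegralZ c iG0) (mulrC _ _)).
Qed.
End ProductIntegrals.

(** * Integrability of powers of the bracket on R^d *)

Section BracketIntegrableRV.
Context {R : realType}.

Lemma integral_bracket d (s : R) : d%:R < s ->
  (\int[@lebesgue_rV R d]_x (japanese x `^ (- s))%:E < +oo)%E.
Proof.
case: d => [|d] ds.
  by rewrite integral_lebesgue_rV0 ?ltry//; apply/measurable_EFinP; exact: measurable_powR_japanese.
(* The power <x>^(-s) is split evenly over the coordinates, as a product of copies of (<x>^2)^(-sg),
   each at most (1 + x_i^2)^(-sg). The condition on [s] says exactly that [sg] exceeds 1/2. *)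
pose sg := s / (2 * d.+1%:R).
have d0 : 0 < d.+1%:R :> R by [].
have sg12 : 1 / 2 < sg.
  by rewrite /sg ltr_pdivlMr ?mulr_gt0//; lra.
pose g (t : R) := (1 + t ^+ 2) `^ (- sg).
have mg : measurable_fun (setT : set (measurableTypeR R)) g.
  exact: (continuous_measurable_fun (@continuous_bracket1 _ _)).
have g0 t : 0 <= g t by rewrite powR_ge0.
have := integral_bracket1 sg12; rewrite -/g => goo.
apply: (@le_lt_trans _ _ ((\int[@lebesgue_measure R]_t (g t)%:E) ^+ d.+1)%E); last first.
  by rewrite expe_lty// integral_ge0// => x _; rewrite lee_fin.
rewrite -ge0_integral_prod_coord//; apply: ge0_le_integral => //.
- by move=> x _; rewrite lee_fin powR_ge0.
- by apply/measurable_EFinP; exact: measurable_powR_japanese.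
- by apply/measurable_EFinP; exact: measurable_prod_coord.
move=> x _; rewrite lee_fin /g.
have jE : japanese x `^ (- s) = \prod_(i < d.+1) (japanese x ^+ 2) `^ (- sg).
  rewrite prodr_const card_ord -powR_mulrn ?powR_ge0// -powRrM -powR_mulrn ?japanese_ge0//.
  rewrite -powRrM; congr (_ `^ _); rewrite /sg; field.
  by rewrite !gt_eqF//.
rewrite jE; apply: ler_prod => i _; rewrite powR_ge0/=.
have x0 : 0 < 1 + x 0 i ^+ 2 by rewrite ltr_pwDl// sqr_ge0.
have sg0 : 0 <= sg by lra.
rewrite !powRN lef_pV2 ?posrE ?powR_gt0//; last by rewrite exprn_gt0// japanese_gt0.
apply: ge0_ler_powR => //; rewrite ?nnegrE ?sqr_ge0 ?(ltW x0)//.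
exact: sqr_coord_le_japanese.
Qed.
End BracketIntegrableRV.

(** * The Fourier transform of exp(-|t|) *)

Section PoissonKernel.
Context {R : realType}.
Local Notation leb := (@lebesgue_measure R).
Implicit Types a t : R.

Let is_derive_expN t : is_derive t (1 : R) (fun s : R => expR (- s)) (- expR (- t)).
Proof.
have h := is_derive1_comp (is_derive_expR (- t)) (is_deriveNid t (1 : R)).
by apply: is_derive_eq h _; rewrite mulrN1.
Qed.

Let is_derive_lin a t : is_derive t (1 : R) (fun s : R => a * s) a.
Proof.
have h := is_deriveZ a (is_derive_id t (1 : R)).
by apply: is_derive_eq h _; rewrite /GRing.scale/= mulr1.
Qed.

Let is_derive_sinl a t : is_derive t (1 : R) (fun s : R => sin (a * s)) (cos (a * t) * a).
Proof. exact: (is_derive1_comp (is_derive_sin (a * t)) (is_derive_lin a t)). Qed.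

Let is_derive_cosl a t : is_derive t (1 : R) (fun s : R => cos (a * s)) (- sin (a * t) * a).
Proof. exact: (is_derive1_comp (is_derive_cos (a * t)) (is_derive_lin a t)). Qed.

Let a21 a : 0 < 1 + a ^+ 2. Proof. by rewrite ltr_pwDl// sqr_ge0. Qed.

(** The cofactor of [expR (- t)] in an antiderivative of [expR (- t) * (1 + cos (a * t))]; the final
    -1 accounts for the summand 1. *)
Let k a (t : R) : R := (a * sin (a * t) - cos (a * t)) / (1 + a ^+ 2) - 1.

Let is_derive_prim a t : is_derive t (1 : R) (fun s : R => expR (- s) * k a s)
  (expR (- t) * (1 + cos (a * t))).
Proof.
have h1 := is_deriveZ a (is_derive_sinl a t).
have h2 := is_deriveB h1 (is_derive_cosl a t).
have h3 := is_deriveZ ((1 + a ^+ 2)^-1) h2.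
have h4 := is_deriveB h3 (is_derive_cst (1 : R) t 1).
have h5 := is_deriveM (is_derive_expN t) h4.
rewrite (_ : (fun s : R => expR (- s) * k a s) = ((fun s : R => expR (- s)) *
   ((1 + a ^+ 2)^-1 \*: ((a \*: (fun s : R => sin (a * s))) - (fun s : R => cos (a * s))) -
    cst 1))); last first.
  apply/funext => s; rewrite !fctE /k /GRing.scale/=; congr (_ * (_ - _)).
  by rewrite mulrC.
apply: is_derive_eq h5 _.
rewrite !fctE /GRing.scale/= /GRing.scale/=; have := gt_eqF (a21 a) => h.
by field; rewrite h.
Qed.

Let k_bound a t : `|k a t| <= `|a| + 2.
Proof.
rewrite (le_trans (ler_normB _ _))// normr1 -[X in _ <= _ + X]/(1 + 1) addrA lerD2r.
rewrite normrM normfV (gtr0_norm (a21 a)) ler_pdivrMr//.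
rewrite (le_trans (ler_normB _ _))//.
have h1 : `|a * sin (a * t)| <= `|a|.
  by rewrite normrM ler_piMr// ler_norml sin_geN1 sin_le1.
have h2 : `|cos (a * t)| <= 1 by rewrite ler_norml cos_geN1 cos_le1.
apply: le_trans (lerD h1 h2) _.
by rewrite mulrDr mulr1 lerDl mulr_ge0 ?sqr_ge0// addr_ge0.
Qed.

Let cvg_prim a : expR (- t) * k a t @[t --> +oo%R] --> (0 : R).
Proof.
have h : expR (- t) * (`|a| + 2) @[t --> +oo%R] --> (0 : R).
  rewrite -[X in _ --> X](mul0r (`|a| + 2)); apply: cvgM; last exact: cvg_cst.
  exact: cvgr_expR.
apply/cvgrPdist_le => e e0; move/cvgrPdist_le : h => /(_ e e0); apply: filterS => t.
rewrite !sub0r !normrN; apply: le_trans; rewrite !normrM ler_wpM2l//.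
by rewrite (le_trans (k_bound a t))// ler_norm.
Qed.

Lemma continuous_expNabs : continuous (fun t : R => expR (- `|t|)).
Proof.
move=> t; apply: (@continuous_comp _ _ _ (fun t : R => - `|t|) expR).
  by apply: cvgN; exact: norm_continuous.
exact: continuous_expR.
Qed.

Let continuous_cosl a : continuous (fun t : R => cos (a * t)).
Proof. by move=> t; exact: (is_derive_continuous (is_derive_cosl a t)). Qed.

(** The summand 1 makes the integrand nonnegative, so that the fundamental theorem on a half-line
    applies directly. It is subtracted again once the integral of exp(-|t|) is known. *)
Lemma integral_expN_cos a :
  (\int[leb]_t (expR (- `|t|) * (1 + cos (a * t)))%:E = (2 * (1 + (1 + a ^+ 2)^-1))%:E)%E.
Proof.
have cos1 t : 0 <= 1 + cos (a * t) by have := cos_geN1 (a * t); lra.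
have cg : continuous (fun t : R => expR (- t) * (1 + cos (a * t))).
  move=> t; apply: cvgM; first exact: (is_derive_continuous (is_derive_expN t)).
  by apply: cvgD; [exact: cvg_cst|exact: continuous_cosl].
rewrite ge0_symfun_integralT; last 3 first.
- by move=> t; rewrite mulr_ge0// expR_ge0.
- move=> t; apply: cvgM; first exact: continuous_expNabs.
  by apply: cvgD; [exact: cvg_cst|exact: continuous_cosl].
- by move=> t /=; rewrite normrN mulrN cosN.
rewrite -set_itvcy EFinM; congr (_ * _)%E.
under eq_integral => t; first (rewrite inE/= in_itv/= andbT => t0; rewrite ger0_norm//; over).
rewrite (@ge0_continuous_FTC2y R _ (fun t => expR (- t) * k a t) 0 0).
- rewrite /k mulr0 oppr0 expR0 sin0 cos0 mulr0 -EFinB; congr EFin.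
  by have := gt_eqF (a21 a) => h; field; rewrite h.
- by move=> t t0; rewrite mulr_ge0// expR_ge0.
- by apply: continuous_subspaceT => t; exact: cg.
- exact: cvg_prim.
- by move=> t t0; have h := is_derive_prim a t; exact: ex_derive.
- by apply: cvg_at_right_filter; exact: (is_derive_continuous (is_derive_prim a 0)).
- by move=> t _; have h := is_derive_prim a t; rewrite derive1E derive_val.
Qed.

Lemma measurable_expNabs : measurable_fun (setT : set (measurableTypeR R))
  (fun t : R => expR (- `|t|)).
Proof. exact: (continuous_measurable_fun continuous_expNabs). Qed.

(** This is half of the preceding integral at [a = 0]. *)
Lemma integral_expNabs : (\int[leb]_t (expR (- `|t|))%:E = (2 : R)%:E)%E.
Proof.
have := integral_expN_cos 0.
under eq_integral do rewrite mul0r cos0 mulrC EFinM.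
have mE : measurable_fun (setT : set (measurableTypeR R)) (fun t : R => (expR (- `|t|))%:E).
  by apply/measurable_EFinP; exact: measurable_expNabs.
have e0 (t : R) : (0 <= (expR (- `|t|))%:E)%E by rewrite lee_fin expR_ge0.
rewrite ge0_integralZl//; set J := (\int[leb]_t (expR (- `|t|))%:E)%E => JE.
have {}JE : ((1 + 1)%:E * J = (2 * (1 + (1 + 0 ^+ 2)^-1))%:E)%E by exact: JE.
have J0 : (0 <= J)%E by apply: integral_ge0.
move: J J0 JE => [x|_|//]; last by rewrite gt0_muley ?lte_fin.
by move=> _ [] h; congr EFin; move: h; rewrite expr0n addr0 invr1; lra.
Qed.

Lemma cintegral_expNabs_cis a :
  cintegral leb (fun t : measurableTypeR R => (expR (- `|t|))%:C * cis (- (a * t))) =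
  (2 / (1 + a ^+ 2))%:C.
Proof.
have me := measurable_expNabs.
have mc : cmeasurable (fun t : measurableTypeR R => (expR (- `|t|))%:C * cis (- (a * t))).
  apply: cmeasurableM; first exact: cmeasurable_real.
  by apply: cmeasurable_cis; apply: measurable_realfun.measurable_funN; exact: measurable_funM.
apply: complex_eqP.
- change (\int[leb]_t complex.Re ((expR (- `|t|))%:C * cis (- (a * t))) = 2 / (1 + a ^+ 2)).
  transitivity (\int[leb]_t (expR (- `|t|) * cos (a * t))).
    by apply: eq_Rintegral => t _; rewrite cReM /= mul0r subr0 cosN.
  have ie : leb.-integrable setT (EFin \o (fun t : R => expR (- `|t|))).
    apply/integrableP; split; first exact/measurable_EFinP.
    under eq_integral do rewrite /= ger0_norm ?expR_ge0//.
    by rewrite integral_expNabs ltry.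
  have iec : leb.-integrable setT (EFin \o (fun t : R => expR (- `|t|) * (1 + cos (a * t)))).
    apply/integrableP; split.
      apply/measurable_EFinP; apply: measurable_funM => //.
      apply: measurable_realfun.measurable_funD => //.
      exact: (continuous_measurable_fun (@continuous_cosl a)).
    under eq_integral => t _.
      rewrite /= ger0_norm; last first.
        by rewrite mulr_ge0 ?expR_ge0//; have := cos_geN1 (a * t); lra.
      over.
    by rewrite integral_expN_cos ltry.
  transitivity (\int[leb]_t (expR (- `|t|) * (1 + cos (a * t)) - expR (- `|t|))).
    by apply: eq_Rintegral => t _; ring.
  rewrite RintegralB// /Rintegral integral_expN_cos integral_expNabs /=.
  by have := gt_eqF (a21 a) => h; field; rewrite h.
- change (\int[leb]_t complex.Im ((expR (- `|t|))%:C * cis (- (a * t))) = 0).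
  have E (f : R -> R) : measurable_fun (setT : set (measurableTypeR R)) f ->
      \int[leb]_t f t = \int[leb]_t f (- t).
    move=> mf; rewrite /Rintegral; congr fine.
    apply: (eq_integral_nonneg (phi := (-%R : measurableTypeR R -> measurableTypeR R))
      _ (f := EFin \o f)); last exact/measurable_EFinP.
    move=> g mg g0; rewrite (@ge0_integral_affine1 R (-1) 0)// ?oppr_eq0 ?oner_eq0//.
    rewrite normrN normr1 mul1e; apply: eq_integral => t _.
    by rewrite mulN1r addr0.
  set f := fun t : R => complex.Im _.
  (* The imaginary part is an odd function of [t]. *)
  have iN : \int[leb]_t f t = - \int[leb]_t f t.
    rewrite {1}E; last exact: mc.2.
    rewrite -[RHS]mulN1r -RintegralZl//.
      by apply: eq_Rintegral => t _; rewrite /f !cImM /= normrN mulrN opprK sinN; ring.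
    apply: cintegrable_Im; apply: (le_cintegrable (g := fun t : measurableTypeR R => (expR (- `|t|))%:E)) => //.
    + exact/measurable_EFinP.
    + by move=> t; rewrite normcM normc_cis mulr1 normcR ger0_norm ?expR_ge0.
    + by rewrite integral_expNabs ltry.
  move: iN; set J := Rintegral _ _ _ => iN; change (J = 0); clearbody J; lra.
Qed.
End PoissonKernel.

(** * The Cauchy density and its total mass *)

Section CauchyDensity.
Context {R : realType}.
Local Notation leb := (@lebesgue_measure R).

(** The Fourier transform of exp(-|.|) in the normalisation with 2 pi in the exponent, that is, the
    value of [cintegral_expNabs_cis] at [a = 2 * pi * t]. *)
Definition cauchy_density (t : R) : R := 2 / (1 + (2 * pi * t) ^+ 2).

Let den0 (t : R) : 0 < 1 + (2 * pi * t) ^+ 2.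
Proof. by rewrite ltr_pwDl// sqr_ge0. Qed.

Lemma cauchy_density_ge0 t : 0 <= cauchy_density t.
Proof. by rewrite divr_ge0// ltW. Qed.

Lemma continuous_cauchy_density : continuous cauchy_density.
Proof.
move=> t; apply: cvgM; first exact: cvg_cst.
apply: cvgV; first by rewrite gt_eqF.
apply: cvgD; first exact: cvg_cst.
apply: (@continuous_comp _ _ _ (fun s : R => 2 * pi * s) (fun s : R => s ^+ 2)).
  by apply: cvgM; [exact: cvg_cst|exact: cvg_id].
exact: exprn_continuous.
Qed.

Lemma measurable_cauchy_density :
  measurable_fun (setT : set (measurableTypeR R)) cauchy_density.
Proof. exact: (continuous_measurable_fun continuous_cauchy_density). Qed.

Lemma integral_cauchy_density : (\int[leb]_t (cauchy_density t)%:E = 1)%E.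
Proof.
have pi0 : 0 < pi :> R by exact: pi_gt0.
rewrite ge0_symfun_integralT; last 3 first.
- exact: cauchy_density_ge0.
- exact: continuous_cauchy_density.
- by move=> t; rewrite /cauchy_density /= mulrN sqrrN.
rewrite -set_itvcy.
pose F (t : R) : R := pi^-1 * atan (2 * pi * t).
have dF (t : R) : is_derive t (1 : R) F (cauchy_density t).
  have h1 : is_derive t (1 : R) (fun s : R => 2 * pi * s) (2 * pi).
    have h := is_deriveZ (2 * pi) (is_derive_id t (1 : R)).
    by apply: is_derive_eq h _; rewrite /GRing.scale/= mulr1.
  have h2 : is_derive (2 * pi * t) (1 : R) (@atan R) ((1 + (2 * pi * t) ^+ 2)^-1).
    by split; [exact: derivable_atan|rewrite -derive1E derive1_atan].
  have h3 := is_deriveZ (pi^-1) (is_derive1_comp h2 h1).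
  apply: is_derive_eq h3 _; rewrite /GRing.scale/= /cauchy_density.
  have d0 := lt0r_neq0 (den0 t); have p0 := lt0r_neq0 pi0.
  move: (1 + _) d0 => D d0; move: (pi : R) p0 => p p0; by field; rewrite d0 p0.
rewrite (@ge0_continuous_FTC2y R _ F 0 (1 / 2)).
- rewrite /F mulr0 atan0 mulr0 -EFinB subr0 -EFinM.
  by congr EFin; rewrite mul1r divff.
- by move=> t _; exact: cauchy_density_ge0.
- by apply: continuous_subspaceT => t; exact: continuous_cauchy_density.
- have -> : 1 / 2 = pi^-1 * (pi / 2) :> R.
    by have := lt0r_neq0 pi0; move: (pi : R) => p p0; field.
  apply: cvgM; first exact: cvg_cst.
  apply: (@cvg_comp _ _ _ (fun t : R => 2 * pi * t) (@atan R) _ +oo%R); last exact: cvgy_atan.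
  apply: gt0_cvgMry; first exact: mulr_gt0.
  exact: cvg_id.
- by move=> t _; have h := dF t; exact: ex_derive.
- by apply: cvg_at_right_filter; exact: (is_derive_continuous (dF 0)).
- by move=> t _; have h := dF t; rewrite derive1E derive_val.
Qed.
End CauchyDensity.

(** * The Fourier transform on R^d, translations and differences *)

Section FourierTransform.
Context {R : realType} (d : nat).
Local Notation mu := (@lebesgue_rV R d).
Local Notation T := 'rV[R]_d.

Definition ft (g : T -> R[i]) (xi : T) : R[i] :=
  cintegral mu (fun x => cis (- (2 * pi * dotR x xi)) * g x).

Lemma dotRDl (x y z : T) : dotR (x + y) z = dotR x z + dotR y z.
Proof. by rewrite /dotR -big_split; apply: eq_bigr => i _; rewrite mxE mulrDl. Qed.

Lemma dotRDr (x y z : T) : dotR x (y + z) = dotR x y + dotR x z.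
Proof. by rewrite /dotR -big_split; apply: eq_bigr => i _; rewrite mxE mulrDr. Qed.

Lemma dotRNr (x y : T) : dotR x (- y) = - dotR x y.
Proof. by rewrite /dotR -sumrN; apply: eq_bigr => i _; rewrite mxE mulrN. Qed.

Lemma dotRZl (a : R) (x y : T) : dotR (a *: x) y = a * dotR x y.
Proof. by rewrite /dotR mulr_sumr; apply: eq_bigr => i _; rewrite mxE mulrA. Qed.

Lemma dotRC (x y : T) : dotR x y = dotR y x.
Proof. by apply: eq_bigr => i _; rewrite mulrC. Qed.

Lemma dotR_delta (i : 'I_d) (y : T) : dotR (delta_mx 0 i) y = y 0 i.
Proof.
rewrite /dotR (bigD1 i)//= mxE !eqxx mul1r big1 ?addr0// => j ji.
by rewrite mxE eqxx (negbTE ji) mul0r.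
Qed.

Lemma cmeasurable_character (d' : measure_display) (T' : measurableType d') (c : R) (f g : T' -> T) :
  measurable_fun setT f -> measurable_fun setT g ->
  cmeasurable (fun t => cis (c * dotR (f t) (g t)) : R[i]).
Proof.
move=> mf mg; apply: cmeasurable_cis.
by apply: measurable_funM => //; exact: measurable_dotR.
Qed.

Lemma cmeasurable_phase (xi : T) : cmeasurable (fun x : T => cis (- (2 * pi * dotR x xi)) : R[i]).
Proof.
under eq_fun do rewrite -mulNr.
by apply: cmeasurable_character.
Qed.

Lemma cintegrable_phase (g : T -> R[i]) (xi : T) : cintegrable mu g ->
  cintegrable mu (fun x => cis (- (2 * pi * dotR x xi)) * g x).
Proof.
apply: (@cintegrableMl _ _ _ _ _ _ 1); first exact: cmeasurable_phase.
by move=> x; rewrite normc_cis.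
Qed.

Lemma cmeasurable_ft (g : T -> R[i]) : cmeasurable g -> cmeasurable (ft g).
Proof.
move=> mg; apply: (@cmeasurable_cintegral _ _ _ _ _ mu
  (fun z : T * T => cis (- (2 * pi * dotR z.2 z.1)) * g z.2)).
apply: cmeasurableM; last exact: cmeasurable_comp.
under eq_fun do rewrite -mulNr.
exact: cmeasurable_character.
Qed.

Lemma normc_ft_le (g : T -> R[i]) (xi : T) : cintegrable mu g ->
  ((normc (ft g xi))%:E <= \int[mu]_x (normc (g x))%:E)%E.
Proof.
move=> ig; rewrite (le_trans (le_normc_cintegral (cintegrable_phase xi ig)))//.
by under eq_integral do rewrite normcM normc_cis mul1r.
Qed.

Lemma ft_shift (g : T -> R[i]) (v xi : T) : cintegrable mu g ->
  ft (fun x => g (x + v)) xi = cis (2 * pi * dotR v xi) * ft g xi.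
Proof.
move=> ig; have mg := ig.1.
rewrite /ft -cintegralZ; last exact: cintegrable_phase.
rewrite [RHS](@cintegral_shift R d v); last first.
  by apply: cmeasurableM; [exact: cmeasurable_cst|exact: (cintegrable_phase xi ig).1].
apply: eq_cintegral => x; rewrite mulrA -cisD dotRDl; congr (cis _ * _); ring.
Qed.

Lemma cintegrable_shift (g : T -> R[i]) (v : T) : cintegrable mu g ->
  cintegrable mu (fun x => g (x + v)).
Proof.
move=> [mg goo].
have mv : measurable_fun setT (fun x : T => x + v) by apply: measurable_rV_add.
split; first exact: (cmeasurable_comp mg mv).
move: goo; rewrite (@ge0_integral_shift R d v)//.
- by apply/measurable_EFinP; exact: cmeasurable_normc.
- by move=> x; rewrite lee_fin normc_ge0.
Qed.

Lemma cintegrable_diffs ws (g : T -> R[i]) : cintegrable mu g ->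
  cintegrable mu (diffs ws g).
Proof.
move=> ig; elim: ws => [|w ws ih]; first exact: ig.
exact: (cintegrableB (cintegrable_shift w ih) ih).
Qed.

Lemma ft_diffs (v xi : T) n (g : T -> R[i]) : cintegrable mu g ->
  ft (diffs (nseq n v) g) xi = (cis (2 * pi * dotR v xi) - 1) ^+ n * ft g xi.
Proof.
move=> ig; elim: n => [|n ih]; first by rewrite expr0 mul1r.
have id := cintegrable_diffs (nseq n v) ig.
rewrite exprS -mulrA -ih mulrBl mul1r -ft_shift// -[in RHS]cintegralB; first last.
- exact: cintegrable_phase.
- by apply: cintegrable_phase; exact: cintegrable_shift.
by apply: eq_cintegral => x; rewrite -mulrBr.
Qed.

(* Functions bounded by B and supported in a fixed ball have integral O(B): compare with
   a power of the bracket. *)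
Lemma japanese_ball (rho s : R) : 0 <= s -> exists2 L : R, 0 <= L &
  forall x : T, `|x| <= rho -> 1 <= L * japanese x `^ (- s).
Proof.
move=> s0; pose r := Num.max rho 0.
have r0 : 0 <= r by rewrite le_max lexx orbT.
exists (Num.sqrt (1 + d%:R * r ^+ 2) `^ s); first exact: powR_ge0.
move=> x xr; rewrite powRN ler_pdivlMr ?powR_japanese_gt0// mul1r.
apply: ge0_ler_powR; rewrite ?nnegrE ?sqrtr_ge0 ?japanese_ge0//.
rewrite -[leLHS]ger0_norm ?japanese_ge0// -sqrtr_sqr ler_wsqrtr//.
apply: japanese_le_coord => i; rewrite (le_trans (rV_coord_norm x i))//.
by rewrite le_max xr.
Qed.

Lemma integral_supported (rho : R) : exists2 K : R, 0 <= K &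
  forall (g : T -> R[i]) (B : R), cmeasurable g -> 0 <= B -> (forall x, normc (g x) <= B) ->
  (forall x, rho < `|x| -> g x = 0) ->
  cintegrable mu g /\ (\int[mu]_x (normc (g x))%:E <= (K * B)%:E)%E.
Proof.
pose s : R := d.+1%:R.
have ds : d%:R < s by rewrite ltr_nat.
have := integral_bracket ds; set J := (\int[_]_x _)%E => Joo.
have J0 : (0 <= J)%E by apply: integral_ge0 => x _; rewrite lee_fin powR_ge0.
have [L L0 HL] := @japanese_ball rho s (ler0n _ _).
exists (L * fine J); first by rewrite mulr_ge0// fine_ge0.
move=> g B mg B0 gB g0.
have le1 x : normc (g x) <= B * (L * japanese x `^ (- s)).
  have [xr|xr] := leP `|x| rho; last first.
    by rewrite (g0 x xr) ComplexField.Normc.normc0 !mulr_ge0 ?powR_ge0.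
  by rewrite (le_trans (gB x))// ler_peMr// HL.
have mb : measurable_fun setT (fun x : T => (B * (L * japanese x `^ (- s)))%:E).
  apply/measurable_EFinP; do 2 apply: measurable_funM => //.
  exact: measurable_powR_japanese.
have intE : (\int[mu]_x (B * (L * japanese x `^ (- s)))%:E = (L * fine J * B)%:E)%E.
  under eq_integral do rewrite mulrA EFinM.
  rewrite ge0_integralZl//; last 3 first.
  - by apply/measurable_EFinP; exact: measurable_powR_japanese.
  - by move=> x _; rewrite lee_fin powR_ge0.
  - by rewrite lee_fin mulr_ge0.
  have Jf : J \is a fin_num by rewrite ge0_fin_numE.
  by rewrite -/J -[in LHS](fineK Jf) -EFinM; congr EFin; ring.
split.
  apply: (le_cintegrable mg mb) => [x|]; first by rewrite lee_fin.
  by rewrite intE ltry.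
rewrite -intE; apply: ge0_le_integral => //.
- by move=> x _; rewrite lee_fin normc_ge0.
- by apply/measurable_EFinP; exact: cmeasurable_normc.
- by move=> x _; rewrite lee_fin.
Qed.
End FourierTransform.

(** * Decay of the Fourier transform from bounds on differences *)

Section FourierDecay.
Context {R : realType} (d : nat).
Local Notation mu := (@lebesgue_rV R d).
Local Notation T := 'rV[R]_d.

Lemma diffs_supported (W : zmodType) (g : T -> W) (rho : R) (v : T) n :
  (forall x, rho < `|x| -> g x = 0) -> `|v| <= 1 ->
  forall x, rho + n%:R < `|x| -> diffs (nseq n v) g x = 0.
Proof.
move=> g0 v1; elim: n => [|n ih] x; first by rewrite addr0; exact: g0.
rewrite -natr1 addrA /= => xr; rewrite -/(diffs _ _) !ih ?subrr//.
  by rewrite (le_lt_trans _ xr)// lerDl.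
rewrite -(ltrD2r 1) (lt_le_trans xr)//.
by rewrite -[X in `|X| <= _](addrK v) (le_trans (ler_normB _ _))// lerD2l.
Qed.

Lemma norm_scale_delta (h : R) (j : 'I_d) : `|h| <= 1 -> `|h *: delta_mx 0 j : T| <= 1.
Proof.
move=> h1; apply: rV_norm_le => // i; rewrite !mxE eqxx /=.
by case: eqP => _; rewrite ?mulr1 ?mulr0 ?normr0.
Qed.

Lemma cis_pi : cis pi = -1 :> R[i].
Proof. by rewrite /cis cospi sinpi; apply: complex_eqP; rewrite /= ?oppr0. Qed.

(* With h = 1 / (2 theta_j), translation by h e_j multiplies the Fourier transform at theta
   by -1, so that N-fold differences of step h replace N integrations by parts. *)
Lemma ft_decay N (rho : R) : exists2 K : R, 0 <= K &
  forall (g : T -> R[i]) (B : R), cmeasurable g -> 0 <= B -> (forall x, normc (g x) <= B) ->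
  (forall x, rho < `|x| -> g x = 0) ->
  (forall j (h : R) x, `|h| <= 1 ->
    normc (diffs (nseq N (h *: delta_mx 0 j)) g x) <= `|h| ^+ N * B) ->
  forall theta, normc (ft g theta) * japanese theta ^+ N <= K * B.
Proof.
have [K1 K10 H1] := @integral_supported R d rho.
(* An N-fold difference with steps of norm at most 1 enlarges the support by at most N. *)
have [K2 K20 H2] := @integral_supported R d (rho + N%:R).
(* If all coordinates of theta are at most 1/2, then <theta> <= A. Otherwise the largest one,
   theta_j, satisfies 1 <= 4 theta_j^2, so that <theta>^2 <= 1 + d theta_j^2 gives <theta> <= A
   |theta_j|. *)
pose A : R := Num.sqrt (4 + d%:R).
have A0 : 0 <= A by exact: sqrtr_ge0.
have A2 : A ^+ 2 = 4 + d%:R by rewrite sqr_sqrtr// addr_ge0.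
exists ((K1 + K2) * A ^+ N); first by rewrite mulr_ge0 ?addr_ge0 ?exprn_ge0.
move=> g B mg B0 gB g0 gd theta.
have [ig iK1] := H1 g B mg B0 gB g0.
have jt := japanese_ge0 theta.
(* A coordinate above 1/2 is what makes the step h = 1 / (2 theta_j) well defined and of size at
   most 1. Without one, <theta> is bounded and the trivial estimate by the L^1 norm suffices. *)
have [[j0 hj0]|small] := pselect (exists j, 1 / 2 < `|theta 0 j|); last first.
  have small' i : `|theta 0 i| <= 1 / 2 by rewrite leNgt; apply/negP => h; apply: small; exists i.
  have jA : japanese theta <= A.
    rewrite -(ler_pXn2r (ltn0Sn 1)) ?nnegrE// A2 (le_trans (japanese_le_coord small'))//.
    by have : 0 <= d%:R :> R by []; lra.
  have f1 : normc (ft g theta) <= K1 * B.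
    by rewrite -lee_fin (le_trans (normc_ft_le _ ig)).
  rewrite (le_trans (ler_pM (normc_ge0 _) (exprn_ge0 _ jt) f1 (lerXn2r N jt A0 jA)))//.
  rewrite mulrAC ler_wpM2r// ler_wpM2r ?exprn_ge0// lerDl//.
case: (@Order.TotalTheory.arg_maxP _ _ _ j0 predT (fun i => `|theta 0 i|)) => // j _ jmax.
have jm i : `|theta 0 i| <= `|theta 0 j| := jmax i isT.
have hj : 1 / 2 < `|theta 0 j| := lt_le_trans hj0 (jm j0).
have tj0 : 0 < `|theta 0 j| by lra.
have tjn : theta 0 j != 0 by rewrite -normr_gt0.
pose h := (2 * theta 0 j)^-1.
have hE : `|h| = (2 * `|theta 0 j|)^-1 by rewrite /h normfV normrM ger0_norm.
have h1 : `|h| <= 1 by rewrite hE invf_le1 ?mulr_gt0//; lra.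
pose v : T := h *: delta_mx 0 j.
have [idf iK2] : cintegrable mu (diffs (nseq N v) g) /\
    (\int[mu]_x (normc (diffs (nseq N v) g x))%:E <= (K2 * (`|h| ^+ N * B))%:E)%E.
  apply: H2.
  - exact: (cintegrable_diffs (nseq N v) ig).1.
  - by rewrite mulr_ge0// exprn_ge0.
  - by move=> x; exact: gd.
  - by apply: diffs_supported => //; exact: norm_scale_delta.
have E := ft_diffs v theta N ig.
have vt : 2 * pi * dotR v theta = pi.
  rewrite dotRZl dotR_delta /h; move: (pi : R) => p; field; exact: tjn.
rewrite vt cis_pi in E.
have nE : normc ((-1 - 1 : R[i]) ^+ N) = 2 ^+ N.
  have -> : (-1 - 1 : R[i]) = (-2 : R)%:C by apply: complex_eqP => /=; lra.
  elim: N {H2 gd idf iK2 E} => [|N ih]; first by rewrite !expr0 ComplexField.Normc.normc1.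
  by rewrite !exprS normcM ih normcR normrN ger0_norm.
have f2 : 2 ^+ N * normc (ft g theta) <= K2 * (`|h| ^+ N * B).
  by rewrite -nE -normcM -E -lee_fin (le_trans (normc_ft_le _ idf)).
have jA : japanese theta <= A * `|theta 0 j|.
  rewrite -(ler_pXn2r (ltn0Sn 1)) ?nnegrE ?mulr_ge0// exprMn A2.
  rewrite (le_trans (japanese_le_coord jm))// mulrDl lerD2r.
  have : (1 / 2) ^+ 2 <= `|theta 0 j| ^+ 2 by rewrite ler_pXn2r ?nnegrE// ltW.
  lra.
have jN : japanese theta ^+ N <= A ^+ N * `|theta 0 j| ^+ N.
  by rewrite -exprMn lerXn2r ?nnegrE// mulr_ge0.
have hN : `|h| ^+ N * `|theta 0 j| ^+ N <= 1.
  rewrite -exprMn exprn_ile1 ?mulr_ge0//.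
  rewrite hE invfM -mulrA mulVf ?gt_eqF// mulr1; lra.
have f3 : normc (ft g theta) <= K2 * (`|h| ^+ N * B).
  apply: le_trans f2; rewrite ler_peMl ?normc_ge0// exprn_ege1//.
  by rewrite ler1n.
apply: (le_trans (ler_pM (normc_ge0 _) (exprn_ge0 _ jt) f3 jN)).
have -> : K2 * (`|h| ^+ N * B) * (A ^+ N * `|theta 0 j| ^+ N) =
    K2 * A ^+ N * B * (`|h| ^+ N * `|theta 0 j| ^+ N).
  by move: (`|h| ^+ N) (A ^+ N) (`|theta 0 j| ^+ N) => a b c; ring.
apply: (@le_trans _ _ (K2 * A ^+ N * B)).
  by rewrite ler_piMr// mulr_ge0 ?(mulr_ge0 K20) ?exprn_ge0.
by rewrite mulrDl ler_wpM2r// lerDr mulr_ge0// exprn_ge0.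
Qed.
End FourierDecay.

Section ComplexDifferences.
Context {R : realType} {V : normedModType R}.
Implicit Types ws : seq V.

Lemma Re_diffs ws (g : V -> R[i]) x :
  complex.Re (diffs ws g x) = diffs ws (fun y => complex.Re (g y)) x.
Proof.
by elim: ws x => [//|w ws ih] x /=; rewrite cReD cReN !ih.
Qed.

Lemma Im_diffs ws (g : V -> R[i]) x :
  complex.Im (diffs ws g x) = diffs ws (fun y => complex.Im (g y)) x.
Proof.
by elim: ws x => [//|w ws ih] x /=; rewrite cImD cImN !ih.
Qed.

End ComplexDifferences.

(** * Test functions and the rapid decay of their transforms *)

Section TestFunctions.
Context {R : realType} (d : nat).
Local Notation mu := (@lebesgue_rV R d).
Local Notation T := 'rV[R]_d.

Lemma derive_supported (g : T -> R) (rho : R) (v : T) :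
  (forall x, rho < `|x| -> g x = 0) -> forall x, rho < `|x| -> 'D_v g x = 0.
Proof.
move=> g0 x xr; apply: derive_eps => e e0.
have K0 : 0 < `|v| + 1 by rewrite ltr_wpDl.
exists ((`|x| - rho) / (`|v| + 1)); first by rewrite divr_gt0// subr_gt0.
move=> h _; rewrite ltr_pdivlMr// => hx.
rewrite (g0 x xr) g0 ?mulr0 ?subrr ?normr0 ?mulr_ge0 ?(ltW e0)//.
have h2 : `|x| <= `|h *: v + x| + `|h| * `|v|.
  by rewrite -normrZ -[X in `|X| <= _](addKr (h *: v)) addrC (le_trans (ler_normD _ _))// normrN.
have h0 := normr_ge0 h; move: hx; rewrite mulrDr mulr1; lra.
Qed.

Lemma iterD_supported (g : T -> R) (rho : R) (vs : seq T) :
  (forall x, rho < `|x| -> g x = 0) -> forall x, rho < `|x| -> iterD vs g x = 0.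
Proof.
move=> g0; elim: vs => [|v vs ih]; first exact: g0.
exact: (derive_supported v ih).
Qed.

Lemma continuous_supported_bounded (g : T -> R) (rho : R) : continuous g ->
  (forall x, rho < `|x| -> g x = 0) -> exists2 B : R, 0 <= B & forall x, `|g x| <= B.
Proof.
move=> cg g0.
have cK : compact [set x : T | `|x| <= rho].
  apply: bounded_closed_compact.
    exists rho; split; first by rewrite num_real.
    by move=> M rM x /= xr; rewrite (le_trans xr)// ltW.
  have -> : [set x : T | `|x| <= rho] = (fun x : T => `|x|) @^-1` [set r | r <= rho] by [].
  apply: preimage_closed; last exact: closed_le.
  by move=> x _; exact: norm_continuous.
have cgK : compact (g @` [set x : T | `|x| <= rho]).
  by apply: continuous_compact => //; apply: continuous_subspaceT.
have [M [_ HM]] := compact_bounded cgK.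
pose B := Num.max (M + 1) 0.
exists B; first by rewrite le_max lexx orbT.
move=> x; have [xr|xr] := leP `|x| rho; last by rewrite g0// normr0 le_max lexx orbT.
have h : `|g x| <= M + 1 by apply: (HM (M + 1)); [rewrite ltrDl|exists x].
by rewrite le_max h.
Qed.

Lemma compact_supported (W : nmodType) (g : T -> W) : compact_support g ->
  exists rho : R, forall x, rho < `|x| -> g x = 0.
Proof.
move=> [K [cK gK]]; have [M [_ HM]] := compact_bounded cK.
exists (M + 1) => x xM; apply: gK => Kx.
have := HM (M + 1); rewrite ltrDl ltr01 => /(_ isT) /(_ x Kx) /=.
by rewrite leNgt xM.
Qed.

(** An N-fold difference of step [h *: e_j] is controlled by [h ^+ N] times the N-th derivative
    along [e_j], which is bounded as a continuous function of bounded support. This is the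
    hypothesis of [ft_decay]. *)
Lemma supported_diffs_bound (g : T -> R) (rho : R) N : smooth g ->
  (forall x, rho < `|x| -> g x = 0) -> exists2 B : R, 0 <= B &
  forall j (h : R) x, `|h| <= 1 ->
    `|diffs (nseq N (h *: delta_mx 0 j)) g x| <= `|h| ^+ N * B.
Proof.
move=> sg g0.
have /choice[B HB] : forall j : 'I_d, exists B : R, 0 <= B /\
    forall x, `|iterD (nseq N (delta_mx 0 j)) g x| <= B.
  move=> j; have [B B0 HB] := continuous_supported_bounded
    (sg (nseq N (delta_mx 0 j))).1 (iterD_supported (nseq N (delta_mx 0 j)) g0).
  by exists B.
exists (\sum_j B j); first by apply: sumr_ge0 => j _; exact: (HB j).1.
move=> j h x h1; apply: (@le_trans _ _ (`|h| ^+ N * B j)); last first.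
  rewrite ler_wpM2l ?exprn_ge0// (bigD1 j)//= lerDl.
  by apply: sumr_ge0 => i _; exact: (HB i).1.
apply: diffs_bound; first exact: sg.
move=> y _.
have := @iterD_lincomb_bound R T (nseq N [:: (h, delta_mx 0 j : T)]) g y (B j) sg (HB j).1.
rewrite map_nseq /lincomb big_seq1 /= => H.
apply: le_trans (H _) _; last first.
  by rewrite big_nseq /= iter_mulr_1 big_seq1.
move=> vs Hvs; suff -> : vs = nseq N (delta_mx 0 j) by exact: (HB j).2.
elim: N vs Hvs {H HB} => [|N ih] [|v vs]//= /andP[]; rewrite inE => /eqP -> /ih ->.
by [].
Qed.

Record test_cfun (g : T -> R[i]) : Prop := TestCfun {
  test_csmooth : csmooth g ;
  test_compact : compact_support g }.

Lemma csmooth_cmeasurable (g : T -> R[i]) : csmooth g -> cmeasurable g.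
Proof.
by move=> [sR sI]; split; apply: measurable_continuous_rV;
  [exact: (smooth_continuous sR)|exact: (smooth_continuous sI)].
Qed.

Lemma test_bounds (g : T -> R[i]) N : test_cfun g -> exists rho B : R,
  [/\ 0 <= B, forall x, normc (g x) <= B, forall x, rho < `|x| -> g x = 0 &
   forall j (h : R) x, `|h| <= 1 ->
    normc (diffs (nseq N (h *: delta_mx 0 j)) g x) <= `|h| ^+ N * B].
Proof.
move=> [[sR sI] cg]; have [rho g0] := compact_supported cg.
have gR0 x : rho < `|x| -> complex.Re (g x) = 0 by move=> /g0 ->.
have gI0 x : rho < `|x| -> complex.Im (g x) = 0 by move=> /g0 ->.
have [B1 B10 H1] := continuous_supported_bounded (smooth_continuous sR) gR0.
have [B2 B20 H2] := continuous_supported_bounded (smooth_continuous sI) gI0.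
have [B3 B30 H3] := supported_diffs_bound N sR gR0.
have [B4 B40 H4] := supported_diffs_bound N sI gI0.
exists rho, (B1 + B2 + B3 + B4); split => //.
- by rewrite !addr_ge0.
- move=> x; rewrite (le_trans (normc_le_ReIm _))//.
  by have := H1 x; have := H2 x; lra.
- move=> j h x h1; rewrite (le_trans (normc_le_ReIm _))// Re_diffs Im_diffs.
  apply: le_trans (lerD (H3 j h x h1) (H4 j h x h1)) _.
  by rewrite -mulrDr ler_wpM2l ?exprn_ge0//; lra.
Qed.

Lemma test_cintegrable (g : T -> R[i]) : test_cfun g -> cintegrable mu g.
Proof.
move=> tg; have [rho [B [B0 gB g0 _]]] := test_bounds 0 tg.
have [K K0 H] := @integral_supported R d rho.
exact: (H g B (csmooth_cmeasurable (test_csmooth tg)) B0 gB g0).1.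
Qed.

Lemma test_ft_decay (g : T -> R[i]) N : test_cfun g -> exists2 C : R, 0 <= C &
  forall theta, normc (ft g theta) * japanese theta ^+ N <= C.
Proof.
move=> tg; have [rho [B [B0 gB g0 gd]]] := test_bounds N tg.
have [K K0 H] := @ft_decay R d N rho.
exists (K * B); first exact: mulr_ge0.
exact: (H g B (csmooth_cmeasurable (test_csmooth tg)) B0 gB g0 gd).
Qed.

Lemma test_ft_moment (g : T -> R[i]) (s : R) : test_cfun g ->
  (\int[mu]_xi (normc (ft g xi) * japanese xi `^ s)%:E < +oo)%E.
Proof.
(* Decay of order s + d + 1 leaves <xi>^(-(d+1)), which is integrable. *)
move=> tg; pose N := (Num.trunc (`|s| + d.+1%:R)).+1.
have sN : s + d.+1%:R <= N%:R.
  by rewrite (le_trans _ (ltW (truncnS_gt _)))// lerD2r ler_norm.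
have [C C0 HC] := test_ft_decay N tg.
pose s1 : R := - d.+1%:R.
have mg := csmooth_cmeasurable (test_csmooth tg).
have mb : measurable_fun setT (fun x : T => (japanese x `^ s1)%:E).
  by apply/measurable_EFinP; exact: measurable_powR_japanese.
suff h : (\int[mu]_xi (normc (ft g xi) * japanese xi `^ s)%:E <=
    \int[mu]_x (C%:E * (japanese x `^ s1)%:E))%E.
  apply: (le_lt_trans h); rewrite ge0_integralZl//; last first.
    by move=> x _; rewrite lee_fin powR_ge0.
  by rewrite lte_mul_pinfty ?lee_fin//; apply: integral_bracket; rewrite ltr_nat.
apply: ge0_le_integral => //.
- by move=> x _; rewrite lee_fin mulr_ge0 ?normc_ge0 ?powR_ge0.
- apply/measurable_EFinP; apply: measurable_funM; last exact: measurable_powR_japanese.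
  exact: (cmeasurable_normc (cmeasurable_ft mg)).
- exact: measurable_funeM.
move=> x _; rewrite -EFinM lee_fin /s1 powRN ler_pdivlMr ?powR_japanese_gt0//.
apply: le_trans (HC x); rewrite -mulrA ler_wpM2l ?normc_ge0//.
rewrite -powRD; last by rewrite (gt_eqF (japanese_gt0 x)) implybT.
by rewrite -powR_mulrn ?japanese_ge0// ler_powR// japanese_ge1.
Qed.
End TestFunctions.

(** * Fourier inversion and the transform of a product *)

Section FourierInversion.
Context {R : realType} (d : nat).
Local Notation mu := (@lebesgue_rV R d).
Local Notation leb := (@lebesgue_measure R).
Local Notation T := 'rV[R]_d.

(** A convergence factor for the inversion integral. Being a product over the coordinates, it has as
    transform the product [poisson] of Cauchy densities, which is explicit, nonnegative and of mass
    1. *)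
Definition damping (xi : T) : R := \prod_i expR (- `|xi 0 i|).
Definition poisson (z : T) : R := \prod_i cauchy_density (z 0 i).

Lemma damping_ge0 xi : 0 <= damping xi.
Proof. by apply: prodr_ge0 => i _; exact: expR_ge0. Qed.

Lemma damping_le1 xi : damping xi <= 1.
Proof.
rewrite -[leRHS](expr1n R d) -[X in _ ^+ X]card_ord -prodr_const.
by apply: ler_prod => i _; rewrite expR_ge0 expR_le1 oppr_le0/=.
Qed.

Lemma measurable_damping : measurable_fun setT damping.
Proof. exact: (@measurable_prod_coord R d (fun t => expR (- `|t|)) measurable_expNabs). Qed.

Lemma integral_damping : (\int[mu]_xi (damping xi)%:E < +oo)%E.
Proof.
rewrite (@ge0_integral_prod_coord R d _ measurable_expNabs (fun t => expR_ge0 _)).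
by rewrite integral_expNabs expe_lty// ?ltry// lee_fin.
Qed.

Lemma poisson_ge0 z : 0 <= poisson z.
Proof. by apply: prodr_ge0 => i _; exact: cauchy_density_ge0. Qed.

Lemma measurable_poisson : measurable_fun setT poisson.
Proof. exact: (@measurable_prod_coord R d _ measurable_cauchy_density). Qed.

Lemma integral_poisson : (\int[mu]_z (poisson z)%:E = 1)%E.
Proof.
rewrite (@ge0_integral_prod_coord R d _ measurable_cauchy_density cauchy_density_ge0).
rewrite integral_cauchy_density; elim: d => [|n ih]; first by rewrite expe0.
by rewrite expeS ih mul1e.
Qed.

Lemma cintegral_damping (z : T) :
  cintegral mu (fun xi => (damping xi)%:C * cis (- (2 * pi * dotR z xi))) = (poisson z)%:C.
Proof.
pose G (i : 'I_d) (t : R) : R[i] := (expR (- `|t|))%:C * cis (- (2 * pi * z 0 i * t)).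
have GE xi : (damping xi)%:C * cis (- (2 * pi * dotR z xi)) = \prod_i G i (xi 0 i).
  rewrite big_split /= /damping rmorph_prod; congr (_ * _).
  rewrite /dotR mulr_sumr -sumrN.
  elim/big_rec2 : _ => [|i y1 y2 _ <-]; first exact: cis0.
  by rewrite cisD mulrA.
rewrite (eq_cintegral _ GE) (@cintegral_prod_coord R d G (fun t => expR (- `|t|))).
- rewrite /poisson rmorph_prod; apply: eq_bigr => i _.
  exact: cintegral_expNabs_cis.
- move=> i; apply: cmeasurableM.
    by apply: cmeasurable_real; exact: measurable_expNabs.
  by apply: cmeasurable_cis; apply: measurable_realfun.measurable_funN; exact: measurable_funM.
- exact: measurable_expNabs.
- by move=> i t; rewrite normcM normc_cis mulr1 normcR ger0_norm ?expR_ge0.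
- by rewrite integral_expNabs ltry.
- by move=> t; exact: expR_ge0.
Qed.

Lemma damping_cvg (xi : T) : damping (k.+1%:R^-1 *: xi) @[k --> \oo] --> (1 : R).
Proof.
have h i : expR (- `|k.+1%:R^-1 * xi 0 i|) @[k --> \oo] --> (1 : R).
  have E1 : expR (- `|0 * xi 0 i|) = 1 :> R by rewrite mul0r normr0 oppr0 expR0.
  rewrite -[X in _ --> X]E1.
  have h0 : k.+1%:R^-1 * xi 0 i @[k --> \oo] --> 0 * xi 0 i.
    by apply: cvgM; [exact: cvg_harmonic|exact: cvg_cst].
  exact: (@continuous_cvg _ _ _ _ _ (fun k : nat => k.+1%:R^-1 * xi 0 i)
    (fun t : R => expR (- `|t|)) _ (@continuous_expNabs R _) h0).
have hs (s : seq 'I_d) :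
    \prod_(i <- s) expR (- `|k.+1%:R^-1 * xi 0 i|) @[k --> \oo] --> (1 : R).
  elim: s => [|i s ih]; first by under eq_fun do rewrite big_nil; exact: cvg_cst.
  have hM := cvgM (h i) ih; rewrite mulr1 in hM.
  by under eq_fun do rewrite big_cons; exact: hM.
rewrite /damping; under eq_fun do under eq_bigr do rewrite mxE.
exact: hs.
Qed.

Lemma ge0_integral_affine_lty (f : T -> \bar R) (a : R) (v : T) : a != 0 ->
  measurable_fun setT f -> (forall x, 0 <= f x)%E -> (\int[mu]_x f x < +oo)%E ->
  (\int[mu]_x f (a *: x + v)%R < +oo)%E.
Proof.
move=> a0 mf f0; rewrite (@ge0_integral_affine R d a v)// => foo.
rewrite ltey; apply/eqP => E; move: foo; rewrite E gt0_muley//.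
by rewrite lte_fin exprn_gt0// normr_gt0.
Qed.

Lemma cintegrable_affine (F : T -> R[i]) (a : R) (v : T) : a != 0 ->
  cintegrable mu F -> cintegrable mu (fun x => F (a *: x + v)).
Proof.
move=> a0 [mF Foo]; split.
  by apply: (cmeasurable_comp mF); exact: measurable_rV_affine.
apply: (@ge0_integral_affine_lty (fun x => (normc (F x))%:E)) => //.
- by apply/measurable_EFinP; exact: cmeasurable_normc.
- by move=> x; rewrite lee_fin normc_ge0.
Qed.

(** With the damping the double integral over [xi] and [y] converges absolutely. Exchanging the
    order leaves [g] integrated against the transform of the damping, an approximate identity at [x]
    whose width is [e]. *)
Lemma damped_inversion (g : T -> R[i]) (x : T) (e : R) : 0 < e -> cintegrable mu g ->
  cintegral mu (fun xi => cis (2 * pi * dotR x xi) * (damping (e *: xi))%:C * ft g xi) =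
  cintegral mu (fun z => g (e *: z + x) * (poisson z)%:C).
Proof.
move=> e0 ig; have mg := ig.1; have en0 := lt0r_neq0 e0.
have mde : measurable_fun setT (fun xi : T => damping (e *: xi)).
  by apply: (measurableT_comp measurable_damping); exact: measurable_rV_scale.
have doo : (\int[mu]_xi (damping (e *: xi))%:E < +oo)%E.
  have h : (\int[mu]_x (damping (e *: x + 0)%R)%:E < +oo)%E.
    apply: (@ge0_integral_affine_lty (fun x => (damping x)%:E) e 0 en0).
    - by apply/measurable_EFinP; exact: measurable_damping.
    - by move=> y; rewrite lee_fin damping_ge0.
    - exact: integral_damping.
  by under eq_integral do rewrite -(addr0 (e *: _)).
have mph (v : T) : cmeasurable (fun xi : T => cis (- (2 * pi * dotR v xi)) : R[i]).
  by under eq_fun do rewrite -mulNr; apply: cmeasurable_character.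
have idp (v : T) : cintegrable mu (fun xi => (damping (e *: xi))%:C * cis (- (2 * pi * dotR v xi))).
  apply: (le_cintegrable (g := fun xi : T => (damping (e *: xi))%:E)) => //.
  - by apply: cmeasurableM => //; exact: cmeasurable_real.
  - exact/measurable_EFinP.
  - by move=> xi; rewrite normcM normc_cis mulr1 normcR ger0_norm// damping_ge0.
pose F (z : T * T) : R[i] := cis (2 * pi * dotR x z.1) * (damping (e *: z.1))%:C *
  (cis (- (2 * pi * dotR z.2 z.1)) * g z.2).
have mF : cmeasurable F.
  apply: cmeasurableM; apply: cmeasurableM.
  - by apply: cmeasurable_character.
  - by apply: cmeasurable_real; exact: (measurableT_comp mde).
  - by under eq_fun do rewrite -mulNr; exact: cmeasurable_character.
  - exact: (cmeasurable_comp mg).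
transitivity (cintegral mu (fun xi => cintegral mu (fun y => F (xi, y)))).
  apply: eq_cintegral => xi; rewrite /F /=.
  by rewrite (cintegralZ _ (cintegrable_phase xi ig)).
have FE xi y : F (xi, y) = g y * ((damping (e *: xi))%:C * cis (- (2 * pi * dotR (y - x) xi))).
  have -> : - (2 * pi * dotR (y - x) xi) = 2 * pi * dotR x xi + - (2 * pi * dotR y xi).
    by rewrite dotRC dotRDr dotRNr !(dotRC xi); move: (pi : R) => p; ring.
  rewrite /F /= cisD; move: (cis _) (cis _) (_%:C) => a b c; ring.
rewrite (@cintegral_fubini _ _ _ _ _ mu mu F (fun xi => damping (e *: xi)) (fun y => normc (g y))) //;
  first last.
- move=> xi y; rewrite FE !normcM normc_cis mulr1 normcR ger0_norm 1?mulrC//.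
  exact: damping_ge0.
- exact: ig.2.
- by move=> y; rewrite normc_ge0.
- by move=> y; rewrite damping_ge0.
- exact: cmeasurable_normc.
(* By scaling, [H (e *: z)] is [poisson z / e ^+ d]; the substitution [y = e *: z + x] at the end
   cancels the power of [e]. *)
pose H (v : T) := cintegral mu (fun xi => (damping (e *: xi))%:C * cis (- (2 * pi * dotR v xi))).
have HE z : (e ^+ d)%:C * H (e *: z) = (poisson z)%:C.
  rewrite -cintegral_damping (@cintegral_affine R d e 0)//; last first.
    apply: (le_cintegrable (g := fun xi : T => (damping xi)%:E)) => //.
    - apply: cmeasurableM => //; apply: cmeasurable_real; exact: measurable_damping.
    - by apply/measurable_EFinP; exact: measurable_damping.
    - by move=> xi; rewrite normcM normc_cis mulr1 normcR ger0_norm// damping_ge0.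
    - exact: integral_damping.
  rewrite gtr0_norm//; congr (_ * _); apply: eq_cintegral => xi.
  by rewrite addr0 dotRZl [in RHS]dotRC dotRZl dotRC.
have mH : cmeasurable H.
  apply: (@cmeasurable_cintegral _ _ _ _ _ mu
    (fun z : T * T => (damping (e *: z.2))%:C * cis (- (2 * pi * dotR z.1 z.2)))).
  apply: cmeasurableM.
    by apply: cmeasurable_real; exact: (measurableT_comp mde).
  by under eq_fun do rewrite -mulNr; exact: cmeasurable_character.
have HM v : normc (H v) <= fine (\int[mu]_xi (damping (e *: xi))%:E).
  rewrite -lee_fin fineK; last first.
    by rewrite ge0_fin_numE// integral_ge0// => y _; rewrite lee_fin damping_ge0.
  rewrite (le_trans (le_normc_cintegral (idp v)))//.
  by under eq_integral do rewrite normcM normc_cis mulr1 normcR (ger0_norm (damping_ge0 _)).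
have iHg : cintegrable mu (fun y : T => H (y - x) * g y).
  have mHx : cmeasurable (fun y : T => H (y - x)).
    by apply: (cmeasurable_comp mH); exact: measurable_rV_sub.
  exact: (cintegrableMl mHx (fun y : T => HM (y - x)) ig).
transitivity (cintegral mu (fun y : T => H (y - x) * g y)).
  apply: eq_cintegral => y; under eq_cintegral do rewrite FE.
  by rewrite (cintegralZ _ (idp (y - x))) mulrC.
rewrite (cintegral_affine x en0 iHg) -(cintegralZ _ (cintegrable_affine x en0 iHg)).
apply: eq_cintegral => z; rewrite addrK mulrA gtr0_norm// HE mulrC.
by [].
Qed.

Lemma test_ft_cintegrable (g : T -> R[i]) : test_cfun g -> cintegrable mu (ft g).
Proof.
move=> tg; split; first exact: (cmeasurable_ft (csmooth_cmeasurable (test_csmooth tg))).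
apply: le_lt_trans (test_ft_moment 0 tg); rewrite le_eqVlt; apply/orP; left; apply/eqP.
by apply: eq_integral => xi _; rewrite powRr0 mulr1.
Qed.

(** Both sides of [damped_inversion] converge as e = 1/(k+1) tends to 0, by dominated convergence:
    the frequency side under [normc (ft g xi)], the space side under a bound of [g] times [poisson],
    whose total mass 1 yields [g x]. *)
Lemma ft_inversion (g : T -> R[i]) (x : T) : test_cfun g ->
  g x = cintegral mu (fun xi => cis (2 * pi * dotR x xi) * ft g xi).
Proof.
move=> tg; have ig := test_cintegrable tg; have mg := ig.1.
have [ift_m ift_oo] := test_ft_cintegrable tg.
have e0 k : 0 < k.+1%:R^-1 :> R by rewrite invr_gt0.
have mph : cmeasurable (fun xi : T => cis (2 * pi * dotR x xi) : R[i]).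
  by apply: cmeasurable_character.
pose A k xi := cis (2 * pi * dotR x xi) * (damping (k.+1%:R^-1 *: xi))%:C * ft g xi.
pose B k z := g (k.+1%:R^-1 *: z + x) * (poisson z)%:C.
have AB k : cintegral mu (A k) = cintegral mu (B k) by exact: damped_inversion.
have mA k : cmeasurable (A k).
  apply: cmeasurableM => //; apply: cmeasurableM => //; apply: cmeasurable_real.
  by apply: (measurableT_comp measurable_damping); exact: measurable_rV_scale.
have mB k : cmeasurable (B k).
  apply: cmeasurableM; last by apply: cmeasurable_real; exact: measurable_poisson.
  by apply: (cmeasurable_comp mg); exact: measurable_rV_affine.
have AE k xi : A k xi = (damping (k.+1%:R^-1 *: xi))%:C * (cis (2 * pi * dotR x xi) * ft g xi).
  by rewrite /A mulrAC mulrC.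
have [rho [M [M0 gM _ _]]] := test_bounds 0 tg.
have [sR sI] := test_csmooth tg.
have cpt z : k.+1%:R^-1 *: z + x @[k --> \oo] --> x.
  have h : k.+1%:R^-1 *: z + x @[k --> \oo] --> 0 *: z + x.
    by apply: cvgD; [apply: cvgZr_tmp; exact: cvg_harmonic|exact: cvg_cst].
  by rewrite scale0r add0r in h.
have [AR AI] : complex.Re (cintegral mu (A k)) @[k --> \oo] --> complex.Re (cintegral mu
      (fun xi => cis (2 * pi * dotR x xi) * ft g xi)) /\
    complex.Im (cintegral mu (A k)) @[k --> \oo] --> complex.Im (cintegral mu
      (fun xi => cis (2 * pi * dotR x xi) * ft g xi)).
  apply: (@cintegral_dominated R _ _ mu A _ (fun xi => normc (ft g xi))) => //.
  - exact: cmeasurableM.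
  - move=> xi; set w := _ * ft g xi.
    have E k : complex.Re (A k xi) = damping (k.+1%:R^-1 *: xi) * complex.Re w.
      by rewrite AE cReM /= mul0r subr0.
    have hM : damping (k.+1%:R^-1 *: xi) * complex.Re w @[k --> \oo] --> 1 * complex.Re w.
      by apply: cvgM; [exact: damping_cvg|exact: cvg_cst].
    by rewrite mul1r in hM; under eq_fun do rewrite E; exact: hM.
  - move=> xi; set w := _ * ft g xi.
    have E k : complex.Im (A k xi) = damping (k.+1%:R^-1 *: xi) * complex.Im w.
      by rewrite AE cImM /= mul0r addr0.
    have hM : damping (k.+1%:R^-1 *: xi) * complex.Im w @[k --> \oo] --> 1 * complex.Im w.
      by apply: cvgM; [exact: damping_cvg|exact: cvg_cst].
    by rewrite mul1r in hM; under eq_fun do rewrite E; exact: hM.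
  - exact: cmeasurable_normc.
  - move=> k xi; rewrite AE !normcM normc_cis mul1r normcR ger0_norm ?damping_ge0//.
    by rewrite ler_piMl ?normc_ge0// damping_le1.
have iP : cintegrable mu (fun z => (poisson z)%:C).
  apply: (le_cintegrable (g := fun z : T => (poisson z)%:E)) => //.
  - by apply: cmeasurable_real; exact: measurable_poisson.
  - by apply/measurable_EFinP; exact: measurable_poisson.
  - by move=> z; rewrite normcR ger0_norm ?poisson_ge0.
  - by rewrite integral_poisson ltry.
have P1 : cintegral mu (fun z => (poisson z)%:C) = 1.
  apply: complex_eqP; first by rewrite /= /Rintegral integral_poisson.
  by rewrite /= /Rintegral integral0.
have [BR BI] : complex.Re (cintegral mu (B k)) @[k --> \oo] --> complex.Re (cintegral mu
      (fun z => g x * (poisson z)%:C)) /\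
    complex.Im (cintegral mu (B k)) @[k --> \oo] --> complex.Im (cintegral mu
      (fun z => g x * (poisson z)%:C)).
  apply: (@cintegral_dominated R _ _ mu B _ (fun z => M * poisson z)) => //.
  - by apply: cmeasurableM; [exact: cmeasurable_cst|exact: iP.1].
  - move=> z; have E (w : R[i]) : complex.Re (w * (poisson z)%:C) = complex.Re w * poisson z.
      by rewrite cReM /= mulr0 subr0.
    rewrite E /B; under eq_fun do rewrite E.
    apply: cvgM; last exact: cvg_cst.
    exact: (@continuous_cvg _ _ _ _ _ (fun k => k.+1%:R^-1 *: z + x)
      (fun y => complex.Re (g y)) _ (@smooth_continuous _ _ _ sR _) (cpt z)).
  - move=> z; have E (w : R[i]) : complex.Im (w * (poisson z)%:C) = complex.Im w * poisson z.
      by rewrite cImM /= mulr0 add0r.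
    rewrite E /B; under eq_fun do rewrite E.
    apply: cvgM; last exact: cvg_cst.
    exact: (@continuous_cvg _ _ _ _ _ (fun k => k.+1%:R^-1 *: z + x)
      (fun y => complex.Im (g y)) _ (@smooth_continuous _ _ _ sI _) (cpt z)).
  - by apply: measurable_funM => //; exact: measurable_poisson.
  - under eq_integral do rewrite EFinM.
    have mP : measurable_fun setT (fun z => (poisson z)%:E).
      by apply/measurable_EFinP; exact: measurable_poisson.
    have P0 z : (0 <= (poisson z)%:E)%E by rewrite lee_fin poisson_ge0.
    by rewrite ge0_integralZl ?lee_fin// integral_poisson mule1 ltry.
  - move=> k z; rewrite normcM normcR (ger0_norm (poisson_ge0 z)) ler_wpM2r//.
    exact: poisson_ge0.
have ABf : (fun k => cintegral mu (A k)) = (fun k => cintegral mu (B k)).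
  by apply/funext.
rewrite (cintegralZ _ iP) P1 mulr1 in BR BI.
apply: complex_eqP.
  apply: (cvg_unique (@Rhausdorff R) BR).
  rewrite [X in X @ _](_ : _ = (fun k => complex.Re (cintegral mu (A k)))); first exact: AR.
  by apply/funext => k; rewrite AB.
apply: (cvg_unique (@Rhausdorff R) BI).
rewrite [X in X @ _](_ : _ = (fun k => complex.Im (cintegral mu (A k)))); first exact: AI.
by apply/funext => k; rewrite AB.
Qed.

(** Only [f] is inverted, so [v] may be merely integrable. This matters because [v] will be the
    output of an operator, for which nothing more is established. *)
Lemma ft_mul (f v : T -> R[i]) (eta : T) : test_cfun f -> cintegrable mu v ->
  ft (fun x => f x * v x) eta = cintegral mu (fun xi => ft f xi * ft v (eta - xi)).
Proof.
move=> tf iv; have mv := iv.1.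
have mf := cmeasurable_ft (csmooth_cmeasurable (test_csmooth tf)).
pose F (z : T * T) : R[i] := cis (- (2 * pi * dotR z.1 (eta - z.2))) * v z.1 * ft f z.2.
have mF : cmeasurable F.
  apply: cmeasurableM; last exact: (cmeasurable_comp mf).
  apply: cmeasurableM; last exact: (cmeasurable_comp mv).
  under eq_fun do rewrite -mulNr; apply: cmeasurable_character => //.
  by apply: measurable_rV_sub => //; exact: measurable_cst.
have mphi x : cmeasurable (fun xi : T => cis (2 * pi * dotR x xi) : R[i]).
  by apply: cmeasurable_character.
transitivity (cintegral mu (fun x => cintegral mu (fun xi => F (x, xi)))).
  apply: eq_cintegral => x; rewrite {1}(ft_inversion x tf) mulrCA mulrC.
  rewrite -cintegralZ; last first.
    apply: (cintegrableMl (mphi x) _ (test_ft_cintegrable tf)) => xi.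
    by rewrite normc_cis.
  apply: eq_cintegral => xi; rewrite /F /=.
  have -> : - (2 * pi * dotR x (eta - xi)) = - (2 * pi * dotR x eta) + 2 * pi * dotR x xi.
    by rewrite dotRDr dotRNr; move: (pi : R) => p; ring.
  rewrite cisD; move: (cis _) (cis _) => a b; ring.
rewrite (@cintegral_fubini _ _ _ _ _ mu mu F (fun x => normc (v x)) (fun xi => normc (ft f xi)))//;
  first last.
- by move=> x xi; rewrite /F !normcM normc_cis mul1r.
- exact: (test_ft_cintegrable tf).2.
- exact: iv.2.
- by move=> y; exact: normc_ge0.
- by move=> y; exact: normc_ge0.
- exact: cmeasurable_normc.
- exact: cmeasurable_normc.
apply: eq_cintegral => xi; rewrite /F /ft -cintegralZ; last exact: cintegrable_phase.
by apply: eq_cintegral => x /=; rewrite mulrC.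
Qed.
End FourierInversion.

(** * Cauchy-Schwarz and Young's inequality for extended-real integrands *)

Section Young.
Context {R : realType} (d : nat).
Local Notation mu := (@lebesgue_rV R d).
Local Notation T := 'rV[R]_d.
Local Open Scope ereal_scope.
Implicit Types g h : T -> \bar R.

Lemma mule_sqr_amgm (x y : \bar R) : 0 <= x -> 0 <= y ->
  x * y + x * y <= x ^+ 2 + y ^+ 2.
Proof.
case: x => [x| |]//; case: y => [y| |]// x0 y0.
- by rewrite !expe2 -!EFinM -!EFinD lee_fin; have := sqr_ge0 (x - y); nra.
- by rewrite !expe2 mulyy addey ?leey// -EFinM.
- by rewrite !expe2 mulyy addye ?leey// -EFinM.
Qed.

(* (\int a b)^2 = \int \int a(x) a(y) b(x) b(y), and b(x) b(y) is at most the mean of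
   b(x)^2 and b(y)^2. *)
Lemma integral_cauchy_schwarz (a b : T -> \bar R) :
  measurable_fun setT a -> measurable_fun setT b ->
  (forall x, 0 <= a x) -> (forall x, 0 <= b x) ->
  (\int[mu]_x (a x * b x)) ^+ 2 <= (\int[mu]_x a x) * \int[mu]_x (a x * b x ^+ 2).
Proof.
move=> ma mb a0 b0.
have mab : measurable_fun setT (fun x => a x * b x) by exact: emeasurable_funM.
have mb2 : measurable_fun setT (fun x => b x ^+ 2).
  by under eq_fun do rewrite expe2; exact: emeasurable_funM.
have mab2 : measurable_fun setT (fun x => a x * b x ^+ 2) by exact: emeasurable_funM.
have ab0 x : 0 <= a x * b x by exact: mule_ge0.
have b20 x : 0 <= b x ^+ 2 by exact: expe_ge0.
have ab20 x : 0 <= a x * b x ^+ 2 by exact: mule_ge0.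
have iab0 : 0 <= \int[mu]_x (a x * b x) by exact: integral_ge0.
have ia0 : 0 <= \int[mu]_x a x by exact: integral_ge0.
have iab20 : 0 <= \int[mu]_x (a x * b x ^+ 2) by exact: integral_ge0.
set L := _ ^+ 2; set Q := _ * _.
(* [Q] is written as a double integral in two ways, exchanging the roles of [x] and [y]. Doubling
   turns the mean into their sum, so nothing possibly infinite is halved. *)
suff : L + L <= Q + Q.
  by apply: contraTT; rewrite -!ltNge => QL; exact: lteD.
have LE : L = \int[mu]_x \int[mu]_y ((a x * b x) * (a y * b y)).
  rewrite /L expe2 -ge0_integralZr//.
  by apply: eq_integral => x _; rewrite ge0_integralZl.
have QE1 : Q = \int[mu]_x \int[mu]_y (a x * (a y * b y ^+ 2)).
  rewrite /Q -ge0_integralZr//.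
  by apply: eq_integral => x _; rewrite ge0_integralZl.
have QE2 : Q = \int[mu]_x \int[mu]_y ((a x * b x ^+ 2) * a y).
  rewrite /Q muleC -ge0_integralZr//.
  by apply: eq_integral => x _; rewrite ge0_integralZl.
have m2 (u v : T -> \bar R) : measurable_fun setT u -> measurable_fun setT v ->
    measurable_fun setT (fun z : T * T => u z.1 * v z.2).
  by move=> mu' mv'; apply: emeasurable_funM; exact: measurableT_comp.
have mi (u v : T -> \bar R) : measurable_fun setT u -> measurable_fun setT v ->
    (forall x, 0 <= u x) -> (forall x, 0 <= v x) ->
    measurable_fun setT (fun x => \int[mu]_y (u x * v y)).
  move=> mu' mv' u0 v0.
  by apply: (measurable_fun_fubini_tonelli_F (m2 := mu) _ (m2 u v mu' mv')) => z; exact: mule_ge0.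
rewrite LE [leRHS](_ : _ = \int[mu]_x \int[mu]_y (a x * (a y * b y ^+ 2)) +
  \int[mu]_x \int[mu]_y ((a x * b x ^+ 2) * a y)); last by rewrite -QE1 -QE2.
rewrite -ge0_integralD//; last 4 first.
- by move=> x _; apply: integral_ge0 => y _; exact: mule_ge0.
- exact: mi.
- by move=> x _; apply: integral_ge0 => y _; exact: mule_ge0.
- exact: mi.
rewrite -ge0_integralD//; last 4 first.
- by move=> x _; apply: integral_ge0 => y _; exact: mule_ge0.
- exact: mi.
- by move=> x _; apply: integral_ge0 => y _; exact: mule_ge0.
- exact: mi.
apply: ge0_le_integral => //.
- by move=> x _; apply: adde_ge0; apply: integral_ge0 => y _; exact: mule_ge0.
- by apply: emeasurable_funD; exact: mi.
- by apply: emeasurable_funD; exact: mi.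
move=> x _.
have mx (c : \bar R) (u : T -> \bar R) : measurable_fun setT u ->
  measurable_fun setT (fun y => c * u y) by exact: measurable_funeM.
rewrite -!ge0_integralD//; try (by move=> y _; exact: mule_ge0); try exact: mx.
apply: ge0_le_integral => //.
- by move=> y _; apply: adde_ge0; exact: mule_ge0.
- by apply: emeasurable_funD; exact: mx.
- by apply: emeasurable_funD; exact: mx.
move=> y _.
rewrite (_ : a x * b x * (a y * b y) = (a x * a y) * (b x * b y)); last by rewrite muleACA.
rewrite (_ : a x * (a y * b y ^+ 2) = (a x * a y) * b y ^+ 2); last by rewrite muleA.
rewrite (_ : a x * b x ^+ 2 * a y = (a x * a y) * b x ^+ 2); last by rewrite muleAC.
have bxy0 : 0 <= b x * b y by exact: mule_ge0.
rewrite -!ge0_muleDr//.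
apply: lee_wpmul2l; first exact: mule_ge0.
by rewrite ge0_muleDr// [leRHS]addeC; exact: mule_sqr_amgm.
Qed.

Definition conv g h : T -> \bar R := fun x => \int[mu]_y (g y * h (x - y)%R).

Lemma conv_ge0 g h : (forall x, 0 <= g x) -> (forall x, 0 <= h x) ->
  forall x, 0 <= conv g h x.
Proof. by move=> g0 h0 x; apply: integral_ge0 => y _; exact: mule_ge0. Qed.

Let mconv2 g h : measurable_fun setT g -> measurable_fun setT h ->
  measurable_fun setT (fun z : T * T => g z.2 * h (z.1 - z.2)%R).
Proof.
move=> mg mh; apply: emeasurable_funM; first exact: measurableT_comp.
by apply: (measurableT_comp mh); exact: measurable_rV_sub.
Qed.

Lemma measurable_conv g h : measurable_fun setT g -> measurable_fun setT h ->
  (forall x, 0 <= g x) -> (forall x, 0 <= h x) -> measurable_fun setT (conv g h).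
Proof.
move=> mg mh g0 h0.
by apply: (measurable_fun_fubini_tonelli_F (m2 := mu) _ (mconv2 mg mh)) => z; exact: mule_ge0.
Qed.

Lemma integral_conv g h : measurable_fun setT g -> measurable_fun setT h ->
  (forall x, 0 <= g x) -> (forall x, 0 <= h x) ->
  \int[mu]_x conv g h x = (\int[mu]_x g x) * \int[mu]_x h x.
Proof.
move=> mg mh g0 h0.
have ih0 : 0 <= \int[mu]_x h x by exact: integral_ge0.
rewrite /conv (fubini_tonelli _ (mconv2 mg mh)); last by move=> z; exact: mule_ge0.
rewrite -ge0_integralZr//; apply: eq_integral => y _ /=.
have msh : measurable_fun setT (fun x : T => h (x - y)%R).
  by apply: (measurableT_comp mh); exact: measurable_rV_sub.
rewrite ge0_integralZl//; congr (_ * _).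
by rewrite [RHS](@ge0_integral_shift R d (- y)).
Qed.

(** Cauchy-Schwarz at each point, with [g] as the weight, bounds the square by the mass of [g] times
    the convolution of [g] with [h ^+ 2], whose integral is a product. *)
Lemma integral_conv_sqr1 g h : measurable_fun setT g -> measurable_fun setT h ->
  (forall x, 0 <= g x) -> (forall x, 0 <= h x) ->
  \int[mu]_x conv g h x ^+ 2 <= (\int[mu]_x g x) ^+ 2 * \int[mu]_x h x ^+ 2.
Proof.
move=> mg mh g0 h0.
have mh2 : measurable_fun setT (fun x => h x ^+ 2).
  by under eq_fun do rewrite expe2; exact: emeasurable_funM.
have h20 x : 0 <= h x ^+ 2 by exact: expe_ge0.
have mc := measurable_conv mg mh2 g0 h20.
have ig0 : 0 <= \int[mu]_x g x by exact: integral_ge0.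
have c0 := conv_ge0 g0 h20.
have mcv := measurable_conv mg mh g0 h0.
have mcv2 : measurable_fun setT (fun x => conv g h x ^+ 2).
  by under eq_fun do rewrite expe2; exact: emeasurable_funM.
have cv20 x : 0 <= conv g h x ^+ 2 by apply: expe_ge0; exact: conv_ge0.
rewrite expe2 -muleA -(integral_conv mg mh2 g0 h20) -ge0_integralZl//.
apply: ge0_le_integral => //.
  exact: measurable_funeM.
move=> x _; apply: integral_cauchy_schwarz => //.
by apply: (measurableT_comp mh); exact: measurable_rV_sub.
Qed.

(** The same argument with the reflected translate of [h] as the weight. *)
Lemma integral_conv_sqr2 g h : measurable_fun setT g -> measurable_fun setT h ->
  (forall x, 0 <= g x) -> (forall x, 0 <= h x) ->
  \int[mu]_x conv g h x ^+ 2 <= (\int[mu]_x g x ^+ 2) * (\int[mu]_x h x) ^+ 2.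
Proof.
move=> mg mh g0 h0.
have mg2 : measurable_fun setT (fun x => g x ^+ 2).
  by under eq_fun do rewrite expe2; exact: emeasurable_funM.
have g20 x : 0 <= g x ^+ 2 by exact: expe_ge0.
have mc := measurable_conv mg2 mh g20 h0.
have ih0 : 0 <= \int[mu]_x h x by exact: integral_ge0.
have c0 := conv_ge0 g20 h0.
have mcv := measurable_conv mg mh g0 h0.
have mcv2 : measurable_fun setT (fun x => conv g h x ^+ 2).
  by under eq_fun do rewrite expe2; exact: emeasurable_funM.
have cv20 x : 0 <= conv g h x ^+ 2 by apply: expe_ge0; exact: conv_ge0.
rewrite expe2 muleA -(integral_conv mg2 mh g20 h0) muleC -ge0_integralZl//.
apply: ge0_le_integral => //.
  exact: measurable_funeM.
move=> x _; rewrite (@ge0_integral_reflect R d x h)//.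
have msh : measurable_fun setT (fun y : T => h (x - y)%R).
  by apply: (measurableT_comp mh); exact: measurable_rV_sub.
rewrite /conv; under eq_integral do rewrite muleC.
under [X in _ <= _ * X]eq_integral do rewrite muleC.
exact: integral_cauchy_schwarz.
Qed.
End Young.

(** * Convolutions of several densities with one of them weighted *)

Section ConvolutionEstimates.
Context {R : realType} (d : nat).
Local Notation mu := (@lebesgue_rV R d).
Local Notation T := 'rV[R]_d.
Local Open Scope ereal_scope.

(** Values are extended reals because convolutions may be infinite at some points before any norm is
    known to be finite. Bundling measurability and sign makes the class closed under the operations
    below. *)
Record density := Density {
  density_fun :> T -> \bar R;
  measurable_density : measurable_fun setT density_fun;
  density_ge0 : forall x, 0 <= density_fun x }.

Definition density0 : density := @Density (fun=> 0) (@measurable_cst _ _ _ _ _ _) (fun=> lexx _).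

Definition density_add (g h : density) : density :=
  @Density (fun x => g x + h x)
    (emeasurable_funD (measurable_density g) (measurable_density h))
    (fun x => adde_ge0 (density_ge0 g x) (density_ge0 h x)).

Definition density_conv (g h : density) : density :=
  @Density (conv g h)
    (measurable_conv (measurable_density g) (measurable_density h)
       (density_ge0 g) (density_ge0 h))
    (conv_ge0 (density_ge0 g) (density_ge0 h)).

Lemma measurable_weight (s : R) (g : density) :
  measurable_fun setT (fun x => (japanese x `^ s)%:E * g x).
Proof.
apply: emeasurable_funM; last exact: measurable_density.
by apply/measurable_EFinP; exact: measurable_powR_japanese.
Qed.

Lemma weight_ge0 (s : R) (g : density) x : 0 <= (japanese x `^ s)%:E * g x.
Proof. by apply: mule_ge0; [rewrite lee_fin powR_ge0|exact: density_ge0]. Qed.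

Definition density_weight (s : R) (g : density) : density :=
  Density (measurable_weight s g) (weight_ge0 s g).

Definition bracket (s : R) : density.
Proof.
apply: (@Density (fun x => (japanese x `^ s)%:E)).
  by apply/measurable_EFinP; exact: measurable_powR_japanese.
by move=> x; rewrite lee_fin powR_ge0.
Defined.

Variables s M : R.

Definition Ecv : seq density -> density := foldr density_conv (bracket (- M)).

(** A Leibniz rule: the sum, over the members of [gs], of the convolution [Ecv gs] with that one
    member multiplied by <.>^s. The bracket at the end of [Ecv] never carries the weight, hence the
    value 0 on the empty list. *)
Fixpoint Dcv (gs : seq density) : density :=
  if gs is g :: gs' then
    density_add (density_conv (density_weight s g) (Ecv gs')) (density_conv g (Dcv gs'))
  else density0.

Definition sqmass (g : density) : \bar R := \int[mu]_x (density_weight s g x) ^+ 2.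

Lemma sqmass_ge0 g : 0 <= sqmass g.
Proof. by apply: integral_ge0 => x _; apply: expe_ge0; exact: density_ge0. Qed.

Lemma prod_sqmass_ge0 gs : 0 <= \prod_(g <- gs) sqmass g.
Proof. by elim/big_ind: _ => // [x y|g _]; [exact: mule_ge0|exact: sqmass_ge0]. Qed.

Lemma density_integral_ge0 (g : density) : 0 <= \int[mu]_x g x.
Proof. by apply: integral_ge0 => x _; exact: density_ge0. Qed.

Lemma fin_bracket (t : R) : (d%:R < t)%R ->
  exists2 c : R, (0 <= c)%R & \int[mu]_x bracket (- t) x = c%:E.
Proof.
move=> dt; exists (fine (\int[mu]_x bracket (- t) x)).
  by rewrite fine_ge0// density_integral_ge0.
by rewrite fineK// ge0_fin_numE ?density_integral_ge0//; exact: integral_bracket.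
Qed.

Hypothesis ds : (d%:R / 2 < s)%R.
Hypothesis dM : (d%:R < M)%R.

(** Cauchy-Schwarz with weight <x>^(-2s) and second factor <x>^(2s) g: their product is g, and
    weight times square is (<x>^s g)^2. The constant is the integral of <x>^(-2s), finite because 2s
    > d. *)
Lemma sqr_integral_density : exists2 c : R, (0 <= c)%R &
  forall g : density, (\int[mu]_x g x) ^+ 2 <= c%:E * sqmass g.
Proof.
have [c c0 cE] : exists2 c : R, (0 <= c)%R & \int[mu]_x bracket (- (s * 2)) x = c%:E.
  by apply: fin_bracket; rewrite -ltr_pdivrMr.
exists c => // g; rewrite -cE.
have pE x : (japanese x `^ (- (s * 2)))%:E * ((japanese x `^ s)%:E * ((japanese x `^ s)%:E * g x)) = g x.
  rewrite !muleA -!EFinM -!powRD ?(gt_eqF (japanese_gt0 x)) ?implybT//.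
  by rewrite (_ : _ + _ + _ = 0)%R ?powRr0 ?mul1e//; ring.
have := @integral_cauchy_schwarz R d (bracket (- (s * 2)))
  (fun x => (japanese x `^ s)%:E * ((japanese x `^ s)%:E * g x)).
rewrite (eq_integral (fun x => g x)); last by move=> x _; exact: pE.
rewrite /sqmass [in X in _ -> X](_ : (fun x => _ ^+ 2) = (fun x =>
  bracket (- (s * 2)) x * ((japanese x `^ s)%:E * ((japanese x `^ s)%:E * g x)) ^+ 2)); last first.
  by apply/funext => x; rewrite !expe2 /= [RHS]muleA pE [RHS]muleCA [RHS]muleA.
apply.
- exact: measurable_density.
- apply: emeasurable_funM; first by apply/measurable_EFinP; exact: measurable_powR_japanese.
  exact: measurable_weight.
- exact: density_ge0.
- by move=> x; apply: mule_ge0; [rewrite lee_fin powR_ge0|exact: weight_ge0].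
Qed.

(** The mass of a convolution is the product of the masses. The squares are there because [sqmass]
    is a squared norm. *)
Lemma integral_Ecv n : exists2 K : R, (0 <= K)%R & forall gs, size gs = n ->
  (\int[mu]_x Ecv gs x) ^+ 2 <= K%:E * \prod_(g <- gs) sqmass g.
Proof.
have [c c0 cE] := fin_bracket dM; have [k k0 kE] := sqr_integral_density.
elim: n => [|n [K K0 ih]].
  exists (c ^+ 2)%R; first exact: sqr_ge0.
  by case=> // _; rewrite big_nil mule1 cE EFin_expe.
exists (k * K)%R; first exact: mulr_ge0.
case=> // g gs [sgs]; rewrite big_cons [X in X ^+ 2](_ : _ = (\int[mu]_x g x) * \int[mu]_x Ecv gs x).
  rewrite expe2 muleACA -!expe2 EFinM [leRHS]muleACA.
  by apply: lee_pmul; [apply: expe_ge0; exact: density_integral_ge0|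
    apply: expe_ge0; exact: density_integral_ge0|exact: kE|exact: ih].
by apply: integral_conv; [exact: measurable_density|exact: measurable_density|
  exact: density_ge0|exact: density_ge0].
Qed.

(** The two terms of [Dcv] call for the two forms of Young's inequality: in one the weighted head is
    measured in L^2 and [Ecv] in L^1, in the other the head in L^1 and the shorter [Dcv] in L^2. The
    factors 2 come from (a + b)^2 <= 2 a^2 + 2 b^2. *)
Lemma integral_sqr_Dcv n : exists2 K : R, (0 <= K)%R & forall gs, size gs = n ->
  \int[mu]_x (Dcv gs x) ^+ 2 <= K%:E * \prod_(g <- gs) sqmass g.
Proof.
have [k k0 kE] := sqr_integral_density.
elim: n => [|n [K K0 ih]].
  exists 0%R => //; case=> // _.
  by rewrite mul0e integral0_eq// => x _; exact: mul0e.
have [L L0 LE] := integral_Ecv n.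
exists (2 * L + 2 * (k * K))%R; first by rewrite addr_ge0// !mulr_ge0.
case=> // g gs [sgs]; rewrite big_cons.
pose a := density_conv (density_weight s g) (Ecv gs); pose b := density_conv g (Dcv gs).
rewrite -[Dcv _]/(density_add a b).
have ab x : (a x + b x) ^+ 2 <= 2%:E * a x ^+ 2 + 2%:E * b x ^+ 2.
  have := density_ge0 a x; have := density_ge0 b x.
  case: (a x) => [u| |]//; case: (b x) => [v| |]// u0 v0.
  - by rewrite !expe2 -!EFinM -!EFinD lee_fin; have := sqr_ge0 (u - v); nra.
  - by rewrite [leRHS](_ : _ = +oo) ?leey// !expe2 mulyy gt0_muley ?lte_fin// addey -?EFinM.
  - by rewrite [leRHS](_ : _ = +oo) ?leey// !expe2 mulyy gt0_muley ?lte_fin// addye -?EFinM.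
  - by rewrite [leRHS](_ : _ = +oo) ?leey// !expe2 mulyy gt0_muley ?lte_fin.
have m2 (h : density) : measurable_fun setT (fun x => 2%:E * h x ^+ 2).
  apply: measurable_funeM; under eq_fun do rewrite expe2.
  by apply: emeasurable_funM; exact: measurable_density.
have h2 (h : density) x : 0 <= h x ^+ 2 by apply: expe_ge0; exact: density_ge0.
have h22 (h : density) x : 0 <= 2%:E * h x ^+ 2 by apply: mule_ge0.
have mh2 (h : density) : measurable_fun setT (fun x => h x ^+ 2).
  by under eq_fun do rewrite expe2; apply: emeasurable_funM; exact: measurable_density.
apply: (@le_trans _ _ (\int[mu]_x (2%:E * a x ^+ 2 + 2%:E * b x ^+ 2))).
  apply: ge0_le_integral; [exact: measurableT|by move=> x _; exact: (h2 (density_add a b))|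
    exact: (mh2 (density_add a b))|exact: emeasurable_funD|by move=> x _; exact: ab].
have g2 : 0 <= sqmass g := sqmass_ge0 g.
have p2 := prod_sqmass_ge0 gs.
rewrite ge0_integralD// !ge0_integralZl// (EFinD (2 * L)) [leRHS]ge0_muleDl ?lee_fin ?mulr_ge0//.
apply: leeD; rewrite EFinM -muleA; apply: lee_wpmul2l => //.
- apply: (le_trans (integral_conv_sqr2 _ _ _ _)); try exact: measurable_density;
    try exact: density_ge0.
  rewrite [leRHS]muleCA; apply: lee_wpmul2l => //; exact: LE.
- apply: (le_trans (integral_conv_sqr1 _ _ _ _)); try exact: measurable_density;
    try exact: density_ge0.
  rewrite EFinM [leRHS]muleACA; apply: lee_pmul; [by apply: expe_ge0; exact: density_integral_ge0|
    by apply: integral_ge0|exact: kE|exact: ih].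
Qed.
End ConvolutionEstimates.

(** * Kernels of commutators and their bound by convolutions *)

Section CommutatorKernel.
Context {R : realType} (d : nat).
Local Notation mu := (@lebesgue_rV R d).
Local Notation T := 'rV[R]_d.

(** What is retained of the transform of a test function. The moments absorb the polynomial growth
    of kernels; pointwise decay is needed when the argument of one function involves the variable of
    another. *)
Record rapid := Rapid {
  rapid_fun :> T -> R[i];
  cmeasurable_rapid : cmeasurable rapid_fun;
  rapid_moment : forall m : nat,
    (\int[mu]_x (normc (rapid_fun x) * japanese x ^+ m)%:E < +oo)%E;
  rapid_decay : forall m : nat, exists2 C : R, 0 <= C &
    forall x, normc (rapid_fun x) * japanese x ^+ m <= C }.

Implicit Types (F : rapid) (k : T -> T -> R[i]).

(** Growth in [z] uniform in [th] is enough for all integrals against rapid functions to converge,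
    and it survives both [kdiff] and [kcomm]. *)
Definition admissible k := cmeasurable (fun z : T * T => k z.1 z.2) /\
  exists C (m : nat), 0 <= C /\ forall th z, normc (k th z) <= C * japanese z ^+ m.

(** The sign, opposite to that of [diffs], is the one of the commutator fP - Pf: the first term
    comes from fP, the shifted one from Pf. *)
Definition kdiff (v : T) k : T -> T -> R[i] := fun th z => k th z - k th (z + v).

Definition kdiffs (vs : seq T) k : T -> T -> R[i] := foldl (fun k v => kdiff v k) k vs.

Definition kcomm F k : T -> T -> R[i] := fun th z =>
  cintegral mu (fun xi => F xi * kdiff xi k (th - xi) z).

Definition kcomms (Fs : seq rapid) k : T -> T -> R[i] := foldr kcomm k Fs.

Lemma japanese_add_exp (m : nat) (x y : T) :
  japanese (x + y) ^+ m <= 2 ^+ m * japanese x ^+ m * japanese y ^+ m.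
Proof.
by rewrite -!exprMn lerXn2r ?nnegrE ?mulr_ge0 ?japanese_ge0// japanese_peetre.
Qed.

Lemma measurable_exp_japanese (m : nat) : measurable_fun setT (fun x : T => japanese x ^+ m).
Proof. by apply: measurable_funX; exact: measurable_japanese. Qed.

Lemma measurable_rapid_moment F m :
  measurable_fun setT (fun x => (normc (F x) * japanese x ^+ m)%:E).
Proof.
apply/measurable_EFinP; apply: measurable_funM; last exact: measurable_exp_japanese.
exact: (cmeasurable_normc (cmeasurable_rapid F)).
Qed.

Lemma rapid_moment_ge0 F m : (0 <= \int[mu]_x (normc (F x) * japanese x ^+ m)%:E)%E.
Proof.
apply: integral_ge0 => x _.
by rewrite lee_fin mulr_ge0 ?normc_ge0 ?exprn_ge0 ?japanese_ge0.
Qed.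

Lemma kcomm_integrand F k : admissible k -> exists C (m : nat), 0 <= C /\ forall th z xi,
  normc (F xi * kdiff xi k (th - xi) z) <=
  C * japanese z ^+ m * (normc (F xi) * japanese xi ^+ m).
Proof.
move=> [_ [C [m [C0 kC]]]]; exists (C * (1 + 2 ^+ m)), m; split.
  by rewrite mulr_ge0// addr_ge0// exprn_ge0.
move=> th z xi; rewrite normcM [leRHS]mulrCA; apply: ler_wpM2l; first exact: normc_ge0.
apply: (le_trans (ler_normcB _ _)).
apply: (le_trans (lerD (kC _ _) (kC _ _))).
rewrite -mulrDr -!mulrA; apply: ler_wpM2l => //.
rewrite mulrDl mul1r lerD//.
  by rewrite ler_peMr ?exprn_ge0 ?japanese_ge0// exprn_ege1// japanese_ge1.
by rewrite mulrA; exact: japanese_add_exp.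
Qed.

Lemma cmeasurable_kdiff2 k : cmeasurable (fun z : T * T => k z.1 z.2) ->
  cmeasurable (fun z : (T * T) * T => kdiff z.2 k (z.1.1 - z.2) z.1.2).
Proof.
move=> mk; apply: cmeasurableB.
  apply: (cmeasurable_comp (F := fun z : T * T => k z.1 z.2) (phi := fun z : (T * T) * T => (z.1.1 - z.2, z.1.2))) => //.
  apply/measurable_fun_pair => /=.
    by apply: measurable_rV_sub => //; exact: measurableT_comp.
  exact: measurableT_comp.
apply: (cmeasurable_comp (F := fun z : T * T => k z.1 z.2) (phi := fun z : (T * T) * T => (z.1.1 - z.2, z.1.2 + z.2))) => //.
apply/measurable_fun_pair => /=.
  by apply: measurable_rV_sub => //; exact: measurableT_comp.
by apply: measurable_rV_add => //; exact: measurableT_comp.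
Qed.

Lemma cmeasurable_kcomm2 F k : cmeasurable (fun z : T * T => k z.1 z.2) ->
  cmeasurable (fun z : (T * T) * T => F z.2 * kdiff z.2 k (z.1.1 - z.2) z.1.2).
Proof.
move=> mk; apply: cmeasurableM; last exact: cmeasurable_kdiff2.
by apply: (cmeasurable_comp (cmeasurable_rapid F)); exact: measurable_snd.
Qed.

Lemma cintegrable_kcomm F k th z : admissible k ->
  cintegrable mu (fun xi => F xi * kdiff xi k (th - xi) z).
Proof.
move=> ak; have [C [m [C0 FC]]] := kcomm_integrand F ak.
apply: (le_cintegrable (g := fun xi : T => ((C * japanese z ^+ m)%:E * (normc (F xi) * japanese xi ^+ m)%:E)%E)).
- apply: (cmeasurable_comp (cmeasurable_kcomm2 F ak.1) (phi := fun xi : T => ((th, z), xi))).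
  exact: pair1_measurable.
- by apply: measurable_funeM; exact: measurable_rapid_moment.
- by move=> xi; rewrite -EFinM lee_fin; exact: FC.
rewrite ge0_integralZl//; last 3 first.
- exact: measurable_rapid_moment.
- by move=> x _; rewrite lee_fin mulr_ge0 ?normc_ge0 ?exprn_ge0 ?japanese_ge0.
- by rewrite lee_fin mulr_ge0 ?exprn_ge0 ?japanese_ge0.
rewrite lte_mul_pinfty ?lee_fin ?mulr_ge0 ?exprn_ge0 ?japanese_ge0//.
exact: rapid_moment.
Qed.

Lemma admissible_kcomm F k : admissible k -> admissible (kcomm F k).
Proof.
move=> ak; split.
  exact: (cmeasurable_cintegral mu (cmeasurable_kcomm2 F ak.1)).
have [C [m [C0 FC]]] := kcomm_integrand F ak.
have I0 := rapid_moment_ge0 F m.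
exists (C * fine (\int[mu]_x (normc (F x) * japanese x ^+ m)%:E)), m.
split; first by rewrite mulr_ge0// fine_ge0.
move=> th z; rewrite -lee_fin.
apply: (le_trans (le_normc_cintegral (cintegrable_kcomm F th z ak))).
rewrite mulrAC EFinM fineK ?ge0_fin_numE//; last exact: rapid_moment.
have mF := measurable_rapid_moment F m.
rewrite -ge0_integralZl//; last 2 first.
- by move=> x _; rewrite lee_fin mulr_ge0 ?normc_ge0 ?exprn_ge0 ?japanese_ge0.
- by rewrite lee_fin mulr_ge0 ?exprn_ge0 ?japanese_ge0.
apply: ge0_le_integral => //.
- by move=> x _; rewrite lee_fin normc_ge0.
- by apply/measurable_EFinP/cmeasurable_normc; exact: (cintegrable_kcomm F th z ak).1.
- exact: measurable_funeM.
by move=> x _; rewrite -EFinM lee_fin; exact: FC.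
Qed.

Lemma admissible_kcomms Fs k : admissible k -> admissible (kcomms Fs k).
Proof. by move=> ak; elim: Fs => //= F Fs; exact: admissible_kcomm. Qed.

Lemma admissible_kdiff v k : admissible k -> admissible (kdiff v k).
Proof.
move=> [mk [C [m [C0 kC]]]]; split.
  apply: cmeasurableB => //.
  apply: (cmeasurable_comp (F := fun z : T * T => k z.1 z.2) (phi := fun z : T * T => (z.1, z.2 + v))) => //.
  apply/measurable_fun_pair => //=.
  by apply: measurable_rV_add => //; exact: measurableT_comp.
exists (C * (1 + 2 ^+ m * japanese v ^+ m)), m; split.
  by rewrite mulr_ge0// addr_ge0// mulr_ge0 ?exprn_ge0 ?japanese_ge0.
move=> th z; apply: (le_trans (ler_normcB _ _)).
apply: (le_trans (lerD (kC _ _) (kC _ _))).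
rewrite -mulrDr -!mulrA; apply: ler_wpM2l => //.
by rewrite mulrDl mul1r lerD// mulrAC; exact: japanese_add_exp.
Qed.

(** The integral in [kcomm] leaves [z] as a free parameter. Consequently the difference created by
    an outer commutator can be pushed through the inner ones onto the original kernel. *)
Lemma kcomm_kdiff F v k : admissible k -> kcomm F (kdiff v k) = kdiff v (kcomm F k).
Proof.
move=> ak; apply/funext => th; apply/funext => z.
rewrite /kcomm /kdiff -cintegralB; [|exact: cintegrable_kcomm|exact: cintegrable_kcomm].
apply: eq_cintegral => xi; rewrite -mulrBr /kdiff; congr (_ * _).
by rewrite (addrAC z v xi) !opprD !opprK addrACA.
Qed.

Lemma kcomms_kdiff Fs v k : admissible k -> kcomms Fs (kdiff v k) = kdiff v (kcomms Fs k).
Proof.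
move=> ak; elim: Fs => //= F Fs ->; rewrite kcomm_kdiff//.
exact: admissible_kcomms.
Qed.

Lemma measurable_rapid_density F :
  measurable_fun setT (fun x => (japanese x * normc (F x))%:E).
Proof.
apply/measurable_EFinP; apply: measurable_funM; first exact: measurable_japanese.
exact: (cmeasurable_normc (cmeasurable_rapid F)).
Qed.

Lemma rapid_density_ge0 F x : (0 <= (japanese x * normc (F x))%:E)%E.
Proof. by rewrite lee_fin mulr_ge0 ?normc_ge0 ?japanese_ge0. Qed.

(** The bracket is the factor <v> that each difference of step [v] costs. *)
Definition rapid_density F : density d :=
  Density (measurable_rapid_density F) (rapid_density_ge0 F).

Variables s M : R.

(** The parameters are generalised so that the induction closes. Peeling off [F] at frequency [xi]
    replaces [k] by [kdiff xi k], translates [omega] by [xi], multiplies [C] by <xi> and adds <xi>^s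
    to [c]; the constant [c] collects the weights of the frequencies already peeled. *)
Lemma kcomms_bound (Fs : seq rapid) : forall (omega : T -> R) k (C c : R) (z th : T),
  admissible k -> (forall x, 0 <= omega x) -> 0 <= C -> 0 <= c ->
  (forall (vs : seq T) (th' : T), size vs = size Fs ->
     omega (th' + \sum_(v <- vs) v) * normc (kdiffs vs k th' z) <=
     C * \prod_(v <- vs) japanese v * (c + \sum_(v <- vs) japanese v `^ s) *
       japanese th' `^ (- M)) ->
  ((omega th * normc (kcomms Fs k th z))%:E <=
    C%:E * (c%:E * Ecv M [seq rapid_density F | F <- Fs] th +
            Dcv s M [seq rapid_density F | F <- Fs] th))%E.
Proof.
elim: Fs => [|F Fs ih] omega k C c z th ak o0 C0 c0 H.
  have := H [::] th erefl.
  rewrite !big_nil !addr0 mulr1 => h.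
  rewrite [leRHS](_ : _ = (C * c * japanese th `^ (- M))%:E) ?lee_fin//.
  by rewrite -mulrA !EFinM; congr (_ * _)%E; exact: adde0.
set gs := [seq rapid_density F | F <- Fs] in ih *; set g := rapid_density F.
have aks := admissible_kcomms Fs ak.
have IH xi : ((omega th * normc (kdiff xi (kcomms Fs k) (th - xi) z))%:E <=
    (C * japanese xi)%:E * ((c + japanese xi `^ s)%:E * Ecv M gs (th - xi)%R +
      Dcv s M gs (th - xi)%R))%E.
  rewrite -kcomms_kdiff//.
  have := ih (fun x => omega (x + xi)) (kdiff xi k) (C * japanese xi)
    (c + japanese xi `^ s) z (th - xi).
  rewrite subrK; apply => //.
  - exact: admissible_kdiff.
  - by rewrite mulr_ge0// japanese_ge0.
  - by rewrite addr_ge0// powR_ge0.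
  move=> vs th' svs; have := H (xi :: vs) th' (congr1 S svs).
  rewrite !big_cons /= (addrA th') (addrAC th') -(addrA c) !mulrA.
  exact.
have iF := cintegrable_kcomm F th z aks.
have mN : measurable_fun setT (fun xi : T => (normc (F xi * kdiff xi (kcomms Fs k) (th - xi) z))%:E).
  by apply/measurable_EFinP; exact: (cmeasurable_normc iF.1).
have mD (h : density d) : measurable_fun setT (fun xi : T => h (th - xi)).
  by apply: (measurableT_comp (measurable_density h)); exact: measurable_rV_sub.
have mE := mD (Ecv M gs); have mDD := mD (Dcv s M gs).
have mg := measurable_density g; have mw := measurable_density (density_weight s g).
have E0 x := density_ge0 (Ecv M gs) x; have D0 x := density_ge0 (Dcv s M gs) x.
have g0 x := density_ge0 g x; have w0 x := density_ge0 (density_weight s g) x.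
rewrite EFinM.
apply: (@le_trans _ _ (\int[mu]_xi ((omega th)%:E * (normc (F xi * kdiff xi (kcomms Fs k) (th - xi) z))%:E))%E).
  rewrite ge0_integralZl ?lee_fin//; last by move=> x _; rewrite lee_fin normc_ge0.
  apply: lee_wpmul2l; first by rewrite lee_fin.
  exact: le_normc_cintegral.
(* Three places for the weight: it stays in [c], falls on the factor just peeled, or falls on a
   later one. *)
pose I1 xi := (c%:E * (g xi * Ecv M gs (th - xi)%R))%E.
pose I2 xi := (density_weight s g xi * Ecv M gs (th - xi)%R)%E.
pose I3 xi := (g xi * Dcv s M gs (th - xi)%R)%E.
have mI1 : measurable_fun setT I1 by apply: measurable_funeM; exact: emeasurable_funM.
have mI2 : measurable_fun setT I2 by exact: emeasurable_funM.
have mI3 : measurable_fun setT I3 by exact: emeasurable_funM.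
have I10 xi : (0 <= I1 xi)%E by apply: mule_ge0; [rewrite lee_fin|exact: mule_ge0].
have I20 xi : (0 <= I2 xi)%E by exact: mule_ge0.
have I30 xi : (0 <= I3 xi)%E by exact: mule_ge0.
have -> : (C%:E * (c%:E * Ecv M [seq rapid_density F0 | F0 <- F :: Fs] th +
    Dcv s M [seq rapid_density F0 | F0 <- F :: Fs] th) =
    \int[mu]_xi (C%:E * (I1 xi + (I2 xi + I3 xi))))%E.
  rewrite ge0_integralZl ?lee_fin//; last 2 first.
  - by apply: emeasurable_funD => //; exact: emeasurable_funD.
  - by move=> x _; rewrite adde_ge0// adde_ge0.
  rewrite ge0_integralD//; last 2 first.
  - by move=> x _; rewrite adde_ge0.
  - exact: emeasurable_funD.
  rewrite ge0_integralD// ge0_integralZl ?lee_fin//.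
  - exact: emeasurable_funM.
  - by move=> x _; exact: mule_ge0.
apply: ge0_le_integral => //.
- by move=> x _; apply: mule_ge0; rewrite lee_fin ?normc_ge0.
- exact: measurable_funeM.
- by apply: measurable_funeM; apply: emeasurable_funD => //; exact: emeasurable_funD.
move=> xi _.
rewrite normcM -EFinM mulrCA EFinM.
apply: (le_trans (lee_wpmul2l _ (IH xi))); first by rewrite lee_fin normc_ge0.
rewrite muleA -EFinM (_ : normc (F xi) * (C * japanese xi) = C * (japanese xi * normc (F xi))); last by ring.
rewrite EFinM -muleA; apply: lee_wpmul2l; first by rewrite lee_fin.
rewrite -[(_ * normc _)%:E]/(g xi) ge0_muleDr//; last first.
  by apply: mule_ge0 => //; rewrite lee_fin addr_ge0// powR_ge0.
rewrite EFinD ge0_muleDl ?lee_fin ?powR_ge0// ge0_muleDr//; last 2 first.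
- by apply: mule_ge0 => //; rewrite lee_fin.
- by apply: mule_ge0 => //; rewrite lee_fin powR_ge0.
rewrite -addeA /I1 /I2 /I3 muleCA; apply: leeD => //; apply: leeD => //.
by rewrite muleCA muleA.
Qed.
End CommutatorKernel.

(** * Derivatives and differences of the entries of a symbol *)

Section SymbolDerivatives.
Context {R : realType} (d : nat).
Local Notation T := 'rV[R]_d.
Local Notation V := ('rV[R]_d * 'rV[R]_d)%type.

Definition ex (j : 'I_d) : V := (delta_mx 0 j, 0).
Definition ez (v : T) : V := (0, v).

Lemma perm_flatten_count (W : eqType) (f : 'I_d -> W) (ks : seq 'I_d) :
  perm_eq (flatten [seq nseq (count_mem i ks) (f i) | i <- enum 'I_d]) [seq f k | k <- ks].
Proof.
apply/permP => P; rewrite count_flatten sumnE !big_map -enumT big_enum /= count_map.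
under eq_bigr do rewrite count_nseq.
elim: ks => [|k ks ih]; first by rewrite big1// => i _; rewrite muln0.
under eq_bigr do rewrite /= mulnDr.
rewrite big_split /= ih (bigD1 k)//= eqxx muln1 big1 ?addn0// => i ik.
by rewrite eq_sym (negPf ik) muln0.
Qed.

(** Lists of indices encode multi-indices by counting; expanding directions in the basis produces
    lists, whereas the symbol estimates are stated for multi-indices. *)
Lemma multi_dirs_perm (js ks : seq 'I_d) :
  perm_eq (multi_dirs (fun i => count_mem i js) (fun i => count_mem i ks))
    ([seq ex j | j <- js] ++ [seq ez (delta_mx 0 k) | k <- ks]).
Proof. by apply: perm_cat; exact: perm_flatten_count. Qed.

Lemma order_multi_count (ks : seq 'I_d) : order_multi (fun i => count_mem i ks) = size ks.
Proof.
rewrite /order_multi; elim: ks => [|k ks ih]; first by rewrite big1.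
rewrite /= big_split /= ih (bigD1 k)//= eqxx big1 ?addn0// => i ik.
by rewrite eq_sym (negPf ik).
Qed.

Variables (m : R) (p : symbol (R := R) d).
Hypothesis pm : symbol_class m p.
Variables i j : 'I_d.

Definition entry : V -> R[i] := fun z => p z.1 z.2 i j.

(** The symbol estimates give one constant for each choice of coordinate directions. There are
    finitely many choices of given length, and the sum of their constants serves for all. *)
Lemma symbol_iterD_bound N n : exists2 B : R, 0 <= B & forall l (ks : seq 'I_d) (z : V),
  size ks = n ->
  `|iterD (nseq N (ex l) ++ [seq ez (delta_mx 0 k) | k <- ks])
     (fun z => complex.Re (entry z)) z| <= B * japanese z.2 `^ (m - n%:R) /\
  `|iterD (nseq N (ex l) ++ [seq ez (delta_mx 0 k) | k <- ks])
     (fun z => complex.Im (entry z)) z| <= B * japanese z.2 `^ (m - n%:R).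
Proof.
have [sp bp] := pm; have [sR sI] := sp i j.
have /choice[C HC] : forall lk : 'I_d * n.-tuple 'I_d, exists C : R, 0 <= C /\ forall z : V,
    normc (iterDC (nseq N (ex lk.1) ++ [seq ez (delta_mx 0 k) | k <- lk.2]) entry z) <=
      C * japanese z.2 `^ (m - n%:R).
  move=> [l ks]; have [C HC] := bp (fun i => count_mem i ks) (fun i => count_mem i (nseq N l)).
  exists `|C|; split => // -[x xi]; have := HC x xi i j.
  rewrite order_multi_count size_tuple => h.
  have pe := multi_dirs_perm (nseq N l) ks; rewrite map_nseq in pe.
  have eR := iterD_perm sR pe; have eI := iterD_perm sI pe.
  rewrite /iterDC eR eI in h.
  by apply: (le_trans h); rewrite ler_wpM2r ?powR_ge0// ler_norm.
exists (\sum_lk C lk); first by apply: sumr_ge0 => lk _; exact: (HC lk).1.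
move=> l ks z /eqP sk; have [C0 h] := HC (l, Tuple sk).
have CS : C (l, Tuple sk) <= \sum_lk C lk.
  by rewrite (bigD1 (l, Tuple sk))//= lerDl sumr_ge0// => lk _; exact: (HC lk).1.
have h2 := le_trans (h z) (ler_wpM2r (powR_ge0 _ _) CS).
by split; apply: le_trans h2; [exact: (le_trans _ (normr_Re_le _))|exact: (le_trans _ (normr_Im_le _))].
Qed.

Lemma sum_coord_le_japanese (v : T) : \sum_k `|v 0 k| <= d%:R * japanese v.
Proof.
rewrite -[d in d%:R](card_ord d) mulr_natl -sumr_const.
by apply: ler_sum => k _; exact: coord_le_japanese.
Qed.

Lemma lincomb_ez (v : T) : lincomb [seq (v 0 k, ez (delta_mx 0 k)) | k <- enum 'I_d] = ez v.
Proof.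
rewrite /lincomb big_map big_enum /= [v in RHS]row_sum_delta.
rewrite /ez; elim/big_rec2: _ => [//|k a b _ ->].
by apply: injective_projections; rewrite /= ?scaler0 ?addr0.
Qed.

(** Each frequency direction [v] is expanded in the coordinate basis, and the absolute values of its
    coordinates add up to at most d <v>. *)
Lemma iterD_dirs_bound (g : V -> R) N l (h : R) (vs : seq T) (z : V) (B : R) :
  smooth g -> 0 <= B ->
  (forall ks : seq 'I_d, size ks = size vs ->
     `|iterD (nseq N (ex l) ++ [seq ez (delta_mx 0 k) | k <- ks]) g z| <= B) ->
  `|iterD (nseq N (h *: ex l) ++ [seq ez v | v <- vs]) g z| <=
    `|h| ^+ N * (\prod_(v <- vs) (d%:R * japanese v)) * B.
Proof.
move=> sg B0 H.
pose cs : seq (seq (R * V)) := nseq N [:: (h, ex l)] ++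
  [seq [seq (v 0 k, ez (delta_mx 0 k)) | k <- enum 'I_d] | v : T <- vs].
have -> : nseq N (h *: ex l) ++ [seq ez v | v <- vs] = map (@lincomb _ _) cs.
  rewrite map_cat map_nseq -map_comp; congr (_ ++ _).
    by rewrite /lincomb big_seq1.
  by apply: eq_map => v; rewrite /= lincomb_ez.
apply: (le_trans (@iterD_lincomb_bound _ _ cs g z B sg B0 _)).
  move=> us Hus.
  have [ks [sks ->]] : exists ks, size ks = size vs /\
      us = nseq N (ex l) ++ [seq ez (delta_mx 0 k) | k <- ks].
    rewrite /cs {cs} in Hus; elim: N us Hus {H} => [|N ih] us /=.
      elim: vs us => [|v vs ihv] [|u us]//=; first by exists [::].
      move=> /andP[+ /ihv[ks [sks ->]]]; rewrite -map_comp => /mapP[k _ ->].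
      by exists (k :: ks); rewrite /= sks.
    case: us => [//|u us] /= /andP[+ /ih[ks [sks ->]]].
    by rewrite inE => /eqP ->; exists ks.
  exact: H.
apply: ler_wpM2r => //; rewrite big_cat /=.
rewrite big_nseq /= big_seq1 iter_mulr_1 big_map.
apply: ler_wpM2l; first exact: exprn_ge0.
apply: ler_prod => v _; rewrite big_map big_enum /= sum_coord_le_japanese andbT.
exact: sumr_ge0.
Qed.

(** Steps in the x-direction leave the frequency unchanged, and a fraction of [v] has bracket at
    most <v>. *)
Lemma in_span_ez_ex N l (h : R) (vs : seq T) (x y : V) :
  in_span (nseq N (h *: ex l) ++ [seq ez v | v <- vs]) x y ->
  japanese y.2 <= japanese x.2 + \sum_(v <- vs) japanese v.
Proof.
elim: N x => [|N ih] x /=.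
  elim: vs x => [|v vs ihv] x /=; first by move=> ->; rewrite big_nil addr0.
  move=> [t t01 /ihv h1]; rewrite big_cons; apply: (le_trans h1).
  rewrite addrA lerD2r; apply: (le_trans (japanese_triangle _ _)).
  by rewrite [leRHS]addrC; apply: lerD; [exact: japanese_scale|exact: lexx].
move=> [t _ /ih]; rewrite /= !scaler0 add0r; exact.
Qed.


(** The mean value theorem gives the derivative bound at an unknown intermediate frequency. As the
    exponent m - n is nonnegative, the power is monotone and the bracket there may be replaced by
    its upper bound, the sum of brackets. *)
Lemma entry_diffs_bound N n : n%:R <= m -> exists2 B : R, 0 <= B &
  forall l (h : R) (vs : seq T) (z : V), size vs = n ->
  normc (diffs (nseq N (h *: ex l) ++ [seq ez v | v <- vs]) entry z) <=
    `|h| ^+ N * (B * (\prod_(v <- vs) japanese v) *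
      (japanese z.2 + \sum_(v <- vs) japanese v) `^ (m - n%:R)).
Proof.
move=> nm; have [B B0 HB] := symbol_iterD_bound N n.
(* The 2 accounts for the real and the imaginary part, each [d%:R] for the expansion of one
   direction. *)
exists (2 * B * d%:R ^+ n); first by rewrite !mulr_ge0// exprn_ge0.
move=> l h vs z sv; set S := japanese z.2 + _.
have S0 : 0 <= S.
  by rewrite addr_ge0 ?japanese_ge0// sumr_ge0// => v _; exact: japanese_ge0.
have [sR sI] := pm.1 i j.
have pE : \prod_(v <- vs) (d%:R * japanese v) = d%:R ^+ n * \prod_(v <- vs) japanese v.
  by rewrite big_split /= big_const_seq count_predT sv iter_mulr_1.
have p0 : 0 <= \prod_(v <- vs) japanese v by apply: prodr_ge0 => v _; exact: japanese_ge0.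
have BS0 : 0 <= B * S `^ (m - n%:R) by rewrite mulr_ge0// powR_ge0.
have mono y : in_span (nseq N (h *: ex l) ++ [seq ez v | v <- vs]) z y ->
    B * japanese y.2 `^ (m - n%:R) <= B * S `^ (m - n%:R).
  move=> /in_span_ez_ex yS; apply: ler_wpM2l => //.
  by apply: ge0_ler_powR => //; rewrite ?nnegrE ?japanese_ge0 ?subr_ge0.
apply: (le_trans (normc_le_ReIm _)); rewrite Re_diffs Im_diffs.
have -> : `|h| ^+ N * (2 * B * d%:R ^+ n * (\prod_(v <- vs) japanese v) * S `^ (m - n%:R)) =
    `|h| ^+ N * (\prod_(v <- vs) (d%:R * japanese v)) * (B * S `^ (m - n%:R)) +
    `|h| ^+ N * (\prod_(v <- vs) (d%:R * japanese v)) * (B * S `^ (m - n%:R)).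
  rewrite pE; move: (S `^ _) (`|h| ^+ N) (_ ^+ n) (\prod_(_ <- _) _) => a b c e; ring.
apply: lerD; apply: diffs_bound => // y Hy; apply: iterD_dirs_bound => // ks sks.
  by apply: le_trans (mono y Hy); apply: (HB l ks y _).1; rewrite sks.
by apply: le_trans (mono y Hy); apply: (HB l ks y _).2; rewrite sks.
Qed.
End SymbolDerivatives.

(** * The kernel of a symbol *)

Section SymbolKernel.
Context {R : realType} (d : nat).
Local Notation mu := (@lebesgue_rV R d).
Local Notation T := 'rV[R]_d.
Local Notation V := ('rV[R]_d * 'rV[R]_d)%type.

Definition ksym (a : V -> R[i]) : T -> T -> R[i] := fun th z => ft (fun x => a (x, z)) th.

Lemma ftB (g h : T -> R[i]) th : cintegrable mu g -> cintegrable mu h ->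
  ft (fun x => g x - h x) th = ft g th - ft h th.
Proof.
move=> ig ih; rewrite /ft -cintegralB; [|exact: cintegrable_phase|exact: cintegrable_phase].
by apply: eq_cintegral => x; rewrite mulrBr.
Qed.

Lemma add_ez (x z v : T) : (x, z) + ez v = (x, z + v).
Proof. by apply: injective_projections; rewrite /= ?addr0. Qed.

Lemma cintegrable_diffs_ez (a : V -> R[i]) (vs : seq T) :
  (forall z, cintegrable mu (fun x => a (x, z))) ->
  forall z, cintegrable mu (fun x => diffs [seq ez v | v <- vs] a (x, z)).
Proof.
move=> ia; elim: vs => [//|v vs ih] z /=.
apply: cintegrableB; last exact: ih.
by under eq_fun do rewrite add_ez; exact: ih.
Qed.

(** The sign records the opposite conventions of [kdiff] and [diffs]; the reversal appears because
    one folds from the left and the other from the right. *)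
Lemma kdiffs_ksym (a : V -> R[i]) (vs : seq T) th z :
  (forall z, cintegrable mu (fun x => a (x, z))) ->
  kdiffs vs (ksym a) th z =
  (-1) ^+ size vs * ft (fun x => diffs [seq ez v | v <- rev vs] a (x, z)) th.
Proof.
move=> ia; elim/last_ind: vs th z => [|vs v ih] th z; first by rewrite mul1r.
rewrite /kdiffs -cats1 foldl_cat /= -/(kdiffs _ _) /kdiff !ih cats1 rev_rcons size_rcons /=.
rewrite ftB; last first.
- exact: cintegrable_diffs_ez.
- under eq_fun do rewrite add_ez.
  exact: cintegrable_diffs_ez.
rewrite -mulrBr exprS mulN1r mulNr -mulrN opprB; congr (_ * (_ - _)).
apply: eq_cintegral => x; congr (_ * diffs _ _ _).
by rewrite add_ez.
Qed.

Lemma diffs_ex (D : V -> R[i]) N (h : R) (l : 'I_d) x z :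
  diffs (nseq N (h *: delta_mx 0 l)) (fun x => D (x, z)) x = diffs (nseq N (h *: ex l)) D (x, z).
Proof.
elim: N x => [//|N ih] x /=; rewrite !ih; congr (diffs _ _ _ - _).
by apply: injective_projections; rewrite /= ?scaler0 ?addr0.
Qed.

Variables (m : R) (p : symbol (R := R) d).
Hypotheses (pm : symbol_class m p) (sp : x_compact_support p).

Lemma symbol_supported : exists rho : R, forall x, rho < `|x| -> forall z, p x z = 0.
Proof.
have [K [cK pK]] := sp.
have [rho H] : exists rho : R, forall x, rho < `|x| -> (p x : T -> 'M[R[i]]_d) = 0.
  apply: compact_supported; exists K; split => // x /pK h; exact/funext.
by exists rho => x /H ->.
Qed.

Variables i j : 'I_d.
Local Notation a := (entry p i j).

Lemma cmeasurable_entry : cmeasurable a.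
Proof.
have [sR sI] := pm.1 i j.
by split; apply: measurable_continuous_rV2; exact: smooth_continuous.
Qed.

Lemma cmeasurable_entry1 z : cmeasurable (fun x => a (x, z)).
Proof. exact: (cmeasurable_comp cmeasurable_entry (pair2_measurable z)). Qed.

Lemma entry_bound : exists2 B : R, 0 <= B & forall z : V, normc (a z) <= B * japanese z.2 `^ m.
Proof.
have [B B0 HB] := symbol_iterD_bound pm i j 0 0.
exists (2 * B); first by rewrite mulr_ge0.
move=> z; apply: (le_trans (normc_le_ReIm _)).
have [h1 h2] := HB i [::] z erefl; rewrite subr0 in h1 h2.
rewrite (_ : 2 * B * _ = B * japanese z.2 `^ m + B * japanese z.2 `^ m); last by ring.
exact: (lerD h1 h2).
Qed.

Lemma cintegrable_entry z : cintegrable mu (fun x => a (x, z)).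
Proof.
have [rho H] := symbol_supported; have [K K0 HK] := @integral_supported R d rho.
have [B B0 HB] := entry_bound.
apply: (HK _ (B * japanese z `^ m) _ _ _ _).1.
- exact: cmeasurable_entry1.
- by rewrite mulr_ge0// powR_ge0.
- by move=> x; exact: (HB (x, z)).
- by move=> x /H h; rewrite /entry /= h mxE.
Qed.

(** [ft_decay] is applied in [x] to the n-fold frequency difference of the entry, whose support in
    [x] is the same for all frequencies. It asks for a sup bound ([B2]) and a bound on N-fold
    x-differences ([B1]), and [B1 + B2] serves for both. *)
Lemma kdiffs_bound N n : n%:R <= m -> exists2 C : R, 0 <= C &
  forall (vs : seq T) th z, size vs = n ->
  normc (kdiffs vs (ksym a) th z) * japanese th ^+ N <=
    C * (\prod_(v <- vs) japanese v) *
      (japanese z + \sum_(v <- vs) japanese v) `^ (m - n%:R).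
Proof.
move=> nm; have [rho Hrho] := symbol_supported.
have [B1 B10 H1] := entry_diffs_bound pm i j N nm.
have [B2 B20 H2] := entry_diffs_bound pm i j 0 nm.
have [K K0 HK] := @ft_decay R d N rho.
exists (K * (B1 + B2)); first by rewrite mulr_ge0// addr_ge0.
move=> vs th z svs; rewrite kdiffs_ksym; last exact: cintegrable_entry.
rewrite normcM (_ : normc ((-1) ^+ _) = 1); last first.
  elim: (size vs) => [|k ih]; first by rewrite expr0 ComplexField.Normc.normc1.
  rewrite exprS normcM ih mulr1 (_ : -1 = (-1 : R)%:C); first by rewrite normcR normrN normr1.
  by apply: complex_eqP; rewrite /= ?oppr0.
rewrite mul1r -!mulrA.
have srvs : size (rev vs) = n by rewrite size_rev.
set P := \prod_(v <- vs) _; set S := _ `^ _.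
have PE : \prod_(v <- rev vs) japanese v = P by apply: perm_big; rewrite perm_rev.
have SE : \sum_(v <- rev vs) japanese v = \sum_(v <- vs) japanese v.
  by apply: perm_big; rewrite perm_rev.
have P0 : 0 <= P by apply: prodr_ge0 => v _; exact: japanese_ge0.
have S0 : 0 <= S by exact: powR_ge0.
have PS0 : 0 <= P * S by exact: mulr_ge0.
have H1' l h x : normc (diffs (nseq N (h *: ex l) ++ [seq ez v | v <- rev vs]) a (x, z)) <=
    `|h| ^+ N * (B1 * (P * S)).
  by have := H1 l h (rev vs) (x, z) srvs; rewrite PE SE -mulrA.
have H2' x : normc (diffs [seq ez v | v <- rev vs] a (x, z)) <= B2 * (P * S).
  (* No x-step is taken here, so the direction [i] and the step 0 are placeholders. *)
  by have := H2 i 0 (rev vs) (x, z) srvs; rewrite PE SE -mulrA expr0 mul1r.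
have supp us x y : rho < `|x| -> diffs [seq ez v | v <- us] a (x, y) = 0.
  move=> xr; elim: us y => [|v us ih] y /=; first by rewrite /entry /= Hrho// mxE.
  by rewrite add_ez !ih subrr.
apply: HK.
- exact: (cintegrable_diffs_ez (rev vs) cintegrable_entry z).1.
- by rewrite mulr_ge0// addr_ge0.
- by move=> x; apply: (le_trans (H2' x)); rewrite ler_wpM2r// lerDr.
- move=> x xr; exact: supp.
- move=> l h x h1; have h2 := H1' l h x; rewrite /diffs foldr_cat in h2.
  rewrite (@diffs_ex (diffs [seq ez v | v <- rev vs] a)); apply: (le_trans h2).
  by rewrite ler_wpM2l ?exprn_ge0// ler_wpM2r// lerDl.
Qed.

(** The growth bound is the case of no differences and no decay in [kdiffs_bound], with [m] rounded
    up to an integer. *)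
Lemma admissible_ksym : 0 <= m -> admissible (ksym a).
Proof.
move=> m0; split.
  apply: (cmeasurable_cintegral mu (F := fun w : (T * T) * T =>
    cis (- (2 * pi * dotR w.2 w.1.1)) * a (w.2, w.1.2))).
  apply: cmeasurableM.
    apply: cmeasurable_cis; apply: measurable_realfun.measurable_funN.
    apply: measurable_funM => //; apply: measurable_dotR => //.
    exact: measurableT_comp.
  apply: (cmeasurable_comp cmeasurable_entry).
  by apply/measurable_fun_pair => //=; exact: measurableT_comp.
have [C C0 HC] := @kdiffs_bound 0 0 m0.
exists C, (Num.trunc m).+1; split => // th z.
have := HC [::] th z erefl; rewrite !big_nil expr0 !mulr1 addr0 subr0 => h.
apply: (le_trans h); apply: ler_wpM2l => //.
rewrite -powR_mulrn ?japanese_ge0//; apply: ler_powR; first exact: japanese_ge1.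
exact: ltW (truncnS_gt _).
Qed.
End SymbolKernel.

(** * Distribution of the weight over the frequencies *)

Section WeightedKernel.
Context {R : realType} (d : nat).
Local Notation mu := (@lebesgue_rV R d).
Local Notation T := 'rV[R]_d.

Lemma powRD_le (s a b : R) : 0 <= s -> 0 <= a -> 0 <= b ->
  (a + b) `^ s <= 2 `^ s * (a `^ s + b `^ s).
Proof.
move=> s0 a0 b0; wlog ab : a b a0 b0 / a <= b.
  move=> H; have [ab|/ltW ba] := leP a b; first exact: H.
  by rewrite addrC [X in _ * X]addrC; exact: H.
apply: (@le_trans _ _ ((2 * b) `^ s)).
  by apply: ge0_ler_powR => //; rewrite ?nnegrE ?addr_ge0 ?mulr_ge0//; lra.
by rewrite powRM// ler_wpM2l ?powR_ge0// lerDr powR_ge0.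
Qed.

Lemma powR_sum_le (s a : R) (vs : seq T) : 0 <= s -> 0 <= a ->
  (a + \sum_(v <- vs) japanese v) `^ s <=
  (2 `^ s) ^+ size vs * (a `^ s + \sum_(v <- vs) japanese v `^ s).
Proof.
move=> s0; elim: vs a => [|v vs ih] a a0; first by rewrite !big_nil !addr0 mul1r.
rewrite !big_cons addrA /=; have jv := japanese_ge0 v.
apply: (le_trans (ih _ (addr_ge0 a0 jv))).
rewrite exprSr -mulrA; apply: ler_wpM2l; first by rewrite exprn_ge0// powR_ge0.
rewrite addrA [leRHS]mulrDr; apply: lerD; first exact: powRD_le.
rewrite ler_peMl ?sumr_ge0// => [v' _|]; first exact: powR_ge0.
by rewrite -[leLHS](powRr0 2) ler_powR//; lra.
Qed.

Lemma japanese_sum_le (x : T) (vs : seq T) :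
  japanese (x + \sum_(v <- vs) v) <= japanese x + \sum_(v <- vs) japanese v.
Proof.
elim: vs x => [|v vs ih] x; first by rewrite !big_nil !addr0.
rewrite !big_cons !addrA; apply: (le_trans (ih _)).
by rewrite lerD2r japanese_triangle.
Qed.

(** With X the sum of brackets in the second factor, the triangle inequality and 1 <= <th>, 1 <= X
    give a first bracket of at most 2 <th> X. The two powers of X then merge into X^(q-1), which
    [powR_sum_le] splits so that a single frequency carries the exponent. *)
Lemma weight_bound (q r : R) (th z : T) (vs : seq T) : 1 <= r -> r <= q ->
  japanese (th + \sum_(v <- vs) v + z) `^ (q - r) *
    (japanese z + \sum_(v <- vs) japanese v) `^ (r - 1) <=
  2 `^ (q - r) * (2 `^ (q - 1)) ^+ size vs *
    (japanese z `^ (q - 1) + \sum_(v <- vs) japanese v `^ (q - 1)) * japanese th `^ (q - r).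
Proof.
move=> r1 rq; set X := japanese z + _; have z1 := japanese_ge1 z; have t1 := japanese_ge1 th.
have X1 : 1 <= X by rewrite (le_trans z1)// lerDl sumr_ge0// => v _; exact: japanese_ge0.
have qr : 0 <= q - r by rewrite subr_ge0.
have le1 : japanese (th + \sum_(v <- vs) v + z) <= 2 * (japanese th * X).
  rewrite -addrA addrA -(addrA th) (addrC (\sum_(v <- vs) v)) addrA.
  apply: (le_trans (japanese_sum_le _ _)).
  have := japanese_triangle th z; rewrite /X in X1 *.
  move: (\sum_(v <- vs) japanese v) X1 => S X1 tz; nra.
apply: (@le_trans _ _ ((2 * (japanese th * X)) `^ (q - r) * X `^ (r - 1))).
  apply: ler_wpM2r; first exact: powR_ge0.
  by apply: ge0_ler_powR => //; rewrite nnegrE ?japanese_ge0// !mulr_ge0//; lra.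
have X0 : 0 <= X by lra.
have t0 := japanese_ge0 th.
rewrite powRM ?mulr_ge0// powRM//.
have -> : 2 `^ (q - r) * (japanese th `^ (q - r) * X `^ (q - r)) * X `^ (r - 1) =
    2 `^ (q - r) * japanese th `^ (q - r) * X `^ (q - 1).
  rewrite -!mulrA -powRD; last by rewrite (gt_eqF (lt_le_trans ltr01 X1)) implybT.
  by rewrite addrA subrK.
rewrite -!mulrA; apply: ler_wpM2l; first exact: powR_ge0.
rewrite mulrC mulrA; apply: ler_wpM2r; first exact: powR_ge0.
apply: powR_sum_le; [lra|exact: japanese_ge0].
Qed.

Variables (m : R) (p : symbol (R := R) d).
Hypotheses (pm : symbol_class m p) (sp : x_compact_support p).

(** [kcomms_bound] is used with [omega] the output weight, shifted by [z], and with [c] = <z>^(q-1),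
    the share of the weight that falls on the input frequency. *)
Lemma kcomms_ksym_bound (q r M : R) n (i j : 'I_d) : m = r + n%:R - 1 -> 1 <= r -> r <= q ->
  exists2 C : R, 0 <= C & forall (Fs : seq (rapid d)) th z, size Fs = n ->
  ((japanese (th + z) `^ (q - r) * normc (kcomms Fs (ksym (entry p i j)) th z))%:E <=
   C%:E * ((japanese z `^ (q - 1))%:E * Ecv M [seq rapid_density F | F <- Fs] th +
           Dcv (q - 1) M [seq rapid_density F | F <- Fs] th))%E.
Proof.
move=> mE r1 rq; have nm : n%:R <= m by lra.
have m0 : 0 <= m by apply: le_trans nm; exact: ler0n.
(* The decay in theta must pay for the weight <theta>^(q-r) and still leave <theta>^(-M). *)
pose N := (Num.trunc (`|M| + (q - r))).+1.
have NM : M + (q - r) <= N%:R.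
  by rewrite (le_trans _ (ltW (truncnS_gt _)))// lerD2r ler_norm.
have [C C0 HC] := kdiffs_bound pm sp i j N nm.
exists (C * (2 `^ (q - r) * (2 `^ (q - 1)) ^+ n)).
  by rewrite !mulr_ge0 ?exprn_ge0 ?powR_ge0.
move=> Fs th z sF.
apply: (@kcomms_bound _ _ (q - 1) M Fs (fun x => japanese (x + z) `^ (q - r))).
- exact: (admissible_ksym pm sp i j m0).
- by move=> x; exact: powR_ge0.
- by rewrite !mulr_ge0 ?exprn_ge0 ?powR_ge0.
- exact: powR_ge0.
move=> vs th'; rewrite sF => svs.
have := HC vs th' z svs; have := weight_bound th' z vs r1 rq.
rewrite svs (_ : m - n%:R = r - 1); last by rewrite mE; ring.
have P0 : 0 <= \prod_(v <- vs) japanese v by apply: prodr_ge0 => v _; exact: japanese_ge0.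
have S0 : 0 <= japanese z `^ (q - 1) + \sum_(v <- vs) japanese v `^ (q - 1).
  by rewrite addr_ge0 ?powR_ge0// sumr_ge0// => v _; exact: powR_ge0.
move: P0 S0; move: (\prod_(v <- vs) _) (_ + \sum_(v <- vs) _ `^ _) => P S P0 S0.
have c0 : 0 <= 2 `^ (q - r) * 2 `^ (q - 1) ^+ n by rewrite mulr_ge0 ?exprn_ge0 ?powR_ge0.
move: (2 `^ (q - r) * 2 `^ (q - 1) ^+ n) c0 => c c0.
have w0 := powR_ge0 (japanese (th' + \sum_(v <- vs) v + z)) (q - r).
move: (japanese (_ + z) `^ _) w0 => w w0.
have X0 := powR_ge0 (japanese z + \sum_(v <- vs) japanese v) (r - 1).
move: (_ `^ (r - 1)) X0 => X X0.
have k0 := normc_ge0 (kdiffs vs (ksym (entry p i j)) th' z).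
move: (normc _) k0 => k k0 wX kX.
have tN : japanese th' `^ (q - r) <= japanese th' `^ (- M) * japanese th' ^+ N.
  rewrite -powR_mulrn ?japanese_ge0// -powRD; last first.
    by rewrite (gt_eqF (japanese_gt0 _)) implybT.
  by apply: ler_powR; [exact: japanese_ge1|lra].
have t0 : 0 < japanese th' ^+ N by rewrite exprn_gt0// japanese_gt0.
rewrite -(ler_pM2r t0) -(mulrA w).
apply: (le_trans (ler_wpM2l w0 kX)).
have -> : w * (C * P * X) = C * P * (w * X) by ring.
have CP0 : 0 <= C * P by exact: mulr_ge0.
apply: (le_trans (ler_wpM2l CP0 wX)).
have cS0 : 0 <= c * S by exact: mulr_ge0.
apply: (le_trans (ler_wpM2l CP0 (ler_wpM2l cS0 tN))).
by rewrite le_eqVlt; apply/orP; left; apply/eqP; ring.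
Qed.
End WeightedKernel.

(** * Action of a kernel on a transform, and the commutator identity *)

Section Pairing.
Context {R : realType} (d : nat).
Local Notation mu := (@lebesgue_rV R d).
Local Notation T := 'rV[R]_d.
Implicit Types (F U : rapid (R := R) d) (k : T -> T -> R[i]) (a b : T -> R).

Definition majorant a := [/\ measurable_fun setT a, forall x, 0 <= a x &
  (\int[mu]_x (a x)%:E < +oo)%E].

Lemma majorantZ (C : R) a : 0 <= C -> majorant a -> majorant (fun x => C * a x).
Proof.
move=> C0 [ma a0 aoo]; split; first exact: measurable_funM.
  by move=> x; exact: mulr_ge0.
under eq_integral do rewrite EFinM.
rewrite ge0_integralZl//; last 2 first.
- exact/measurable_EFinP.
- by move=> x _; rewrite lee_fin.
by rewrite lte_mul_pinfty ?lee_fin.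
Qed.

Lemma majorant_rapid F (m : nat) : majorant (fun x => normc (F x) * japanese x ^+ m).
Proof.
split; [by apply/measurable_EFinP; exact: measurable_rapid_moment| |exact: rapid_moment].
by move=> x; rewrite mulr_ge0 ?normc_ge0// exprn_ge0// japanese_ge0.
Qed.

Lemma majorant_bracket (s : R) : d%:R < s -> majorant (fun x => japanese x `^ (- s)).
Proof.
move=> ds; split; [exact: measurable_powR_japanese|by move=> x; exact: powR_ge0|].
exact: integral_bracket.
Qed.

Lemma le_majorant_cintegrable a (f : T -> R[i]) : cmeasurable f -> majorant a ->
  (forall x, normc (f x) <= a x) -> cintegrable mu f.
Proof.
move=> mf [ma a0 aoo] fa.
apply: (le_cintegrable (g := fun x : T => (a x)%:E)) => //.
exact/measurable_EFinP.
Qed.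

Lemma fubini_majorant a b (G : T * T -> R[i]) : cmeasurable G -> majorant a -> majorant b ->
  (forall x y, normc (G (x, y)) <= a x * b y) ->
  [/\ forall x, cintegrable mu (fun y => G (x, y)),
      forall y, cintegrable mu (fun x => G (x, y)),
      cintegrable mu (fun x => cintegral mu (fun y => G (x, y))) &
      cintegral mu (fun x => cintegral mu (fun y => G (x, y))) =
      cintegral mu (fun y => cintegral mu (fun x => G (x, y)))].
Proof.
move=> mG [ma a0 aoo] [mb b0 boo] Gab; split.
- exact: (cintegrable_section1 mG mb a0 b0 boo Gab).
- exact: (cintegrable_section2 mG ma a0 b0 aoo Gab).
- exact: (@cintegrable_cintegral1 _ _ _ _ _ mu mu G a b mG ma mb a0 b0 aoo boo Gab).
- exact: (@cintegral_fubini _ _ _ _ _ mu mu G a b mG ma mb a0 b0 aoo boo Gab).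
Qed.

(** An operator with kernel [k], seen on the Fourier side: the input frequency is [z], the output
    frequency is [eta], and the first argument of [k] is the frequency transferred. *)
Definition pairing (U : T -> R[i]) k (eta : T) : R[i] :=
  cintegral mu (fun z => U z * k (eta - z) z).

Lemma cmeasurable_rapid_snd U : cmeasurable (fun w : T * T => U w.2).
Proof. by apply: (cmeasurable_comp (cmeasurable_rapid U)); exact: measurable_snd. Qed.

Lemma cmeasurable_rapid_fst U : cmeasurable (fun w : T * T => U w.1).
Proof. by apply: (cmeasurable_comp (cmeasurable_rapid U)); exact: measurable_fst. Qed.

Lemma cmeasurable_kernel k d' (X : measurableType d') (f g : X -> T) :
  cmeasurable (fun z : T * T => k z.1 z.2) -> measurable_fun setT f -> measurable_fun setT g ->
  cmeasurable (fun x => k (f x) (g x)).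
Proof.
move=> mk mf mg.
apply: (cmeasurable_comp (F := fun z : T * T => k z.1 z.2) (phi := fun x => (f x, g x))) => //.
exact: measurable_fun_pair.
Qed.

Lemma cintegrable_pairing U k eta : admissible k ->
  cintegrable mu (fun z => U z * k (eta - z) z).
Proof.
move=> [mk [C [m [C0 kC]]]].
apply: (le_majorant_cintegrable _ (majorantZ C0 (majorant_rapid U m))).
  apply: cmeasurableM; first exact: cmeasurable_rapid.
  by apply: cmeasurable_kernel => //; exact: measurable_rV_sub.
by move=> z; rewrite normcM mulrCA; apply: ler_wpM2l; [exact: normc_ge0|exact: kC].
Qed.

Definition rapid_conv F U : T -> R[i] := fun z => cintegral mu (fun xi => F xi * U (z - xi)).

(** The two terms are the transforms of f P u and of P (f u). In the second, the input frequency is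
    shifted by [xi] so that both integrands share the factor [F xi * U z]; what remains is a
    difference of kernels. *)
Lemma pairing_kcomm F U k eta : admissible k ->
  cintegrable mu (fun xi => F xi * pairing U k (eta - xi)) /\
  cintegral mu (fun xi => F xi * pairing U k (eta - xi)) - pairing (rapid_conv F U) k eta =
  pairing U (kcomm F k) eta.
Proof.
move=> ak; have [mk [C [m [C0 kC]]]] := ak.
pose a x := normc (F x) * japanese x ^+ m.
have Ma : majorant a := majorant_rapid F m.

(* The 1 is for the kernel at [z], the [2 ^+ m] for the kernel at [z + xi], where Peetre's
   inequality separates the variables. *)
pose b z := (C * (1 + 2 ^+ m)) * (normc (U z) * japanese z ^+ m).
have C20 : 0 <= C * (1 + 2 ^+ m) by rewrite mulr_ge0// addr_ge0// exprn_ge0.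
have Mb : majorant b := majorantZ C20 (majorant_rapid U m).
pose G1 (w : T * T) := F w.1 * (U w.2 * k (eta - w.1 - w.2) w.2).
pose G2 (w : T * T) := F w.1 * (U w.2 * k (eta - w.2 - w.1) (w.2 + w.1)).
have mG1 : cmeasurable G1.
  apply: cmeasurableM; first exact: cmeasurable_rapid_fst.
  apply: cmeasurableM; first exact: cmeasurable_rapid_snd.
  apply: cmeasurable_kernel => //; apply: measurable_rV_sub => //.
  exact: measurable_rV_sub.
have mG2 : cmeasurable G2.
  apply: cmeasurableM; first exact: cmeasurable_rapid_fst.
  apply: cmeasurableM; first exact: cmeasurable_rapid_snd.
  apply: cmeasurable_kernel => //; last exact: measurable_rV_add.
  by apply: measurable_rV_sub => //; exact: measurable_rV_sub.
have jx1 (x : T) : 1 <= japanese x ^+ m by rewrite exprn_ege1// japanese_ge1.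
have jx0 (x : T) : 0 <= japanese x ^+ m by rewrite exprn_ge0// japanese_ge0.
have key x y t : normc t <= C * (1 + 2 ^+ m) * japanese y ^+ m * japanese x ^+ m ->
    normc (F x * (U y * t)) <= a x * b y.
  move=> tC; rewrite !normcM /a /b -!mulrA; apply: ler_wpM2l; first exact: normc_ge0.
  rewrite mulrC [leRHS](_ : _ = C * (1 + 2 ^+ m) * japanese y ^+ m * japanese x ^+ m * normc (U y)).
    by apply: ler_wpM2r => //; exact: normc_ge0.
  by ring.
have G1ab x y : normc (G1 (x, y)) <= a x * b y.
  apply: key; apply: (le_trans (kC _ _)).
  rewrite -mulrA -mulrA; apply: ler_wpM2l => //.
  rewrite mulrCA ler_peMr//.
  by apply: (le_trans (jx1 x)); rewrite ler_peMl// lerDl exprn_ge0.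
have G2ab x y : normc (G2 (x, y)) <= a x * b y.
  apply: key; apply: (le_trans (kC _ _)).
  rewrite -!mulrA; apply: ler_wpM2l => //.
  apply: (le_trans (japanese_add_exp m y x)).
  rewrite -!mulrA; apply: ler_wpM2r; first exact: mulr_ge0.
  by rewrite lerDr.
have [G1x _ G1i _] := fubini_majorant mG1 Ma Mb G1ab.
have [G2x _ G2i _] := fubini_majorant mG2 Ma Mb G2ab.
have mG : cmeasurable (fun w => G1 w - G2 w) by exact: cmeasurableB.
have Gab x y : normc (G1 (x, y) - G2 (x, y)) <= a x * (2 * b y).
  apply: (le_trans (ler_normcB _ _)); apply: (le_trans (lerD (G1ab x y) (G2ab x y))).
  by rewrite le_eqVlt; apply/orP; left; apply/eqP; ring.
have [_ _ _ Gf] := fubini_majorant mG Ma (majorantZ (ler0n R 2) Mb) Gab.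
have AE : (fun xi => F xi * pairing U k (eta - xi)) =
    (fun xi => cintegral mu (fun z => G1 (xi, z))).
  apply/funext => xi.
  exact: (esym (cintegralZ (F xi) (cintegrable_pairing U (eta - xi) ak))).
have BE : pairing (rapid_conv F U) k eta = cintegral mu (fun xi => cintegral mu (fun z => G2 (xi, z))).
  (* Before the shift, [U] depends on [z - xi], and a product majorant must be recovered. Writing
     <z>^m as <z>^L <z>^(-(d+1)) and applying Peetre to <z>^L, the decay of [U] absorbs <z - xi>^L,
     the moments of [F] absorb <xi>^L, and <z>^(-(d+1)) is integrable. *)
  pose L := (m + d.+1)%N; have [BU BU0 HU] := rapid_decay U L.
  pose G3 (w : T * T) := F w.1 * (U (w.2 - w.1) * k (eta - w.2) w.2).
  have mG3 : cmeasurable G3.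
    apply: cmeasurableM; first exact: cmeasurable_rapid_fst.
    apply: cmeasurableM.
      by apply: (cmeasurable_comp (cmeasurable_rapid U)); exact: measurable_rV_sub.
    apply: (cmeasurable_kernel mk _ (@measurable_snd _ _ T T)).
    exact: (measurable_rV_sub (measurable_cst eta) (@measurable_snd _ _ T T)).
  have CB0 : 0 <= C * 2 ^+ L * BU by rewrite !mulr_ge0// exprn_ge0.
  have dd : d%:R < d.+1%:R :> R by rewrite ltr_nat.
  have G3ab x y : normc (G3 (x, y)) <=
      normc (F x) * japanese x ^+ L * (C * 2 ^+ L * BU * japanese y `^ (- d.+1%:R)).
    have -> : normc (G3 (x, y)) = normc (F x) * (normc (U (y - x)) * normc (k (eta - y) y)).
      by rewrite !normcM.
    rewrite -!mulrA; apply: ler_wpM2l; first exact: normc_ge0.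
    apply: (le_trans (ler_wpM2l (normc_ge0 _) (kC _ _))).
    rewrite mulrCA [leRHS]mulrCA; apply: ler_wpM2l; first exact: C0.
    have -> : japanese y ^+ m = japanese y ^+ L * japanese y `^ (- d.+1%:R).
      rewrite -(powR_mulrn m (japanese_ge0 y)) -(powR_mulrn L (japanese_ge0 y)) -powRD.
        by rewrite /L natrD addrK.
      by rewrite (gt_eqF (japanese_gt0 _)) implybT.
    rewrite !mulrA; apply: ler_wpM2r; first exact: powR_ge0.
    have jy : japanese y ^+ L <= 2 ^+ L * japanese (y - x) ^+ L * japanese x ^+ L.
      by rewrite -{1}(subrK x y); exact: japanese_add_exp.
    apply: (le_trans (ler_wpM2l (normc_ge0 _) jy)).
    rewrite [leLHS](_ : _ = japanese x ^+ L * 2 ^+ L * (normc (U (y - x)) * japanese (y - x) ^+ L)); last by ring.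
    by apply: ler_wpM2l; rewrite ?mulr_ge0 ?exprn_ge0 ?japanese_ge0.
  have [G3x G3y _ G3f] := fubini_majorant mG3 (majorant_rapid F L)
    (majorantZ CB0 (majorant_bracket dd)) G3ab.
  have -> : pairing (rapid_conv F U) k eta =
      cintegral mu (fun z => cintegral mu (fun xi => G3 (xi, z))).
    apply: eq_cintegral => z; rewrite mulrC.
    have iFU : cintegrable mu (fun xi => F xi * U (z - xi)).
      have [B B0 HB] := rapid_decay U 0.
      apply: (le_majorant_cintegrable _ (majorantZ B0 (majorant_rapid F 0))).
        apply: cmeasurableM; first exact: cmeasurable_rapid.
        apply: (cmeasurable_comp (cmeasurable_rapid U)).
        by apply: measurable_rV_sub.
      move=> xi; rewrite normcM expr0 mulr1 [leRHS]mulrC.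
      apply: ler_wpM2l; first exact: normc_ge0.
      by have := HB (z - xi); rewrite expr0 mulr1.
    rewrite -(cintegralZ (k (eta - z) z) iFU); apply: eq_cintegral => xi.
    by rewrite /G3 /= mulrC mulrA.
  rewrite -G3f; apply: eq_cintegral => xi.
  rewrite (cintegral_shift xi (G3x xi).1); apply: eq_cintegral => z.
  by rewrite /G3 /G2 /= addrK opprD addrA.
rewrite AE BE; split; first exact: G1i.
rewrite -(cintegralB G1i G2i); under eq_cintegral do rewrite -(cintegralB (G1x _) (G2x _)).
rewrite Gf /pairing; apply: eq_cintegral => z.
rewrite /kcomm -(cintegralZ (U z) (cintegrable_kcomm F (eta - z) z ak)).
apply: eq_cintegral => xi; rewrite /G1 /G2 /kdiff /=.
rewrite (addrAC eta (- xi)); move: (k _ _) (k _ _) => x y; ring.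
Qed.
End Pairing.

(** * Fourier-side formula for the operator and its iterated commutators *)

Section OperatorFormula.
Context {R : realType} (d : nat).
Local Notation mu := (@lebesgue_rV R d).
Local Notation T := 'rV[R]_d.
Local Notation V := ('rV[R]_d * 'rV[R]_d)%type.

Lemma test_moment (g : T -> R[i]) (m : nat) : test_cfun g ->
  (\int[mu]_x (normc (ft g x) * japanese x ^+ m)%:E < +oo)%E.
Proof.
move=> tg; have := test_ft_moment m%:R tg.
by under eq_integral do rewrite powR_mulrn ?japanese_ge0//.
Qed.

Definition rapid_ft (g : T -> R[i]) (tg : test_cfun g) : rapid (R := R) d :=
  Rapid (cmeasurable_ft (csmooth_cmeasurable (test_csmooth tg)))
    (fun m => test_moment m tg) (fun m => test_ft_decay m tg).

Record test_fun := TestFun { test_fun_val :> T -> R; test_funP : test_function test_fun_val }.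

Lemma test_fun_cfun (f : test_fun) : test_cfun (fun x => (f x)%:C).
Proof.
have [sf [K [cK fK]]] := test_funP f; split; last first.
  by exists K; split => // x /fK ->.
by split; [exact: sf|exact: smooth_cst0].
Qed.

Definition rapid_fun_of (f : test_fun) : rapid (R := R) d := rapid_ft (test_fun_cfun f).

Lemma test_cfunMr (f : test_fun) (g : T -> R[i]) : test_cfun g ->
  test_cfun (fun x => (f x)%:C * g x).
Proof.
move=> [[sR sI] [K [cK gK]]]; have [sf _] := test_funP f; split; last first.
  by exists K; split => // x /gK ->; rewrite mulr0.
split.
  under eq_fun do rewrite cReM /= mul0r subr0; exact: smoothM.
under eq_fun do rewrite cImM /= mul0r addr0; exact: smoothM.
Qed.

Variables (m : R) (P : operator (R := R) d) (p : symbol (R := R) d).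
Hypotheses (m0 : 0 <= m) (hP : Psi m P p) (sp : x_compact_support p).
Let pm : symbol_class m p := hP.1.

Lemma test_cvector_cfun (u : T -> 'cV[R[i]]_d) j : test_cvector u -> test_cfun (fun x => u x j 0).
Proof. by move=> tu; have [h1 h2] := tu j. Qed.

Lemma fourier_ft k (u : T -> 'cV[R[i]]_k) j xi : cmeasurable (fun x => u x j 0) ->
  fourier u xi j 0 = ft (fun x => u x j 0) xi.
Proof.
move=> mu_; rewrite mxE integralC_cintegral//.
by apply: cmeasurableM => //; exact: cmeasurable_phase.
Qed.

(** The oscillatory formula is transformed in [x] under the integral sign. Fubini is legitimate
    because compact support gives integrability in [x] and the rapid decay of the transform of [u]
    gives it in the frequency. *)
Lemma Op_formula i (u : T -> 'cV[R[i]]_d) : test_cvector u ->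
  cintegrable mu (fun x => P u x i 0) /\ forall eta, ft (fun x => P u x i 0) eta =
    \sum_j pairing (ft (fun x => u x j 0)) (ksym (entry p i j)) eta.
Proof.
move=> tu; pose U j := rapid_ft (test_cvector_cfun j tu).
have mu_ j : cmeasurable (fun x => u x j 0).
  exact: (csmooth_cmeasurable (test_csmooth (test_cvector_cfun j tu))).
pose H j (w : T * T) : R[i] := cis (2 * pi * dotR w.1 w.2) * (entry p i j w * U j w.2).
have mH j : cmeasurable (H j).
  apply: cmeasurableM.
    by apply: cmeasurable_character; [exact: measurable_fst|exact: measurable_snd].
  apply: cmeasurableM; last exact: cmeasurable_rapid_snd.
  exact: (cmeasurable_entry pm i j).
have [rho Hrho] := symbol_supported sp.
have dd : d%:R < d.+1%:R :> R by rewrite ltr_nat.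
(* On the ball containing the x-support, the constant 1 is dominated by an integrable power of the
   bracket. *)
have [L L0 HL] := @japanese_ball R d rho d.+1%:R (ler0n _ _).
have Hab j : exists a b, [/\ majorant a, majorant b &
    forall x xi, normc (entry p i j (x, xi) * U j xi) <= a x * b xi].
  have [B B0 HB] := entry_bound pm i j.
  pose k := (Num.trunc m).+1.
  exists (fun x => L * japanese x `^ (- d.+1%:R)), (fun xi => B * (normc (U j xi) * japanese xi ^+ k)).
  split; [exact: (majorantZ L0 (majorant_bracket dd))|exact: (majorantZ B0 (majorant_rapid _ k))|].
  move=> x xi; have b0 : 0 <= B * (normc (U j xi) * japanese xi ^+ k).
    by rewrite !mulr_ge0 ?normc_ge0 ?exprn_ge0 ?japanese_ge0.
  have [xr|xr] := leP `|x| rho; last first.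
    rewrite /entry /= Hrho// mxE mul0r ComplexField.Normc.normc0.
    by apply: mulr_ge0 => //; apply: mulr_ge0 => //; exact: powR_ge0.
  apply: (@le_trans _ _ (1 * (B * (normc (U j xi) * japanese xi ^+ k)))); last first.
    by apply: ler_wpM2r => //; exact: HL.
  rewrite mul1r normcM [leRHS]mulrCA mulrC; apply: ler_wpM2l; first exact: normc_ge0.
  apply: (le_trans (HB _)); apply: ler_wpM2l => //=.
  rewrite -(powR_mulrn k (japanese_ge0 xi)); apply: ler_powR; first exact: japanese_ge1.
  exact: ltW (truncnS_gt _).
have PE x : P u x i 0 = \sum_j cintegral mu (fun xi => H j (x, xi)).
  rewrite (hP.2 u tu) mxE integralC_cintegral; last first.
    apply: cmeasurableM.
      by apply: cmeasurable_character; [exact: measurable_cst|exact: measurable_id].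
    under eq_fun do rewrite mxE.
    apply: cmeasurable_sum => j; apply: cmeasurableM.
      exact: (cmeasurable_comp (cmeasurable_entry pm i j) (pair1_measurable x)).
    under eq_fun do rewrite fourier_ft//.
    exact: cmeasurable_rapid (U j).
  rewrite -cintegral_sum; last first.
    move=> j; have [a [b [Ma Mb ab]]] := Hab j.
    have [] := fubini_majorant (mH j) Ma Mb _; last by move=> h _ _ _; exact: h.
    by move=> y xi; rewrite /H normcM normc_cis mul1r.
  apply: eq_cintegral => xi; rewrite mxE mulr_sumr; apply: eq_bigr => j _.
  by rewrite fourier_ft.
have [iP EP] : (forall j, cintegrable mu (fun x => cintegral mu (fun xi => H j (x, xi)))) /\
  forall j eta, ft (fun x => cintegral mu (fun xi => H j (x, xi))) eta =
    pairing (U j) (ksym (entry p i j)) eta.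
  split=> j; have [a [b [Ma Mb ab]]] := Hab j.
    have HH x xi : normc (H j (x, xi)) <= a x * b xi by rewrite /H normcM normc_cis mul1r.
    by have [_ _ h _] := fubini_majorant (mH j) Ma Mb HH.
  move=> eta.
  pose G (w : T * T) := cis (- (2 * pi * dotR w.1 eta)) * H j w.
  have mG : cmeasurable G.
    apply: cmeasurableM; last exact: mH.
    exact: (cmeasurable_comp (cmeasurable_phase eta) measurable_fst).
  have Gab x xi : normc (G (x, xi)) <= a x * b xi.
    by rewrite /G /H !normcM !normc_cis !mul1r -normcM.
  have HH x xi : normc (H j (x, xi)) <= a x * b xi by rewrite /H normcM normc_cis mul1r.
  have [Hx _ _ _] := fubini_majorant (mH j) Ma Mb HH.
  have [_ _ _ GE] := fubini_majorant mG Ma Mb Gab.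
  have -> : ft (fun x => cintegral mu (fun xi => H j (x, xi))) eta =
      cintegral mu (fun x => cintegral mu (fun xi => G (x, xi))).
    apply: eq_cintegral => x.
    exact: (esym (cintegralZ (cis (- (2 * pi * dotR x eta))) (Hx x))).
  rewrite GE; apply: eq_cintegral => xi.
  have ie := cintegrable_phase (eta - xi) (cintegrable_entry pm sp i j xi).
  rewrite /ksym /ft -(cintegralZ (U j xi) ie); apply: eq_cintegral => x.
  have -> : cis (- (2 * pi * dotR x (eta - xi))) =
      cis (- (2 * pi * dotR x eta)) * cis (2 * pi * dotR x xi) :> R[i].
    rewrite -cisD dotRDr dotRNr; congr cis; move: (pi : R) => q; ring.
  by rewrite /G /H /=; move: (cis _) (cis _) (entry _ _ _ _) (ft _ _) => c1 c2 e v; ring.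
split; first by under eq_fun do rewrite PE; exact: cintegrable_sum.
move=> eta; rewrite (_ : (fun x => P u x i 0) = fun x => \sum_j cintegral mu (fun xi => H j (x, xi))); last first.
  by apply/funext => x; exact: PE.
rewrite /ft; under eq_cintegral do rewrite mulr_sumr.
rewrite cintegral_sum; last by move=> j; exact: cintegrable_phase.
by apply: eq_bigr => j _; exact: EP.
Qed.

(** The input [u] is quantified inside the induction because a commutator evaluates the shorter
    operator both at [u] and at f u, which is again a test vector. Integrability of the output is
    carried along for [ft_mul]. *)
Lemma S_op_formula (fs : seq test_fun) : forall i (u : T -> 'cV[R[i]]_d), test_cvector u ->
  cintegrable mu (fun x => S_op P (map test_fun_val fs) u x i 0) /\
  forall eta, ft (fun x => S_op P (map test_fun_val fs) u x i 0) eta =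
    \sum_j pairing (ft (fun x => u x j 0))
      (kcomms (map rapid_fun_of fs) (ksym (entry p i j))) eta.
Proof.
elim: fs => [|f fs ih] i u tu; first exact: Op_formula.
set Q := S_op P (map test_fun_val fs) in ih *.
pose fu := mulop f u; pose F := rapid_fun_of f.
have tf := test_fun_cfun f.
have tfu : test_cvector fu.
  move=> j; have [h1 h2] := test_cfunMr f (test_cvector_cfun j tu).
  by split; under eq_fun do rewrite mxE.
have [iQ EQ] := ih i u tu; have [iQf EQf] := ih i fu tfu.
have [rho [B [B0 fB _ _]]] := test_bounds 0 tf.
have ifQ : cintegrable mu (fun x => (f x)%:C * Q u x i 0).
  exact: (cintegrableMl (csmooth_cmeasurable (test_csmooth tf)) fB iQ).
have SE : (fun x => S_op P (map test_fun_val (f :: fs)) u x i 0) =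
    (fun x => (f x)%:C * Q u x i 0 - Q fu x i 0).
  by apply/funext => x; rewrite /= /commop /mulop !mxE.
rewrite SE; split; first exact: cintegrableB.
move=> eta; rewrite ftB// (ft_mul eta tf iQ) EQf.
pose k j := kcomms (map rapid_fun_of fs) (ksym (entry p i j)).
have ak j : admissible (k j) by apply: admissible_kcomms; exact: admissible_ksym pm sp i j m0.
pose U j := rapid_ft (test_cvector_cfun j tu).
have -> : cintegral mu (fun xi => ft (fun x => (f x)%:C) xi * ft (fun x => Q u x i 0) (eta - xi)) =
    \sum_j cintegral mu (fun xi => F xi * pairing (U j) (k j) (eta - xi)).
  rewrite -cintegral_sum; last by move=> j; exact: (pairing_kcomm F (U j) eta (ak j)).1.
  by apply: eq_cintegral => xi; rewrite EQ mulr_sumr.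
rewrite -sumrB; apply: eq_bigr => j _.
apply: (etrans _ (pairing_kcomm F (U j) eta (ak j)).2).
have -> : ft (fun x => fu x j 0) = rapid_conv F (U j).
  apply/funext => z.
  apply: (etrans _ (ft_mul z tf (test_cintegrable (test_cvector_cfun j tu)))).
  by apply: eq_cintegral => x; rewrite mxE.
by [].
Qed.
End OperatorFormula.

(** * Sobolev norms as weighted square masses *)

Section SobolevNorms.
Context {R : realType} (d : nat).
Local Notation mu := (@lebesgue_rV R d).
Local Notation T := 'rV[R]_d.

Lemma measurable_cnorm_fourier k (u : T -> 'cV[R[i]]_k) :
  (forall j, cmeasurable (fun x => u x j 0)) ->
  measurable_fun setT (fun x : T => cnorm (fourier u x)).
Proof.
move=> mu_; apply: (measurableT_comp (continuous_measurable_fun (@sqrt_continuous R))).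
apply: measurable_sum => j; apply: measurable_funX; apply: cmeasurable_normc.
under eq_fun do rewrite fourier_ft//.
exact: cmeasurable_ft.
Qed.

Lemma cnorm_ge0 k (v : 'cV[R[i]]_k) : 0 <= cnorm v.
Proof. exact: sqrtr_ge0. Qed.

Lemma normc_le_cnorm k (v : 'cV[R[i]]_k) j : normc (v j 0) <= cnorm v.
Proof.
rewrite -(ler_pXn2r (ltn0Sn 1)) ?nnegrE ?normc_ge0 ?cnorm_ge0// sqr_sqrtr; last first.
  by apply: sumr_ge0 => i _; exact: sqr_ge0.
by rewrite (bigD1 j)//= lerDl; apply: sumr_ge0 => i _; exact: sqr_ge0.
Qed.

Lemma cnorm_le_sum k (v : 'cV[R[i]]_k) : cnorm v <= \sum_j normc (v j 0).
Proof.
have s0 : 0 <= \sum_j normc (v j 0) by apply: sumr_ge0 => j _; exact: normc_ge0.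
rewrite -(ler_pXn2r (ltn0Sn 1)) ?nnegrE ?cnorm_ge0// sqr_sqrtr; last first.
  by apply: sumr_ge0 => i _; exact: sqr_ge0.
rewrite [leRHS]expr2 mulr_suml; apply: ler_sum => j _.
rewrite expr2; apply: ler_wpM2l; first exact: normc_ge0.
by rewrite (bigD1 j)//= lerDl; apply: sumr_ge0 => i _; exact: normc_ge0.
Qed.

Definition cnorm_density k (u : T -> 'cV[R[i]]_k) (mu_ : forall j, cmeasurable (fun x => u x j 0)) :
  density (R := R) d.
Proof.
apply: (@Density _ _ (fun x : T => (cnorm (fourier u x))%:E)).
  by apply/measurable_EFinP; exact: measurable_cnorm_fourier.
by move=> x; rewrite lee_fin cnorm_ge0.
Defined.

(** Squaring removes the root in [Lnorm]; the equality also covers an infinite norm, so finiteness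
    need not be established first. *)
Lemma sobolev_norm_sqr k (s : R) (u : T -> 'cV[R[i]]_k)
    (mu_ : forall j, cmeasurable (fun x => u x j 0)) :
  (sobolev_norm s u ^+ 2 = sqmass s (cnorm_density mu_))%E.
Proof.
have e2 (x : \bar R) : (0 <= x -> x `^ 2 = x ^+ 2)%E.
  by case: x => [x| |]// x0; rewrite ?poweR_EFin ?powR_mulrn// ?poweRyr.
have N0 : (0 <= sobolev_norm s u)%E by exact: Lnorm_ge0.
rewrite -e2// /sobolev_norm poweR_Lnorm ?pnatr_eq0//.
rewrite /sqmass (@integral_lebesgue_tuple R d (fun x => density_weight s (cnorm_density mu_) x ^+ 2)%E).
  by apply: eq_integral => t _; rewrite e2 ?abse_ge0// EFinM gee0_abs// mule_ge0// lee_fin ?powR_ge0 ?cnorm_ge0.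
under eq_fun do rewrite expe2.
by apply: emeasurable_funM; exact: measurable_density.
Qed.
End SobolevNorms.

(** * Pointwise estimate on the Fourier side *)

Section MainEstimate.
Context {R : realType} (d : nat).
Local Notation mu := (@lebesgue_rV R d).
Local Notation T := 'rV[R]_d.

(** One more convolution of the kind made in [kcomms_bound]: the term weighted at the input
    frequency and the one weighted at a later factor are the two terms of [Dcv] for the list headed
    by [W]. *)
Lemma pairing_bound (s M C w : R) (U : rapid (R := R) d) (W : density (R := R) d) gs k (eta : T) :
  admissible k -> 0 <= w -> 0 <= C -> (forall z, (normc (U z))%:E <= W z)%E ->
  (forall z, (w * normc (k (eta - z)%R z))%:E <=
    C%:E * ((japanese z `^ s)%:E * Ecv M gs (eta - z)%R + Dcv s M gs (eta - z)%R))%E ->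
  ((w * normc (pairing U k eta))%:E <= C%:E * Dcv s M (W :: gs) eta)%E.
Proof.
move=> ak w0 C0 UW H; have iU := cintegrable_pairing U eta ak.
have mN : measurable_fun setT (fun z : T => (normc (U z * k (eta - z) z))%:E).
  by apply/measurable_EFinP; exact: (cmeasurable_normc iU.1).
have mD (h : density d) : measurable_fun setT (fun z : T => h (eta - z)).
  by apply: (measurableT_comp (measurable_density h)); exact: measurable_rV_sub.
have mE := mD (Ecv M gs); have mDD := mD (Dcv s M gs).
have mW := measurable_density W; have mw := measurable_density (density_weight s W).
have E0 x := density_ge0 (Ecv M gs) x; have D0 x := density_ge0 (Dcv s M gs) x.
have W0 x := density_ge0 W x; have w00 x := density_ge0 (density_weight s W) x.
pose I2 z := (density_weight s W z * Ecv M gs (eta - z)%R)%E.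
pose I3 z := (W z * Dcv s M gs (eta - z)%R)%E.
have mI2 : measurable_fun setT I2 by exact: emeasurable_funM.
have mI3 : measurable_fun setT I3 by exact: emeasurable_funM.
have I20 z : (0 <= I2 z)%E by exact: mule_ge0.
have I30 z : (0 <= I3 z)%E by exact: mule_ge0.
have -> : (C%:E * Dcv s M (W :: gs) eta = \int[mu]_z (C%:E * (I2 z + I3 z)))%E.
  rewrite ge0_integralZl ?lee_fin//; last 2 first.
  - exact: emeasurable_funD.
  - by move=> x _; rewrite adde_ge0.
  by rewrite ge0_integralD.
rewrite EFinM.
apply: (@le_trans _ _ (\int[mu]_z (w%:E * (normc (U z * k (eta - z)%R z))%:E))%E).
  rewrite ge0_integralZl ?lee_fin//; last by move=> x _; rewrite lee_fin normc_ge0.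
  apply: lee_wpmul2l; first by rewrite lee_fin.
  exact: le_normc_cintegral.
apply: ge0_le_integral => //.
- by move=> x _; apply: mule_ge0; rewrite lee_fin ?normc_ge0.
- exact: measurable_funeM.
- by apply: measurable_funeM; exact: emeasurable_funD.
move=> z _; rewrite normcM -EFinM mulrCA EFinM.
have b0 : (0 <= (japanese z `^ s)%:E * Ecv M gs (eta - z)%R)%E.
  by apply: mule_ge0 => //; rewrite lee_fin powR_ge0.
have n0 : (0 <= (normc (U z))%:E)%E by rewrite lee_fin normc_ge0.
apply: (le_trans (lee_wpmul2l n0 (H z))).
apply: (@le_trans _ _ (W z * (C%:E * ((japanese z `^ s)%:E * Ecv M gs (eta - z)%R + Dcv s M gs (eta - z)%R)))%E).
  by apply: lee_wpmul2r; [apply: mule_ge0; rewrite ?lee_fin// adde_ge0|exact: UW].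
rewrite muleCA; apply: lee_wpmul2l; first by rewrite lee_fin.
rewrite ge0_muleDr// [I2 z](_ : _ = W z * ((japanese z `^ s)%:E * Ecv M gs (eta - z)%R))%E//.
by rewrite muleA; congr (_ * _)%E; rewrite muleC.
Qed.

Variables (n : nat) (q r : R) (P : operator (R := R) d) (p : symbol (R := R) d).
Hypotheses (hr : 1 <= r) (hrq : r <= q) (hP : Psi (r + n%:R - 1) P p)
  (sp : x_compact_support p).

Lemma test_cvector_cmeasurable (u : T -> 'cV[R[i]]_d) (tu : test_cvector u) j :
  cmeasurable (fun x => u x j 0).
Proof. exact: (csmooth_cmeasurable (test_csmooth (test_cvector_cfun j tu))). Qed.

(** The Euclidean norm is at most the sum of the moduli of the components, each of which is a sum
    over the entries of the symbol. The constants of the finitely many entries are added, and every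
    component of the transform of [u] is dominated by [cnorm_density]. *)
Lemma S_op_pointwise (M : R) : exists2 C : R, 0 <= C &
  forall (fs : seq (test_fun (R := R) d)) u (tu : test_cvector u) eta, size fs = n ->
  ((japanese eta `^ (q - r) * cnorm (fourier (S_op P (map (@test_fun_val _ _) fs) u) eta))%:E <=
   C%:E * Dcv (q - 1) M (cnorm_density (test_cvector_cmeasurable tu) ::
     [seq rapid_density F | F <- map (@rapid_fun_of _ _) fs]) eta)%E.
Proof.
have m0 : 0 <= r + n%:R - 1 by rewrite addrAC addr_ge0 ?subr_ge0// ler0n.
have /choice[C HC] : forall ij : 'I_d * 'I_d, exists C : R, 0 <= C /\
    forall (Fs : seq (rapid d)) th z, size Fs = n ->
    ((japanese (th + z) `^ (q - r) * normc (kcomms Fs (ksym (entry p ij.1 ij.2)) th z))%:E <=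
     C%:E * ((japanese z `^ (q - 1))%:E * Ecv M [seq rapid_density F | F <- Fs] th +
           Dcv (q - 1) M [seq rapid_density F | F <- Fs] th))%E.
  move=> [i j]; have [C C0 HC] := kcomms_ksym_bound hP.1 sp M i j erefl hr hrq.
  by exists C.
exists (\sum_ij C ij); first by apply: sumr_ge0 => ij _; exact: (HC ij).1.
move=> fs u tu eta sfs; set D := Dcv _ _ _ _.
have D0 : (0 <= D)%E by exact: density_ge0.
set v := S_op _ _ _; set w := _ `^ _; have w0 : 0 <= w by exact: powR_ge0.
pose U j := rapid_ft (test_cvector_cfun j tu).
pose k i j := kcomms (map (@rapid_fun_of _ _) fs) (ksym (entry p i j)).
have le1 : cnorm (fourier v eta) <= \sum_(ij : 'I_d * 'I_d) normc (pairing (U ij.2) (k ij.1 ij.2) eta).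
  apply: (le_trans (cnorm_le_sum _)).
  rewrite -(pair_bigA _ (fun i j => normc (pairing (U j) (k i j) eta)))/=; apply: ler_sum => i _.
  have [iv Ev] := S_op_formula m0 hP sp fs i tu.
  by rewrite fourier_ft ?Ev; [exact: normc_sum|exact: iv.1].
apply: (@le_trans _ _ (\sum_(ij : 'I_d * 'I_d) (w * normc (pairing (U ij.2) (k ij.1 ij.2) eta))%:E)%E).
  by rewrite sumEFin lee_fin -mulr_sumr; apply: ler_wpM2l.
rewrite -sumEFin ge0_sume_distrl; last by move=> ij _; rewrite lee_fin (HC ij).1.
apply: lee_sum => -[i j] _ /=.
apply: (@pairing_bound (q - 1) M (C (i, j)) w (U j) _ _ (k i j) eta _ w0 (HC (i, j)).1).
- by apply: admissible_kcomms; exact: (admissible_ksym hP.1 sp i j m0).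
- move=> z; rewrite lee_fin.
  apply: le_trans (normc_le_cnorm (fourier u z) j).
  by rewrite (fourier_ft _ (test_cvector_cmeasurable tu j)).
- move=> z; have := (HC (i, j)).2 (map (@rapid_fun_of _ _) fs) (eta - z) z.
  by rewrite subrK size_map => /(_ sfs).
Qed.
End MainEstimate.

(** * Passage to Sobolev norms and conclusion *)

Section Final.
Context {R : realType} (d : nat).
Local Notation mu := (@lebesgue_rV R d).
Local Notation T := 'rV[R]_d.

Lemma test_complexify (w : T -> 'cV[R]_d) : test_vector w -> test_cvector (complexify w).
Proof.
move=> tw i; have [h1 h2] := test_fun_cfun (TestFun (tw i)).
by split; under eq_fun do rewrite mxE.
Qed.

Lemma cmeasurable_scalar_field (f : test_fun (R := R) d) (j : 'I_1) :
  cmeasurable (fun x => complexify (scalar_field f) x j 0).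
Proof.
under eq_fun do rewrite !mxE.
exact: (csmooth_cmeasurable (test_csmooth (test_fun_cfun f))).
Qed.

(** The bracket built into [rapid_density] raises the weight from q - 1 to q, which is why the f_i
    are measured in H^q and w in H^(q-1). *)
Lemma sqmass_rapid_fun (q : R) (f : test_fun (R := R) d) :
  (sqmass (q - 1) (rapid_density (rapid_fun_of f)) =
   sobolev_norm q (complexify (scalar_field f)) ^+ 2)%E.
Proof.
rewrite (sobolev_norm_sqr q (cmeasurable_scalar_field f)).
apply: eq_integral => x _; congr (_ ^+ 2)%E; rewrite /= -EFinM; congr EFin.
rewrite /cnorm big_ord1 sqrtr_sqr ger0_norm ?normc_ge0//.
rewrite (fourier_ft _ (cmeasurable_scalar_field f ord0)).
rewrite (_ : ft _ x = ft (fun y => (f y)%:C) x); last first.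
  by congr (ft _ x); apply/funext => y; rewrite !mxE.
rewrite mulrA; congr (_ * _).
rewrite -[X in _ * X](powRr1 (japanese_ge0 x)) -powRD ?subrK//.
by rewrite (gt_eqF (japanese_gt0 _)) implybT.
Qed.
End Final.

Theorem theoremA1 (R : realType) (d n : nat) (q r : R)
    (hn : (1 <= n)%N) (hr : 1 <= r)
    (P : operator (R := R) d) (p : symbol (R := R) d)
    (hP : Psi (r + n%:R - 1) P p)
    (hherm : hermitian_symbol p) (hsupp : x_compact_support p)
    (hq : 1 + d%:R / 2 < q) (hrq : r <= q) :
  exists C : R, 0 < C /\
    forall (w : 'rV[R]_d -> 'cV[R]_d) (f : n.-tuple ('rV[R]_d -> R)),
      test_vector w -> (forall i, test_function (tnth f i)) ->
      (sobolev_norm (q - r) (S_op P f (complexify w)) <=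
        C%:E * (\prod_(i < n) sobolev_norm q (complexify (scalar_field (tnth f i))))
             * sobolev_norm (q - 1) (complexify w))%E.
Proof.
have dq : d%:R / 2 < q - 1 by rewrite ltrBrDl.
have dd : d%:R < d.+1%:R :> R by rewrite ltr_nat.
have m0 : 0 <= r + n%:R - 1 by rewrite addrAC addr_ge0 ?subr_ge0// ler0n.
(* Any decay exponent above d makes the last convolution factor integrable. *)
have [C C0 HC] := S_op_pointwise hr hrq hP hsupp d.+1%:R.
have [K K0 HK] := integral_sqr_Dcv dq dd n.+1.
pose c := C * Num.sqrt K.
have c0 : 0 <= c by rewrite mulr_ge0// sqrtr_ge0.
(* The added 1 ensures strict positivity, since [c] may vanish. *)
exists (c + 1); split; first by rewrite ltr_wpDl.
move=> w f tw tf.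
pose fs := [seq TestFun (tf i) | i <- enum 'I_n].
have fsE : map (@test_fun_val _ _) fs = f.
  by rewrite -map_comp -[RHS]map_tnth_enum.
have sfs : size fs = n by rewrite size_map size_enum_ord.
have tu := test_complexify tw.
set v := S_op P f _.
have mv j : cmeasurable (fun x => v x j 0).
  by have [h _] := S_op_formula m0 hP hsupp fs j tu; rewrite fsE in h; exact: h.1.
pose gs := cnorm_density (test_cvector_cmeasurable tu) ::
  [seq rapid_density F | F <- map (@rapid_fun_of _ _) fs].
have sgs : size gs = n.+1 by rewrite /= 2!size_map sfs.
have N0 s k (u : 'rV[R]_d -> 'cV[R[i]]_k) : (0 <= sobolev_norm s u)%E by exact: Lnorm_ge0.
set Nw := sobolev_norm (q - 1) _; set Nf := (\prod_(i < n) _)%E.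
have Nw0 : (0 <= Nw)%E := N0 _ _ _.
have Nf0 : (0 <= Nf)%E.
  by rewrite /Nf; elim/big_ind: _ => [//|x y|i _]; [exact: mule_ge0|exact: N0].
have PE : (\prod_(g <- gs) sqmass (q - 1) g = (Nf * Nw) ^+ 2)%E.
  rewrite big_cons -(sobolev_norm_sqr (q - 1) (test_cvector_cmeasurable tu)) -/Nw !expe2.
  rewrite 2!big_map /fs big_map big_enum /=.
  under eq_bigr do rewrite sqmass_rapid_fun expe2.
  by rewrite big_split [RHS]muleACA [LHS]muleC.
have D0 x := density_ge0 (Dcv (q - 1) d.+1%:R gs) x.
have mD2 : measurable_fun setT (fun x => Dcv (q - 1) d.+1%:R gs x ^+ 2)%E.
  by under eq_fun do rewrite expe2; apply: emeasurable_funM; exact: measurable_density.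
(* Squares are compared, because the convolution estimate bounds the integral of the square by a
   product of squared norms. *)
apply: lee_sqrE; first by rewrite !mule_ge0// lee_fin addr_ge0.
rewrite (sobolev_norm_sqr (q - r) mv).
apply: (@le_trans _ _ (\int[@lebesgue_rV R d]_x ((C ^+ 2)%:E * Dcv (q - 1) d.+1%:R gs x ^+ 2))%E).
  apply: ge0_le_integral.
  - exact: measurableT.
  - by move=> x _; exact: sqre_ge0.
  - by under eq_fun do rewrite expe2; apply: emeasurable_funM; exact: measurable_density.
  - exact: measurable_funeM.
  move=> x _; rewrite EFin_expe !expe2 [leRHS]muleACA -!expe2 lee_sqr.
  - have := HC fs (complexify w) tu x sfs; rewrite fsE; exact.
  - exact: density_ge0.
  - by rewrite mule_ge0// lee_fin.
rewrite ge0_integralZl//; last 2 first.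
- by move=> x _; exact: sqre_ge0.
- by rewrite lee_fin sqr_ge0.
have C20 : (0 <= (C ^+ 2)%:E)%E by rewrite lee_fin sqr_ge0.
apply: (le_trans (lee_wpmul2l C20 (HK gs sgs))).
rewrite PE muleA -EFinM -muleA [leRHS]expe2 [leRHS]muleACA -!expe2 -EFin_expe.
apply: lee_wpmul2r; first exact: sqre_ge0.
rewrite lee_fin (_ : _ * K = c ^+ 2); last by rewrite /c exprMn sqr_sqrtr.
by rewrite ler_pXn2r ?nnegrE ?addr_ge0// lerDl.
Qed.
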